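(* Let $\mathfrak{g}$ be a finite-dimensional Lie algebra over $\mathbb{C}$. If $\mathfrak{g}$ is non-solvable, or $\mathfrak{g}$ admits a non-abelian nilpotent homomorphic image, then $\mathfrak{g}$ is not rank-stable.
   Context: For $A\in M_n(F)$ over a field $F$ let $\operatorname{rank}(A)=\dim_F\operatorname{Im}A$ and let $\operatorname{rk}(A)=\frac1n\operatorname{rank}(A)$ (normalized rank). For $A\in M_n(F)$, $\widehat{A}$ is the finitely supported $\mathbb{N}\times\mathbb{N}$ matrix that agrees with $A$ in entries $(i,j)$ with $1\le i,j\le n$ and is zero elsewhere. Let $\operatorname{Lie}\langle x_1,\dots,x_d\rangle$ be the free Lie algebra over $F$ on $x_1,\dots,x_d$. A finitely presented Lie algebra $\operatorname{Lie}\langle x_1,\dots,x_d\rangle/\langle P_1,\dots,P_r\rangle$, where $P_1,\dots,P_r$ are Lie polynomials, is rank-stable if for every $\varepsilon>0$ there exists $\delta>0$ such that for every $n\ge 1$ and every tuple $A_1,\dots,A_d\in \mathfrak{gl}_n(F)=M_n(F)$ (with bracket $[a,b]=ab-ba$) satisfying $\operatorname{rk}P_i(A_1,\dots,A_d)<\delta$ for all $1\le i\le r$, there exist $n'\ge 1$ and $B_1,\dots,B_d\in \mathfrak{gl}_{n'}(F)$ with $P_i(B_1,\dots,B_d)=0$ for all $1\le i\le r$ and $\operatorname{rank}(\widehat{A_i}-\widehat{B_i})<\varepsilon n$ for all $1\le i\le d$. (This property does not depend on the chosen finite presentation.) Every finite-dimensional Lie algebra with basis $e_1,\dots,e_d$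 is finitely presented, with generators $e_1,\dots,e_d$ and relations $[e_i,e_j]-\sum_{k}\gamma_{ij}^k e_k$ for $1\le i<j\le d$, where $\gamma_{ij}^k\in F$ are its structure constants. *)

(* Defs.v *)
From HB Require Import structures.
From mathcomp Require Import all_boot all_order all_algebra.
From mathcomp Require Import boolp reals complex.
From mathcomp Require Import ring.

Set Implicit Arguments.
Unset Strict Implicit.
Unset Printing Implicit Defensive.

Import GRing.Theory Num.Theory.
Local Open Scope ring_scope.

HB.mixin Record Lmodule_isLie (F : fieldType) V of GRing.Lmodule F V := {
  lie : V -> V -> V;
  lieDl : forall x y z, lie (x + y) z = lie x z + lie y z;
  lieZl : forall (a : F) x y, lie (a *: x) y = a *: lie x y;
  lieDr : forall x y z, lie x (y + z) = lie x y + lie x z;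
  lieZr : forall (a : F) x y, lie x (a *: y) = a *: lie x y;
  liexx : forall x, lie x x = 0;
  lie_jacobi : forall x y z,
    lie x (lie y z) + lie y (lie z x) + lie z (lie x y) = 0
}.

#[short(type="lieType")]
HB.structure Definition LieAlgebra (F : fieldType) :=
  {V of GRing.Lmodule F V & Lmodule_isLie F V}.

#[short(type="finLieType")]
HB.structure Definition FinLieAlgebra (F : fieldType) :=
  {V of Vector F V & Lmodule_isLie F V}.

Definition lie_hom (F : fieldType) (g h : lieType F) (f : g -> h) : Prop :=
  linear f /\ forall x y, f (lie x y) = lie (f x) (f y).

Definition lie_abelian (F : fieldType) (g : lieType F) : Prop :=
  forall x y : g, lie x y = 0.

Definition lie_ideal (F : fieldType) (g : lieType F) (I : g -> Prop) : Prop :=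
  [/\ I 0,
      forall (a : F) x y, I x -> I y -> I (a *: x + y)
    & forall x y, I y -> I (lie x y)].

Definition gen_ideal (F : fieldType) (g : lieType F) (S : g -> Prop) (x : g) :
    Prop :=
  forall I : g -> Prop, lie_ideal I -> (forall s, S s -> I s) -> I x.

Section MatrixLie.
Variables (F : fieldType) (n : nat).
Implicit Types A B C : 'M[F]_n.

Definition mxlie A B := A *m B - B *m A.

Let mxlieDl A B C : mxlie (A + B) C = mxlie A C + mxlie B C.
Proof. by rewrite /mxlie mulmxDl mulmxDr opprD addrACA. Qed.
Let mxlieZl (a : F) A B : mxlie (a *: A) B = a *: mxlie A B.
Proof. by rewrite /mxlie -scalemxAl -scalemxAr scalerBr. Qed.
Let mxlieDr A B C : mxlie A (B + C) = mxlie A B + mxlie A C.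
Proof. by rewrite /mxlie mulmxDl mulmxDr opprD addrACA. Qed.
Let mxlieZr (a : F) A B : mxlie A (a *: B) = a *: mxlie A B.
Proof. by rewrite /mxlie -scalemxAl -scalemxAr scalerBr. Qed.
Let mxliexx A : mxlie A A = 0.
Proof. by rewrite /mxlie subrr. Qed.
Let mxlie_jacobi A B C :
  mxlie A (mxlie B C) + mxlie B (mxlie C A) + mxlie C (mxlie A B) = 0.
Proof.
rewrite /mxlie !mulmxBl !mulmxBr !mulmxA !opprB.
by apply/matrixP => i j; rewrite !mxE; ring.
Qed.

HB.instance Definition _ := Lmodule_isLie.Build F 'M[F]_n
  mxlieDl mxlieZl mxlieDr mxlieZr mxliexx mxlie_jacobi.
End MatrixLie.

Inductive lie_term (F : Type) (d : nat) : Type :=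
| LVar of 'I_d
| LZero
| LAdd of lie_term F d & lie_term F d
| LScale of F & lie_term F d
| LBracket of lie_term F d & lie_term F d.
Arguments LVar {F d}.
Arguments LZero {F d}.

HB.instance Definition _ (F : Type) d := gen_eqMixin (lie_term F d).
HB.instance Definition _ (F : Type) d := gen_choiceMixin (lie_term F d).

(* The least congruence that contains the axioms of Lie algebras. *)
Inductive lie_equiv (F : fieldType) (d : nat) :
    lie_term F d -> lie_term F d -> Prop :=
| LE_refl t : lie_equiv t t
| LE_sym t u : lie_equiv t u -> lie_equiv u t
| LE_trans t u v : lie_equiv t u -> lie_equiv u v -> lie_equiv t v
| LE_add t t' u u' :
    lie_equiv t t' -> lie_equiv u u' -> lie_equiv (LAdd t u) (LAdd t' u')
| LE_scale a t t' : lie_equiv t t' -> lie_equiv (LScale a t) (LScale a t')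
| LE_bracket t t' u u' :
    lie_equiv t t' -> lie_equiv u u' ->
    lie_equiv (LBracket t u) (LBracket t' u')
| LE_addA t u v : lie_equiv (LAdd t (LAdd u v)) (LAdd (LAdd t u) v)
| LE_addC t u : lie_equiv (LAdd t u) (LAdd u t)
| LE_add0 t : lie_equiv (LAdd LZero t) t
| LE_addN t : lie_equiv (LAdd (LScale (-1) t) t) LZero
| LE_scaleA a b t : lie_equiv (LScale a (LScale b t)) (LScale (a * b) t)
| LE_scale1 t : lie_equiv (LScale 1 t) t
| LE_scaleDr a t u :
    lie_equiv (LScale a (LAdd t u)) (LAdd (LScale a t) (LScale a u))
| LE_scaleDl a b t :
    lie_equiv (LScale (a + b) t) (LAdd (LScale a t) (LScale b t))
| LE_bracketDl t u v :
    lie_equiv (LBracket (LAdd t u) v) (LAdd (LBracket t v) (LBracket u v))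
| LE_bracketZl a t u :
    lie_equiv (LBracket (LScale a t) u) (LScale a (LBracket t u))
| LE_bracketDr t u v :
    lie_equiv (LBracket t (LAdd u v)) (LAdd (LBracket t u) (LBracket t v))
| LE_bracketZr a t u :
    lie_equiv (LBracket t (LScale a u)) (LScale a (LBracket t u))
| LE_bracketxx t : lie_equiv (LBracket t t) LZero
| LE_jacobi t u v :
    lie_equiv (LAdd (LAdd (LBracket t (LBracket u v))
                          (LBracket u (LBracket v t)))
                    (LBracket v (LBracket t u))) LZero.

Local Open Scope quotient_scope.

Section FreeLie.
Variables (F : fieldType) (d : nat).

Definition lie_equivb (t u : lie_term F d) : bool := `[< lie_equiv t u >].

Lemma lie_equivb_refl : reflexive lie_equivb.
Proof. by move=> t; apply/asboolP; apply: LE_refl. Qed.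
Lemma lie_equivb_sym : symmetric lie_equivb.
Proof. by move=> t u; apply/asboolP/asboolP; apply: LE_sym. Qed.
Lemma lie_equivb_trans : transitive lie_equivb.
Proof.
by move=> u t v /asboolP tu /asboolP uv; apply/asboolP; apply: LE_trans uv.
Qed.

Canonical lie_equivb_equiv :=
  EquivRel lie_equivb lie_equivb_refl lie_equivb_sym lie_equivb_trans.

Definition freeLie := {eq_quot lie_equivb}.

HB.instance Definition _ : EqQuotient _ lie_equivb freeLie :=
  EqQuotient.on freeLie.
HB.instance Definition _ := Choice.on freeLie.

Definition fl_pi (t : lie_term F d) : freeLie := \pi_freeLie t.

Lemma fl_piP t u : lie_equiv t u -> fl_pi t = fl_pi u.
Proof. by move=> tu; apply/eqquotP/asboolP. Qed.

Lemma fl_repr t : lie_equiv (repr (fl_pi t)) t.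
Proof. by apply/asboolP/(@eqquotP _ _ freeLie); rewrite reprK. Qed.

Lemma fl_piK (p : freeLie) : fl_pi (repr p) = p.
Proof. exact: reprK. Qed.

Definition fl_add (p q : freeLie) := fl_pi (LAdd (repr p) (repr q)).
Definition fl_opp (p : freeLie) := fl_pi (LScale (-1) (repr p)).
Definition fl_scale (a : F) (p : freeLie) := fl_pi (LScale a (repr p)).
Definition fl_bracket (p q : freeLie) := fl_pi (LBracket (repr p) (repr q)).

Lemma fl_addE t u : fl_add (fl_pi t) (fl_pi u) = fl_pi (LAdd t u).
Proof. by apply: fl_piP; apply: LE_add; apply: fl_repr. Qed.
Lemma fl_oppE t : fl_opp (fl_pi t) = fl_pi (LScale (-1) t).
Proof. by apply: fl_piP; apply: LE_scale; apply: fl_repr. Qed.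
Lemma fl_scaleE a t : fl_scale a (fl_pi t) = fl_pi (LScale a t).
Proof. by apply: fl_piP; apply: LE_scale; apply: fl_repr. Qed.
Lemma fl_bracketE t u : fl_bracket (fl_pi t) (fl_pi u) = fl_pi (LBracket t u).
Proof. by apply: fl_piP; apply: LE_bracket; apply: fl_repr. Qed.

Let flE := (fl_addE, fl_oppE, fl_scaleE, fl_bracketE).

Let fl_addA : associative fl_add.
Proof.
move=> p q r; rewrite -[p]fl_piK -[q]fl_piK -[r]fl_piK !flE.
exact/fl_piP/LE_addA.
Qed.
Let fl_addC : commutative fl_add.
Proof.
by move=> p q; rewrite -[p]fl_piK -[q]fl_piK !flE; apply/fl_piP/LE_addC.
Qed.
Let fl_add0 : left_id (fl_pi LZero) fl_add.
Proof. by move=> p; rewrite -[p]fl_piK !flE; apply/fl_piP/LE_add0. Qed.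
Let fl_addN : left_inverse (fl_pi LZero) fl_opp fl_add.
Proof. by move=> p; rewrite -[p]fl_piK !flE; apply/fl_piP/LE_addN. Qed.

HB.instance Definition _ :=
  GRing.isZmodule.Build freeLie fl_addA fl_addC fl_add0 fl_addN.

Let fl_scaleA a b p : fl_scale a (fl_scale b p) = fl_scale (a * b) p.
Proof. by rewrite -[p]fl_piK !flE; apply/fl_piP/LE_scaleA. Qed.
Let fl_scale1 : left_id 1 fl_scale.
Proof. by move=> p; rewrite -[p]fl_piK !flE; apply/fl_piP/LE_scale1. Qed.
Let fl_scaleDr : right_distributive fl_scale +%R.
Proof.
move=> a p q; rewrite -[p]fl_piK -[q]fl_piK.
rewrite -[LHS]/(fl_scale a (fl_add _ _)) -[RHS]/(fl_add _ _) !flE.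
exact/fl_piP/LE_scaleDr.
Qed.
Let fl_scaleDl p : {morph fl_scale^~ p : a b / a + b}.
Proof.
move=> a b /=; rewrite -[p]fl_piK -[RHS]/(fl_add _ _) !flE.
exact/fl_piP/LE_scaleDl.
Qed.

HB.instance Definition _ := GRing.Zmodule_isLmodule.Build F freeLie
  fl_scaleA fl_scale1 fl_scaleDr fl_scaleDl.

Lemma fl_piD t u : fl_pi (LAdd t u) = fl_pi t + fl_pi u.
Proof. by rewrite -fl_addE. Qed.
Lemma fl_piZ a t : fl_pi (LScale a t) = a *: fl_pi t.
Proof. by rewrite -fl_scaleE. Qed.
Lemma fl_pi0 : fl_pi LZero = 0.
Proof. by []. Qed.

Let fl_bracketDl p q r :
  fl_bracket (p + q) r = fl_bracket p r + fl_bracket q r.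
Proof.
rewrite -[p]fl_piK -[q]fl_piK -[r]fl_piK -fl_piD !flE -fl_piD.
exact/fl_piP/LE_bracketDl.
Qed.
Let fl_bracketZl a p q : fl_bracket (a *: p) q = a *: fl_bracket p q.
Proof.
rewrite -[p]fl_piK -[q]fl_piK -fl_piZ !flE -fl_piZ.
exact/fl_piP/LE_bracketZl.
Qed.
Let fl_bracketDr p q r :
  fl_bracket p (q + r) = fl_bracket p q + fl_bracket p r.
Proof.
rewrite -[p]fl_piK -[q]fl_piK -[r]fl_piK -fl_piD !flE -fl_piD.
exact/fl_piP/LE_bracketDr.
Qed.
Let fl_bracketZr a p q : fl_bracket p (a *: q) = a *: fl_bracket p q.
Proof.
rewrite -[p]fl_piK -[q]fl_piK -fl_piZ !flE -fl_piZ.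
exact/fl_piP/LE_bracketZr.
Qed.
Let fl_bracketxx p : fl_bracket p p = 0.
Proof. by rewrite -[p]fl_piK !flE; apply/fl_piP/LE_bracketxx. Qed.
Let fl_jacobi p q r :
  fl_bracket p (fl_bracket q r) + fl_bracket q (fl_bracket r p)
    + fl_bracket r (fl_bracket p q) = 0.
Proof.
rewrite -[p]fl_piK -[q]fl_piK -[r]fl_piK !flE -!fl_piD.
exact/fl_piP/LE_jacobi.
Qed.

HB.instance Definition _ := Lmodule_isLie.Build F freeLie
  fl_bracketDl fl_bracketZl fl_bracketDr fl_bracketZr fl_bracketxx fl_jacobi.

Lemma fl_piL t u : fl_pi (LBracket t u) = lie (fl_pi t) (fl_pi u).
Proof. by rewrite -fl_bracketE. Qed.

Definition fl_var (i : 'I_d) : freeLie := fl_pi (LVar i).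

End FreeLie.

Local Close Scope quotient_scope.

Section Eval.
Variables (F : fieldType) (d : nat) (g : lieType F) (a : 'I_d -> g).

Fixpoint lie_term_eval (t : lie_term F d) : g :=
  match t with
  | LVar i => a i
  | LZero => 0
  | LAdd t u => lie_term_eval t + lie_term_eval u
  | LScale c t => c *: lie_term_eval t
  | LBracket t u => lie (lie_term_eval t) (lie_term_eval u)
  end.

(* Independent of the representative: see [lie_eval_pi]. *)
Definition lie_eval (p : freeLie F d) : g := lie_term_eval (repr p).

Lemma lie_term_eval_equiv t u :
  lie_equiv t u -> lie_term_eval t = lie_term_eval u.
Proof.
elim=> //= {t u}.
- by move=> t u v _ -> _ ->.
- by move=> t t' u u' _ -> _ ->.
- by move=> c t t' _ ->.
- by move=> t t' u u' _ -> _ ->.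
- by move=> t u v; rewrite addrA.
- by move=> t u; rewrite addrC.
- by move=> t; rewrite add0r.
- by move=> t; rewrite scaleN1r addNr.
- by move=> b c t; rewrite scalerA.
- by move=> t; rewrite scale1r.
- by move=> b t u; rewrite scalerDr.
- by move=> b c t; rewrite scalerDl.
- by move=> t u v; rewrite lieDl.
- by move=> b t u; rewrite lieZl.
- by move=> t u v; rewrite lieDr.
- by move=> b t u; rewrite lieZr.
- by move=> t; rewrite liexx.
- by move=> t u v; rewrite lie_jacobi.
Qed.

Lemma lie_eval_pi t : lie_eval (fl_pi t) = lie_term_eval t.
Proof. exact/lie_term_eval_equiv/fl_repr. Qed.

Lemma lie_eval_var i : lie_eval (fl_var F i) = a i.
Proof. exact: lie_eval_pi. Qed.

Lemma lie_eval_hom : lie_hom lie_eval.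
Proof.
split=> [c p q|p q]; rewrite -[p]fl_piK -[q]fl_piK.
  by rewrite -fl_piZ -fl_piD !lie_eval_pi.
by rewrite -fl_piL !lie_eval_pi.
Qed.

Lemma lie_eval_unique (f : freeLie F d -> g) :
  lie_hom f -> (forall i, f (fl_var F i) = a i) -> f =1 lie_eval.
Proof.
move=> [lin_f lie_f] f_var p; rewrite -[p]fl_piK lie_eval_pi.
have f0 : f 0 = 0 by have := lin_f (-1) 0 0; rewrite scaler0 addr0 scaleN1r addNr.
elim: (repr p) => //= [t IHt u IHu|c t IHt|t IHt u IHu].
- by rewrite fl_piD -[fl_pi t]scale1r lin_f scale1r IHt IHu.
- by rewrite fl_piZ -[_ *: _]addr0 lin_f f0 addr0 IHt.
- by rewrite fl_piL lie_f IHt IHu.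
Qed.

End Eval.

Section RankStable.
Variables (R : realType) (F : fieldType).

Definition rk n (A : 'M[F]_n) : R := (\rank A)%:R / n%:R.

(* The N x N matrix which extends A by zero. *)
Definition hatmx n (A : 'M[F]_n) (i j : nat) : F :=
  match insub i, insub j with
  | Some i', Some j' => A i' j'
  | _, _ => 0
  end.

(* [hatmx A - hatmx B] is supported on its upper left square block of size
   [maxn n n'], so its rank is the rank of this block. *)
Definition rank_hat_sub n n' (A : 'M[F]_n) (B : 'M[F]_n') : nat :=
  \rank (\matrix_(i < maxn n n', j < maxn n n') (hatmx A i j - hatmx B i j)).

Definition rank_stable_presentation d r (P : 'I_r -> freeLie F d) : Prop :=
  forall eps : R, 0 < eps -> exists2 delta : R, 0 < delta &
    forall n (A : 'I_d -> 'M[F]_n), (0 < n)%N ->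
      (forall i, rk (lie_eval A (P i)) < delta) ->
      exists n' (B : 'I_d -> 'M[F]_n'),
        [/\ (0 < n')%N,
            forall i, lie_eval B (P i) = 0
          & forall i, (rank_hat_sub (A i) (B i))%:R < eps * n%:R].

(* The morphism Lie<x_0, ..., x_(d-1)> -> g which sends each x_i to [a i]
   induces an isomorphism Lie<x_0, ..., x_(d-1)> / <P_0, ..., P_(r-1)> -> g. *)
Definition lie_presents d r (P : 'I_r -> freeLie F d) (g : lieType F)
    (a : 'I_d -> g) : Prop :=
  (forall x : g, exists p, lie_eval a p = x) /\
  (forall p, lie_eval a p = 0 <-> gen_ideal (fun q => exists i, q = P i) p).

(* Rank-stability of [P] only depends on the Lie algebra which it presents, so
   the choice of a finite presentation is immaterial. *)
Definition rank_stable (g : lieType F) : Prop :=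
  exists d r (P : 'I_r -> freeLie F d) (a : 'I_d -> g),
    lie_presents P a /\ rank_stable_presentation P.

End RankStable.

Section Series.
Variables (F : fieldType) (g : finLieType F).

(* The span of all [lie u v] with u in U and v in V: see [memv_lie] and
   [lie_vspaceP]. *)
Definition lie_vspace (U V : {vspace g}) : {vspace g} :=
  <<[seq lie u v | u <- vbasis U, v <- vbasis V]>>%VS.

Lemma lie_sumr (I : Type) (s : seq I) (x : g) (f : I -> g) :
  lie x (\sum_(i <- s) f i) = \sum_(i <- s) lie x (f i).
Proof.
elim: s => [|i s IHs]; last by rewrite !big_cons lieDr IHs.
by rewrite !big_nil -(scale0r (0 : g)) lieZr !scale0r.
Qed.

Lemma lie_suml (I : Type) (s : seq I) (x : g) (f : I -> g) :
  lie (\sum_(i <- s) f i) x = \sum_(i <- s) lie (f i) x.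
Proof.
elim: s => [|i s IHs]; last by rewrite !big_cons lieDl IHs.
by rewrite !big_nil -(scale0r (0 : g)) lieZl !scale0r.
Qed.

Lemma memv_lie (U V : {vspace g}) :
  {in U & V, forall u v, lie u v \in lie_vspace U V}.
Proof.
move=> u v /coord_vbasis-> /coord_vbasis->.
rewrite lie_suml; apply: memv_suml => i _.
rewrite lie_sumr; apply: memv_suml => j _.
rewrite lieZl lieZr !memvZ // memv_span //.
by apply/allpairsP; exists ((vbasis U)`_i, (vbasis V)`_j); rewrite !memt_nth.
Qed.

Lemma lie_vspaceP (U V W : {vspace g}) :
  reflect {in U & V, forall u v, lie u v \in W} (lie_vspace U V <= W)%VS.
Proof.
apply: (iffP idP) => [sW u v uU vV|UVW].
  exact: (subvP sW) (memv_lie uU vV).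
apply/span_subvP => _ /allpairsP[[u v] /= [uU vV ->]].
by apply: UVW; apply: vbasis_mem.
Qed.

Definition derived_series (k : nat) : {vspace g} :=
  iter k (fun U => lie_vspace U U) fullv.

Definition lower_central_series (k : nat) : {vspace g} :=
  iter k (lie_vspace fullv) fullv.

Definition lie_solvable : Prop := exists k, derived_series k = 0%VS.

Definition lie_nilpotent : Prop := exists k, lower_central_series k = 0%VS.

End Series.

Definition has_nonabelian_nilpotent_image (F : fieldType) (g : finLieType F) :
    Prop :=
  exists (h : finLieType F) (f : g -> h),
    [/\ lie_hom f, forall y, exists x, f x = y, lie_nilpotent h
      & ~ lie_abelian h].

(* Main.v *)
(** Proof idea.  Let [s] be a quotient of [g] and [z] an element of degree at
most 2 of the enveloping algebra [U(s)], central in every representation.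
Suppose that [s] has approximate representations on which [z] is approximately
a scalar [c <> 0].  If [g] were rank-stable, they would be close in rank to
genuine representations [b] of [g].  The image under [b] of the kernel of
[g -> s] spans a small submodule; modulo it, [z] still has the eigenvalue [c],
and the eigenspace is a nonzero genuine representation of [s] on which [z = c].
It remains to find [s], [z] and [c] for which there is none.

If [g] has a non-abelian nilpotent image, take [s] nonabelian with
[[s, [s, s]] = 0], [z = [x, y] <> 0] and [c = 1]: a commutator has trace 0, and
[s] acts approximately by truncated differential operators of order 1.

If [g] is not solvable, let [s] be a nonsolvable quotient of least dimension.
Its Killing form is nondegenerate: otherwise its radical contains a nonzero
perfect ideal [P]; for [x] in [P] the operator acting by the complex conjugate
of the eigenvalue on the generalized eigenspaces of [ad x] is a derivation,
whence [\sum |lambda|^2 = 0] over the eigenvalues, [ad x] is nilpotent, and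
Engel's theorem contradicts [P = [P, P]].  Take for [z] the Casimir element and
for [c] a number transcendental over the field generated by the structure
constants.  If [z = c] in a representation, apply to the matrix entries a field
derivation which kills the structure constants and maps [c] to 1: this yields a
cocycle whose trace pairing with the representation is skew, whereas the
derivative of the Casimir element has trace [1 * dim].  Finally [U(s) / (z - c)]
has polynomial growth, so that its truncations are approximate representations;
it is nonzero for some such [c], since otherwise [z - c] would be invertible
with an inverse of bounded degree for infinitely many [c], and [z] would be
algebraic, whereas its average eigenvalue on the [k]-th tensor power of the
adjoint representation is [k]. *)
Require Import Defs.
From HB Require Import structures.
From mathcomp Require Import all_boot all_order all_algebra.
From mathcomp Require Import boolp classical_sets reals complex mxtens.
From mathcomp Require Import ring lra zify.

Set Implicit Arguments.
Unset Strict Implicit.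
Unset Printing Implicit Defensive.

Import Order.TTheory GRing.Theory Num.Theory.
Local Open Scope ring_scope.

(** * Linear maps, brackets and rank estimates *)

Section LinearFacts.
Variables (F : fieldType) (U V : lmodType F) (f : U -> V).
Hypothesis lin_f : linear f.

Lemma lin0 : f 0 = 0.
Proof. by have := lin_f (-1) 0 0; rewrite scaler0 addr0 scaleN1r addNr. Qed.

Lemma linD x y : f (x + y) = f x + f y.
Proof. by have := lin_f 1 x y; rewrite !scale1r. Qed.

Lemma linZ a x : f (a *: x) = a *: f x.
Proof. by have := lin_f a x 0; rewrite !addr0 lin0 addr0. Qed.

Lemma linN x : f (- x) = - f x.
Proof. by rewrite -scaleN1r linZ scaleN1r. Qed.

Lemma linB x y : f (x - y) = f x - f y.
Proof. by rewrite linD linN. Qed.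

Lemma lin_sum I (r : seq I) (P : pred I) (E : I -> U) :
  f (\sum_(i <- r | P i) E i) = \sum_(i <- r | P i) f (E i).
Proof.
by elim/big_rec2: _ => [|i u v _ <-]; rewrite ?lin0 ?linD.
Qed.

End LinearFacts.

Section LieFacts.
Variables (F : fieldType) (g : lieType F).
Implicit Types x y z : g.

Lemma lie0x x : lie 0 x = 0.
Proof. by rewrite -(scale0r (0 : g)) lieZl !scale0r. Qed.

Lemma liex0 x : lie x 0 = 0.
Proof. by rewrite -(scale0r (0 : g)) lieZr !scale0r. Qed.

Lemma lieNl x y : lie (- x) y = - lie x y.
Proof. by rewrite -scaleN1r lieZl scaleN1r. Qed.

Lemma lieNr x y : lie x (- y) = - lie x y.
Proof. by rewrite -scaleN1r lieZr scaleN1r. Qed.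

Lemma lieBl x y z : lie (x - y) z = lie x z - lie y z.
Proof. by rewrite lieDl lieNl. Qed.

Lemma lieBr x y z : lie x (y - z) = lie x y - lie x z.
Proof. by rewrite lieDr lieNr. Qed.

Lemma lieC x y : lie x y = - lie y x.
Proof.
apply/eqP; rewrite -addr_eq0; apply/eqP.
by have := liexx (x + y); rewrite lieDl !lieDr !liexx add0r addr0.
Qed.

Lemma lie_leibniz x y z : lie x (lie y z) = lie (lie x y) z + lie y (lie x z).
Proof.
have /eqP := lie_jacobi x y z; rewrite -addrA addr_eq0 => /eqP->.
by rewrite opprD -lieNr -(lieC x z) addrC (lieC (lie x y)).
Qed.

End LieFacts.

Lemma mx_lieE (F : fieldType) n (A B : 'M[F]_n) : lie A B = A *m B - B *m A.
Proof. by []. Qed.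

Section RankFacts.
Variable F : fieldType.

Lemma rank_add_leq m n (A B : 'M[F]_(m, n)) a b :
  (\rank A <= a)%N -> (\rank B <= b)%N -> (\rank (A + B)%R <= a + b)%N.
Proof. by move=> ra rb; apply: leq_trans (mxrank_add A B) (leq_add ra rb). Qed.

Lemma rank_sub_leq m n (A B : 'M[F]_(m, n)) a b :
  (\rank A <= a)%N -> (\rank B <= b)%N -> (\rank (A - B)%R <= a + b)%N.
Proof. by move=> ra rb; apply: rank_add_leq; rewrite ?mxrank_opp. Qed.

Lemma rank_scale_leq m n (A : 'M[F]_(m, n)) c a :
  (\rank A <= a)%N -> (\rank (c *: A)%R <= a)%N.
Proof. by apply: leq_trans; apply: mxrank_scale. Qed.

Lemma rank_mull_leq m n p (A : 'M[F]_(m, n)) (B : 'M[F]_(n, p)) a :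
  (\rank A <= a)%N -> (\rank (A *m B)%R <= a)%N.
Proof. by apply: leq_trans; apply: mxrankM_maxl. Qed.

Lemma rank_mulr_leq m n p (A : 'M[F]_(m, n)) (B : 'M[F]_(n, p)) b :
  (\rank B <= b)%N -> (\rank (A *m B)%R <= b)%N.
Proof. by apply: leq_trans; apply: mxrankM_maxr. Qed.

Lemma rank_sum_leq m n (I : eqType) (r : seq I) (E : I -> 'M[F]_(m, n))
    (b : I -> nat) :
  (forall i, i \in r -> \rank (E i)%R <= b i)%N ->
  (\rank (\sum_(i <- r) E i)%R <= \sum_(i <- r) b i)%N.
Proof.
elim: r => [|i r IHr] Eb; first by rewrite !big_nil mxrank0.
rewrite !big_cons; apply: rank_add_leq; first by apply: Eb; rewrite mem_head.
by apply: IHr => j jr; apply: Eb; rewrite inE jr orbT.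
Qed.

Lemma rank_mul_diff_leq m n p (A A' : 'M[F]_(m, n)) (B B' : 'M[F]_(n, p)) a b :
  (\rank (A - A')%R <= a)%N -> (\rank (B - B')%R <= b)%N ->
  (\rank (A *m B - A' *m B')%R <= a + b)%N.
Proof.
move=> ra rb.
have -> : A *m B - A' *m B' = (A - A') *m B + A' *m (B - B').
  by rewrite mulmxBl mulmxBr addrA subrK.
by apply: rank_add_leq; [apply: rank_mull_leq | apply: rank_mulr_leq].
Qed.

Lemma rank_lie_diff_leq n (A A' B B' : 'M[F]_n) a b :
  (\rank (A - A')%R <= a)%N -> (\rank (B - B')%R <= b)%N ->
  (\rank (lie A B - lie A' B')%R <= (a + b).*2)%N.
Proof.
move=> ra rb; rewrite !mx_lieE -addnn.
have -> : A *m B - B *m A - (A' *m B' - B' *m A') =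
   (A *m B - A' *m B') - (B *m A - B' *m A').
  by rewrite !opprD !opprK addrACA.
apply: rank_sub_leq; first exact: rank_mul_diff_leq.
by rewrite addnC; apply: rank_mul_diff_leq.
Qed.

End RankFacts.

(** The constant depends on the term only, not on the size of the matrices. It turns closeness on
    the generators into closeness on each fixed element of the Lie algebra. *)
Lemma term_eval_rank (F : fieldType) d (t : lie_term F d) :
  exists K, forall N (U U' : 'I_d -> 'M[F]_N) D,
    (forall i, \rank (U i - U' i)%R <= D)%N ->
    (\rank (lie_term_eval U t - lie_term_eval U' t)%R <= K * D)%N.
Proof.
elim: t => [i||t [K IHt] u [K' IHu]|c t [K IHt]|t [K IHt] u [K' IHu]].
- by exists 1%N => N U U' D UU; rewrite mul1n; apply: UU.
- by exists 0%N => N U U' D _; rewrite subrr mxrank0.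
- exists (K + K')%N => N U U' D UU /=; rewrite opprD addrACA mulnDl.
  by apply: rank_add_leq; [apply: IHt | apply: IHu].
- exists K => N U U' D UU /=; rewrite -scalerBr.
  by apply: rank_scale_leq; apply: IHt.
- exists (K + K').*2%N => N U U' D UU /=; rewrite -doubleMl mulnDl.
  by apply: rank_lie_diff_leq; [apply: IHt | apply: IHu].
Qed.

(** Again [K] is independent of [N]. On a term that represents a relator the second evaluation is 0,
    so an approximate representation is an approximate solution of the presentation. *)
Lemma term_eval_approx (F : fieldType) (g : lieType F) d (a : 'I_d -> g)
    (t : lie_term F d) :
  exists K, forall N (al : g -> 'M[F]_N) D, linear al ->
    (forall x y, \rank (lie (al x) (al y) - al (lie x y))%R <= D)%N ->
    (\rank (lie_term_eval (al \o a) t - al (lie_term_eval a t))%R <= K * D)%N.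
Proof.
elim: t => [i||t [K IHt] u [K' IHu]|c t [K IHt]|t [K IHt] u [K' IHu]].
- by exists 0%N => N al D lin_al _; rewrite subrr mxrank0.
- by exists 0%N => N al D lin_al _ /=; rewrite (lin0 lin_al) subrr mxrank0.
- exists (K + K')%N => N al D lin_al alD /=.
  rewrite (linD lin_al) opprD addrACA mulnDl.
  by apply: rank_add_leq; [apply: IHt | apply: IHu].
- exists K => N al D lin_al alD /=; rewrite (linZ lin_al) -scalerBr.
  by apply: rank_scale_leq; apply: IHt.
- exists ((K + K').*2 + 1)%N => N al D lin_al alD /=.
  rewrite mulnDl mul1n -doubleMl mulnDl.
  set X := lie_term_eval a t; set Y := lie_term_eval a u.
  set T := lie_term_eval _ t; set T' := lie_term_eval _ u.
  have -> : lie T T' - al (lie X Y) =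
      (lie T T' - lie (al X) (al Y)) + (lie (al X) (al Y) - al (lie X Y)).
    by rewrite addrA subrK.
  apply: rank_add_leq => //.
  by apply: rank_lie_diff_leq; [apply: IHt | apply: IHu].
Qed.

(** * Representations of a quotient close to approximate ones *)

Section Subquotients.
Variables (F : fieldType) (g : lieType F) (n : nat) (b : g -> 'M[F]_n).
Hypothesis hom_b : lie_hom b.

Lemma quotient_rep p (V : 'M[F]_(p, n)) :
  (forall x, (V *m b x <= V)%MS) ->
  exists m (b' : g -> 'M[F]_m) (Q : 'M[F]_(n, m)),
    [/\ lie_hom b', row_full Q, forall x, b x *m Q = Q *m b' x
      & forall k (v : 'M_(k, n)), (v *m Q == 0) = (v <= V)%MS].
Proof.
move=> sVb; pose Q := col_base (cokermx V).
have fullQ : row_full Q by apply: col_base_full.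
have kerQ k (v : 'M_(k, n)) : (v *m Q == 0) = (v <= V)%MS.
  rewrite submxE -[in RHS](mulmx_base (cokermx V)) mulmxA -/Q.
  apply/eqP/eqP => [->|vQ0]; first by rewrite mul0mx.
  by apply: (row_free_inj (row_base_free (cokermx V))); rewrite mul0mx.
pose b' x := pinvmx Q *m b x *m Q.
have bQ x : b x *m Q = Q *m b' x.
  (* The rows of [1 - Q Q^+] are killed by [Q], hence lie in the stable space [V]; this makes the
     choice of the pseudo-inverse irrelevant. *)
  have /eqP : (1%:M - Q *m pinvmx Q) *m b x *m Q == 0.
    rewrite kerQ; apply: submx_trans (sVb x); apply: submxMr.
    by rewrite -kerQ mulmxBl mul1mx -mulmxA mulVpmx // mulmx1 subrr.
  by rewrite !mulmxBl mul1mx /b' !mulmxA => /subr0_eq.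
clearbody b' Q; exists _, b', Q; split=> //; have [lin_b lie_b] := hom_b; split=> [a x y|x y].
  apply: (row_full_inj fullQ); rewrite mulmxDr -scalemxAr -!bQ.
  by rewrite (lin_b a) mulmxDl scalemxAl.
apply: (row_full_inj fullQ).
by rewrite -bQ lie_b !mx_lieE mulmxBr mulmxBl !mulmxA -!bQ -!mulmxA -!bQ.
Qed.

Lemma sub_rep p (V : 'M[F]_(p, n)) :
  (forall x, (V *m b x <= V)%MS) ->
  exists m (b' : g -> 'M[F]_m) (E : 'M[F]_(m, n)),
    [/\ lie_hom b', row_free E, forall x, E *m b x = b' x *m E,
        m = \rank V & (E <= V)%MS].
Proof.
move=> sVb; pose E := row_base V.
have freeE : row_free E by apply: row_base_free.
pose b' x := E *m b x *m pinvmx E.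
have Eb x : E *m b x = b' x *m E.
  rewrite /b' mulmxKpV //; apply: submx_trans (submxMr (b x) _) _.
  - by rewrite (eq_row_base V).
  - by rewrite eq_row_base; apply: sVb.
have sEV : (E <= V)%MS by rewrite eq_row_base.
clearbody b' E; exists _, b', E; split=> //.
have [lin_b lie_b] := hom_b; split=> [a x y|x y].
  apply: (row_free_inj freeE); rewrite /= mulmxDl -scalemxAl -!Eb.
  by rewrite (lin_b a) mulmxDr scalemxAr.
apply: (row_free_inj freeE) => /=.
by rewrite -Eb lie_b !mx_lieE mulmxBr mulmxBl !mulmxA !Eb -!mulmxA !Eb !mulmxA.
Qed.

Lemma factor_rep (s : lieType F) (f : g -> s) :
  lie_hom f -> (forall y, exists x, f x = y) -> (forall x, f x = 0 -> b x = 0) ->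
  exists2 r : s -> 'M[F]_n, lie_hom r & forall x, r (f x) = b x.
Proof.
move=> [lin_f lie_f] surj_f kf; have [lin_b lie_b] := hom_b.
have [h fh] := choice surj_f.
have bE x y : f x = f y -> b x = b y.
  move=> fxy; apply/eqP; rewrite -subr_eq0 -(linB lin_b); apply/eqP/kf.
  by rewrite (linB lin_f) fxy subrr.
exists (b \o h) => [|x]; last by apply: bE; rewrite fh.
split=> [a x y|x y] /=.
  by rewrite -lin_b; apply: bE; rewrite lin_f !fh.
by rewrite -lie_b; apply: bE; rewrite lie_f !fh.
Qed.

End Subquotients.

(* [quad_op pq z r] is the action on [r] of the element [\sum p q + z] of the
   enveloping algebra. *)
Section QuadraticElement.
Variables (F : fieldType) (T : Type).

Definition quad_op n (pq : seq (T * T)) (z : T) (r : T -> 'M[F]_n) : 'M[F]_n :=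
  \sum_(i <- pq) r i.1 *m r i.2 + r z.

Lemma quad_op_rank (K : T -> nat) n pq z (r r' : T -> 'M[F]_n) D :
  (forall x, \rank (r x - r' x)%R <= K x * D)%N ->
  (\rank (quad_op pq z r - quad_op pq z r')%R
     <= (\sum_(i <- pq) (K i.1 + K i.2) + K z) * D)%N.
Proof.
move=> rr'; rewrite /quad_op opprD addrACA mulnDl; apply: rank_add_leq => //.
elim: pq => [|[p q] pq IHpq]; first by rewrite !big_nil subrr mxrank0.
rewrite !big_cons opprD addrACA mulnDl; apply: rank_add_leq => //=.
by rewrite mulnDl; apply: rank_mul_diff_leq.
Qed.

Lemma quad_op_mull m n pq z (r : T -> 'M[F]_m) (r' : T -> 'M[F]_n)
    (Q : 'M[F]_(m, n)) :
  (forall x, r x *m Q = Q *m r' x) ->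
  quad_op pq z r *m Q = Q *m quad_op pq z r'.
Proof.
move=> rQ; rewrite /quad_op mulmxDl mulmxDr rQ mulmx_suml mulmx_sumr.
by congr (_ + _); apply: eq_bigr => i _; rewrite -mulmxA !rQ !mulmxA rQ.
Qed.

End QuadraticElement.

Section Padding.
Variable F : fieldType.

(** Writing padding as [J^T A J] makes it visibly linear and, since [J J^T = 1] for [n <= N],
    multiplicative and rank-preserving. *)
Definition pad_emb n N : 'M[F]_(n, N) := \matrix_(i, j) ((i : nat) == j)%:R.

Definition pad N n (A : 'M[F]_n) : 'M[F]_N :=
  (pad_emb n N)^T *m A *m pad_emb n N.

Lemma mul_pad_emb m n N (A : 'M[F]_(m, n)) i (j : 'I_N) :
  (A *m pad_emb n N) i j = if insub (val j) is Some j' then A i j' else 0.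
Proof.
rewrite mxE; case: insubP => [j' _ jj'|].
  rewrite (bigD1 j') //= big1 ?addr0 => [|k kj']; first by rewrite mxE jj' eqxx mulr1.
  by rewrite mxE -jj' val_eqE (negbTE kj') mulr0.
rewrite -leqNgt => nj; apply: big1 => k _; rewrite mxE.
by rewrite ltn_eqF ?mulr0 //; apply: leq_trans nj.
Qed.

Lemma padE N n (A : 'M[F]_n) : pad N A = \matrix_(i, j) hatmx A i j.
Proof.
apply/matrixP => i j; rewrite /pad mul_pad_emb mxE /hatmx.
case: (insub (val j)) => [j'|]; last by case: insub.
rewrite -[_ *m A]trmxK mxE trmx_mul trmxK mul_pad_emb.
by case: insub => // i'; rewrite mxE.
Qed.

Lemma rank_hat_subE n n' (A : 'M[F]_n) (B : 'M[F]_n') :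
  rank_hat_sub A B = \rank (pad (maxn n n') A - pad (maxn n n') B)%R.
Proof.
by rewrite /rank_hat_sub !padE; congr (\rank _); apply/matrixP => i j; rewrite !mxE.
Qed.

Lemma linear_pad N n : linear (@pad N n).
Proof. by move=> a A B; rewrite /pad mulmxDr mulmxDl -scalemxAr -scalemxAl. Qed.

Variables (n N : nat).
Hypothesis leqnN : (n <= N)%N.

Lemma pad_embK : pad_emb n N *m (pad_emb n N)^T = 1%:M.
Proof.
apply/matrixP => i j; rewrite !mxE (bigD1 (widen_ord leqnN j)) //= big1 => [|k kj].
  by rewrite !mxE eqxx mulr1 addr0 -val_eqE.
rewrite !mxE; have -> : ((j : nat) == k) = false; last by rewrite mulr0.
by apply: contraNF kj => /eqP jk; apply/eqP/val_inj.
Qed.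

Lemma padM (A B : 'M[F]_n) : pad N (A *m B) = pad N A *m pad N B.
Proof. by rewrite /pad -!mulmxA (mulmxA (pad_emb n N)) pad_embK mul1mx. Qed.

Lemma rank_pad (A : 'M[F]_n) : \rank (pad N A) = \rank A.
Proof.
apply/eqP; rewrite eqn_leq; apply/andP; split.
  by apply: rank_mull_leq; apply: rank_mulr_leq.
have AE : pad_emb n N *m pad N A *m (pad_emb n N)^T = A.
  by rewrite /pad !mulmxA pad_embK mul1mx -mulmxA pad_embK mulmx1.
by rewrite -[X in (\rank X <= _)%N]AE; apply: rank_mull_leq; apply: rank_mulr_leq.
Qed.

Lemma lie_term_eval_pad d (U : 'I_d -> 'M[F]_n) t :
  lie_term_eval (fun i => pad N (U i)) t = pad N (lie_term_eval U t).
Proof.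
elim: t => //= [|t -> u ->|c t ->|t -> u ->].
- by rewrite (lin0 (@linear_pad _ _)).
- by rewrite (linD (@linear_pad _ _)).
- by rewrite (linZ (@linear_pad _ _)).
- by rewrite !mx_lieE (linB (@linear_pad _ _)) !padM.
Qed.

Lemma quad_op_pad (T : Type) (pq : seq (T * T)) z (r : T -> 'M[F]_n) :
  quad_op pq z (fun x => pad N (r x)) = pad N (quad_op pq z r).
Proof.
rewrite /quad_op (linD (@linear_pad _ _)) (lin_sum (@linear_pad _ _)).
by congr (_ + _); apply: eq_bigr => i _; rewrite padM.
Qed.

End Padding.

Lemma linear_kernel (F : fieldType) (U V : vectType F) (f : U -> V) :
  linear f -> exists K : {vspace U}, forall x, (x \in K) = (f x == 0).
Proof.
move=> lin_f; pose f' : {linear U -> V} := HB.pack f (GRing.isLinear.Build _ _ _ _ f lin_f).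
by exists (lker (linfun f')) => x; rewrite memv_ker lfunE.
Qed.

(** The two estimates make [c J - J (pad Z')] of rank at most [e + e'], and a row [u] of its kernel
    satisfies [c u J = u J (pad Z')]. As [c != 0], such a [u J] is supported on the first [n']
    coordinates, so cutting it down to size [n'] loses no rank. *)
Lemma near_scalar_eigenspace (F : fieldType) n n' N (Z : 'M[F]_n) (Z' : 'M[F]_n')
    c e e' :
  c != 0 -> (n <= N)%N -> (n' <= N)%N ->
  (\rank (Z - c%:M)%R <= e)%N -> (\rank (pad N Z - pad N Z')%R <= e')%N ->
  exists2 W : 'M[F]_(n, n'), W *m Z' = c *: W & (n <= \rank W + (e + e'))%N.
Proof.
move=> c0 nN n'N rZ rZZ'; pose J := pad_emb F n N; pose J' := pad_emb F n' N.
have JK : J *m J^T = 1%:M by apply: pad_embK.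
have J'K : J' *m J'^T = 1%:M by apply: pad_embK.
pose M := c *: J - J *m pad N Z'.
have rM : (\rank M <= e + e')%N.
  have -> : M = - ((Z - c%:M) *m J) + J *m (pad N Z - pad N Z').
    have JZ : J *m pad N Z = Z *m J by rewrite /pad !mulmxA JK mul1mx.
    by rewrite mulmxBr JZ mulmxBl mul_scalar_mx opprB addrA subrK.
  by apply: rank_add_leq; [rewrite mxrank_opp; apply: rank_mull_leq|apply: rank_mulr_leq].
pose S := kermx M; pose W := S *m J *m J'^T.
have SM : c *: (S *m J) = W *m Z' *m J'.
  apply/eqP; rewrite -subr_eq0; apply/eqP.
  by rewrite -[RHS](mulmx_ker M) -/S mulmxBr -scalemxAr /W /pad -/J' !mulmxA.
exists W; first by rewrite {2}/W scalemxAl SM -mulmxA J'K mulmx1.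
have rS : (n <= \rank S + (e + e'))%N.
  by rewrite mxrank_ker addnC -leq_subLR leq_sub2l.
apply: leq_trans rS _; rewrite leq_add2r -(mxrankMfree S (B := J)); last first.
  by apply/row_freeP; exists J^T.
by rewrite -(mxrank_scale_nz _ c0) SM; apply: rank_mull_leq; apply: rank_mull_leq.
Qed.

(** * The obstruction to rank-stability *)

Section Obstruction.
Variables (R : realType) (F : fieldType) (g s : finLieType F) (f : g -> s).
Variables (pq : seq (s * s)) (z : s) (c : F).
Hypotheses (hom_f : lie_hom f) (surj_f : forall y, exists x, f x = y).
Hypothesis c_neq0 : c != 0.
Hypothesis central : forall m (r : s -> 'M[F]_m), lie_hom r ->
  forall x, r x *m quad_op pq z r = quad_op pq z r *m r x.
Hypothesis no_rep : forall m (r : s -> 'M[F]_m), lie_hom r ->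
  quad_op pq z r = c%:M -> m = 0%N.

(** If the span [V] of the images of the kernel had smaller rank than [W], then [W] would survive
    modulo [V] and give a nonzero representation of [s] on which [z = c]. The section [h] is merely
    set-theoretic; modulo [V] its choice does not matter. *)
Lemma kernel_image_large n p (b : g -> 'M[F]_n) (h : s -> g) (K : {vspace g})
    (W : 'M[F]_(p, n)) :
  lie_hom b -> cancel h f -> (forall x, (x \in K) = (f x == 0)) ->
  W *m quad_op pq z (b \o h) = c *: W ->
  (\rank W <= \sum_(x <- vbasis K) \rank (b x))%N.
Proof.
move=> hom_b hK memK Wc; have [lin_b lie_b] := hom_b; have [lin_f lie_f] := hom_f.
pose V := (\sum_(i < \dim K) b (vbasis K)`_i)%MS.
have rV : (\rank V <= \sum_(x <- vbasis K) \rank (b x))%N.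
  rewrite (big_nth 0) big_mkord size_tuple.
  rewrite /V; elim/big_rec2: _ => [|i k B _ leBk]; first by rewrite mxrank0.
  by apply: leq_trans (mxrank_adds_leqif _ _) _; rewrite leq_add2l.
have sVK x : x \in K -> (b x <= V)%MS.
  move=> /coord_vbasis->; rewrite (lin_sum lin_b); apply: summx_sub => i _.
  by rewrite (linZ lin_b) scalemx_sub // (sumsmx_sup i).
rewrite leqNgt; apply/negP => /(leq_ltn_trans rV) ltVW.
have sVb x : (V *m b x <= V)%MS.
  rewrite sumsmxMr; apply/sumsmx_subP => i _.
  set k := _`_i; have kK : k \in K by apply: vbasis_mem; apply: mem_nth; rewrite size_tuple.
  (* Both terms have their rows in [V], because [lie k x] is again in the kernel. *)
  have -> : b k *m b x = b x *m b k + b (lie k x).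
    by rewrite lie_b mx_lieE addrC subrK.
  rewrite addmx_sub ?mulmx_sub ?sVK // memK lie_f.
  by move: kK; rewrite memK => /eqP->; rewrite lie0x.
have [m [b' [Q [hom_b' fullQ bQ kerQ]]]] := quotient_rep hom_b sVb.
have kill x : f x = 0 -> b' x = 0.
  move=> /eqP; rewrite -memK => xK; apply: (row_full_inj fullQ).
  by rewrite -bQ mulmx0; apply/eqP; rewrite kerQ sVK.
have [r hom_r rf] := factor_rep hom_b' hom_f surj_f kill.
pose zr := quad_op pq z r.
have bhQ : quad_op pq z (b \o h) *m Q = Q *m zr.
  by apply: quad_op_mull => x /=; rewrite bQ -rf hK.
have sWE : (W *m Q <= eigenspace zr c)%MS.
  by apply/eigenspaceP; rewrite -mulmxA -bhQ mulmxA Wc scalemxAl.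
(* Centrality of [z] makes its eigenspace a subrepresentation. *)
have stE x : (eigenspace zr c *m r x <= eigenspace zr c)%MS.
  apply/eigenspaceP; rewrite -mulmxA (central hom_r) mulmxA.
  by have /eigenspaceP-> := submx_refl (eigenspace zr c); rewrite scalemxAl.
have [m' [r' [E [hom_r' freeE Er rk_m' sE]]]] := sub_rep hom_r stE.
have zr' : quad_op pq z r' = c%:M.
  apply: (row_free_inj freeE); rewrite /= mul_scalar_mx.
  rewrite (@quad_op_mull _ _ _ _ _ _ r' r E) => [|x]; last by rewrite Er.
  by apply/eigenspaceP.
have m'0 := no_rep hom_r' zr'.
have : (W <= V)%MS.
  rewrite -kerQ -mxrank_eq0 -leqn0; apply: leq_trans (mxrankS sWE) _.
  by rewrite -rk_m' m'0.
by move/mxrankS; rewrite leqNgt ltVW.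
Qed.

Theorem not_rank_stable_of_approx :
  (forall M, exists n (al : s -> 'M[F]_n),
     [/\ (0 < n)%N, linear al,
         forall x y, (\rank (lie (al x) (al y) - al (lie x y))%R * M <= n)%N
       & (\rank (quad_op pq z al - c%:M)%R * M <= n)%N]) ->
  ~ rank_stable R g.
Proof.
move=> approx [d0 [nr [P [a [[gen_a ker_a] stab]]]]].
have [lin_f lie_f] := hom_f.
have [h hK] := choice surj_f; have [K memK] := linear_kernel lin_f.
have [p pE] := choice gen_a; pose t x := repr (p x).
have tE x : lie_term_eval a (t x) = x by rewrite -[RHS]pE.
have [T1 T1P] := choice (fun x : g => term_eval_rank (t x)).
have [T2 T2P] := choice (fun x : g => term_eval_approx a (t x)).
have [TP TPP] := choice (fun i => term_eval_approx a (repr (P i))).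
pose T x := (T2 x + T1 x)%N.
pose C0 := (\sum_(i <- pq) (T (h i.1) + T (h i.2)) + T (h z))%N.
pose C1 := (\sum_(x <- vbasis K) T x)%N.
(* Errors are counted in units of [n %/ M]: [C1] for the image of the kernel, 1 for [z - c] and [C0]
   for replacing the approximate representation in [z]. Together they must stay below [n]. *)
pose M := (C1 + (1 + C0)).+1.
have [|delta delta0 {}stab] := stab M%:R^-1; first by rewrite invr_gt0 ltr0n.
pose TPm := \max_i TP i.
(* The second bound makes the normalized ranks of the relators less than [delta]. *)
pose M' := maxn M (Num.bound (TPm%:R / delta)).
have M'0 : (0 < M')%N by rewrite (leq_trans _ (leq_maxl _ _)).
have [n [al [n0 lin_al lie_al quad_al]]] := approx M'.
have lin_alf : linear (al \o f) by move=> k x y /=; rewrite lin_f lin_al.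
pose D := (n %/ M)%N; pose D' := (n %/ M')%N.
have leD'D : (D' <= D)%N by rewrite leq_div2l // leq_maxl.
have lie_alf x y :
    (\rank (lie ((al \o f) x) ((al \o f) y) - (al \o f) (lie x y))%R <= D')%N.
  by rewrite /= lie_f /D' leq_divRL.
have [||n' [B [n'0 BP hatAB]]] := stab n (al \o f \o a) => // [i|].
  rewrite /rk ltr_pdivrMr ?ltr0n //.
  have Pi0 : lie_term_eval a (repr (P i)) = 0.
    by apply: (ker_a (P i)).2 => I _; apply; exists i.
  have := TPP i n _ D' lin_alf lie_alf.
  rewrite Pi0 (lin0 lin_alf) subr0 -/(lie_eval _ _) => rP.
  have {}rP : (\rank (lie_eval (al \o f \o a) (P i)) * M' <= TPm * n)%N.
    apply: leq_trans (_ : TP i * (D' * M') <= _)%N.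
      by rewrite mulnA leq_mul2r rP orbT.
    by apply: leq_mul; rewrite ?leq_trunc_div // (leq_bigmax i).
  rewrite -(ltr_pM2r (_ : 0 < M'%:R)) ?ltr0n // -natrM.
  apply: le_lt_trans (_ : (TPm * n)%:R < _); first by rewrite ler_nat.
  rewrite mulrAC natrM ltr_pM2r ?ltr0n // -ltr_pdivrMl // mulrC.
  apply: lt_le_trans (archi_boundP _) _.
    by apply: divr_ge0; [apply: ler0n | apply: ltW].
  by rewrite ler_nat leq_maxr.
have [lin_eB lie_eB] := lie_eval_hom B; have [lina liea] := lie_eval_hom a.
(* Evaluation at [B] kills the relators, hence the ideal that they generate, so it factors through
   [g]. *)
have evB q q' : lie_eval a q = lie_eval a q' -> lie_eval B q = lie_eval B q'.
  move=> qq'; apply/subr0_eq; rewrite -(linB lin_eB).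
  have /ker_a : lie_eval a (q - q') = 0 by rewrite (linB lina) qq' subrr.
  move/(_ (fun q => lie_eval B q = 0)); apply=> [|q'' [i ->]]; last exact: BP.
  split=> [|k x y x0 y0|x y y0]; first exact: (lin0 lin_eB).
    by rewrite lin_eB x0 y0 scaler0 addr0.
  by rewrite lie_eB y0 liex0.
pose b x := lie_eval B (p x).
have hom_b : lie_hom b.
  split=> [k x y|x y]; rewrite /b; first by rewrite -lin_eB; apply: evB; rewrite lina !pE.
  by rewrite -lie_eB; apply: evB; rewrite liea !pE.
pose N := maxn n n'.
have nN : (n <= N)%N by apply: leq_maxl.
have n'N : (n' <= N)%N by apply: leq_maxr.
(* The intermediate matrix is the evaluation of the term [t x] at the tuple [A]: [T2] bounds the
   defect of [al], and [T1] the passage from [A] to [B]. *)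
have rb x : (\rank (pad N (al (f x)) - pad N (b x))%R <= T x * D)%N.
  rewrite -(subrK (pad N (lie_term_eval (al \o f \o a) (t x))) (pad N (al (f x)))).
  rewrite -addrA /T mulnDl; apply: rank_add_leq.
    rewrite -(linB (@linear_pad _ _ _)) rank_pad // -mxrank_opp opprB.
    apply: leq_trans (_ : T2 x * D' <= _)%N; last by rewrite leq_mul2l leD'D orbT.
    by have := T2P x n _ D' lin_alf lie_alf; rewrite tE.
  rewrite /b /lie_eval -/(t x) -!lie_term_eval_pad //; apply: T1P => i.
  rewrite -rank_hat_subE /D leq_divRL // -(ler_nat R) natrM ltW //.
  by rewrite -ltr_pdivlMr ?ltr0n // mulrC.
have [W Wc rW] : exists2 W : 'M[F]_(n, n'),
    W *m quad_op pq z (b \o h) = c *: W & (n <= \rank W + (D + C0 * D))%N.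
  apply: (near_scalar_eigenspace (N := N) (Z := quad_op pq z al)) => //.
    by apply: leq_trans leD'D; rewrite leq_divRL.
  rewrite -!quad_op_pad //; apply: (@quad_op_rank _ _ (T \o h)) => x /=.
  by have := rb (h x); rewrite hK.
have rW' : (\rank W <= C1 * D)%N.
  apply: leq_trans (kernel_image_large hom_b hK memK Wc) _.
  rewrite /C1 big_distrl /= big_seq [X in (_ <= X)%N]big_seq.
  apply: leq_sum => x /vbasis_mem; rewrite memK => /eqP fx0; have := rb x.
  by rewrite fx0 (lin0 lin_al) (lin0 (@linear_pad _ _ _)) sub0r mxrank_opp rank_pad.
have : (n < n)%N; last by rewrite ltnn.
apply: leq_ltn_trans rW _; apply: leq_ltn_trans (_ : (C1 + (1 + C0)) * D < n)%N.
  by rewrite mulnDl mulnDl mul1n leq_add2r.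
have [D0|D0] := posnP D; first by rewrite D0 muln0.
by apply: leq_trans (leq_trunc_div n M); rewrite -/D mulnC ltn_pmul2l.
Qed.

End Obstruction.

(** * Quotients, tensor products and the nilpotent case *)

Section QuotientLie.
Variables (F : fieldType) (g : finLieType F) (K : {vspace g}).
Hypothesis idealK : forall x y, y \in K -> lie x y \in K.

(** The carrier is a complement of [K]. The proof that [K] is an ideal is an argument of the type,
    so that the Lie structure, which depends on it, can be attached to the type. *)
Definition quotient_lie of (forall x y, y \in K -> lie x y \in K) : Type :=
  subvs_of (K^C)%VS.
Local Notation q := (quotient_lie idealK).
HB.instance Definition _ := Vector.on q.

Definition quotient_proj (x : g) : q := vsproj (K^C)%VS (daddv_pi K^C K x).
Definition quotient_val (u : q) : g := vsval (u : subvs_of (K^C)%VS).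

Let capKC : (K^C :&: K)%VS = 0%VS.
Proof. by rewrite capvC capv_compl. Qed.

Let linear_proj : linear quotient_proj.
Proof. by move=> a x y; rewrite /quotient_proj !linearP. Qed.

Let linear_val : linear quotient_val.
Proof. by move=> a x y; rewrite /quotient_val linearP. Qed.

Let valK : cancel quotient_val quotient_proj.
Proof.
by move=> u; rewrite /quotient_proj daddv_pi_id ?vsvalK // subvsP.
Qed.

Let projK x : quotient_val (quotient_proj x) - x \in K.
Proof.
rewrite /quotient_val vsprojK ?memv_pi // -opprB memvN.
rewrite -{1}(daddv_pi_add capKC (w := x)) ?addv_complf ?memvf 1?addvC ?addv_complf ?memvf //.
by rewrite addrAC subrr add0r memv_pi.
Qed.

Let proj_eq0 x : (quotient_proj x == 0) = (x \in K).
Proof.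
apply/eqP/idP => [p0|xK].
  by have := projK x; rewrite p0 (lin0 linear_val) sub0r memvN.
have /eqP : daddv_pi K K^C x + daddv_pi K^C K x == x.
  by rewrite daddv_pi_add ?capv_compl // addv_complf memvf.
rewrite daddv_pi_id ?capv_compl // => /eqP; rewrite -subr_eq0 addrAC subrr add0r.
by move=> /eqP pix0; rewrite /quotient_proj pix0 linear0.
Qed.

Let proj_eq x y : x - y \in K -> quotient_proj x = quotient_proj y.
Proof. by rewrite -proj_eq0 (linB linear_proj) subr_eq0 => /eqP. Qed.

Let idealKl x y : x \in K -> lie x y \in K.
Proof. by move=> xK; rewrite lieC memvN idealK. Qed.

Definition quotient_bracket (u v : q) : q :=
  quotient_proj (lie (quotient_val u) (quotient_val v)).
Local Notation br := quotient_bracket.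

Let brE x y : br (quotient_proj x) (quotient_proj y) = quotient_proj (lie x y).
Proof.
apply: proj_eq; set x' := quotient_val _; set y' := quotient_val _.
have -> : lie x' y' - lie x y = lie (x' - x) y' + lie x (y' - y).
  by rewrite lieBl lieBr addrA subrK.
by apply: rpredD; [apply: idealKl | apply: idealK]; apply: projK.
Qed.

Let brDl u v w : br (u + v) w = br u w + br v w.
Proof. by rewrite /br (linD linear_val) lieDl (linD linear_proj). Qed.
Let brZl a u v : br (a *: u) v = a *: br u v.
Proof. by rewrite /br (linZ linear_val) lieZl (linZ linear_proj). Qed.
Let brDr u v w : br u (v + w) = br u v + br u w.
Proof. by rewrite /br (linD linear_val) lieDr (linD linear_proj). Qed.
Let brZr a u v : br u (a *: v) = a *: br u v.
Proof. by rewrite /br (linZ linear_val) lieZr (linZ linear_proj). Qed.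
Let brxx u : br u u = 0.
Proof. by rewrite /br liexx (lin0 linear_proj). Qed.
Let br_jacobi u v w : br u (br v w) + br v (br w u) + br w (br u v) = 0.
Proof.
rewrite -(valK u) -(valK v) -(valK w) !brE -!(linD linear_proj).
by rewrite lie_jacobi (lin0 linear_proj).
Qed.

HB.instance Definition _ := Lmodule_isLie.Build F q brDl brZl brDr brZr brxx br_jacobi.

Lemma lie_quotient_exists : exists (h : finLieType F) (f : g -> h),
  [/\ lie_hom f, forall y, exists x, f x = y & forall x, (f x == 0) = (x \in K)].
Proof.
exists q, quotient_proj; split=> //; last by move=> y; exists (quotient_val y).
by split=> // x y; rewrite -brE.
Qed.

End QuotientLie.

Section Tensor.
Variable F : fieldType.

Lemma linear_tensl m n p q (B : 'M[F]_(p, q)) :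
  linear (fun A : 'M[F]_(m, n) => tensmx A B).
Proof. by move=> a A A'; apply/matrixP => i j; rewrite !mxE mulrDl mulrA. Qed.

Lemma linear_tensr m n p q (A : 'M[F]_(m, n)) :
  linear (fun B : 'M[F]_(p, q) => tensmx A B).
Proof. by move=> a B B'; apply/matrixP => i j; rewrite !mxE mulrDr mulrCA. Qed.

Lemma tens1mx m n : tensmx (1%:M : 'M[F]_m) (1%:M : 'M[F]_n) = 1%:M.
Proof.
apply/matrixP => i j; case: (mxtens_indexP i) => i1 i2.
case: (mxtens_indexP j) => j1 j2; rewrite tensmxE !mxE -natrM mulnb.
by rewrite (inj_eq (can_inj (@mxtens_indexK _ _))) -pair_eqE.
Qed.

Lemma mxtrace_tens m n (A : 'M[F]_m) (B : 'M[F]_n) :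
  \tr (tensmx A B) = \tr A * \tr B.
Proof.
rewrite /mxtrace big_distrlr pair_big /=.
rewrite (reindex (@mxtens_index m n)) /=; last first.
  by exists (@mxtens_unindex m n) => i _; [apply: mxtens_indexK | apply: mxtens_unindexK].
by apply: eq_bigr => [[i j] _]; rewrite tensmxE.
Qed.

Lemma rank_tens1 m n (A : 'M[F]_m) :
  (\rank (tensmx A (1%:M : 'M_n)) <= \rank A * n)%N.
Proof.
rewrite -[A in tensmx A _]mulmx_base -[1%:M]mulmx1 -tensmx_mul.
by apply: rank_mull_leq; apply: rank_leq_col.
Qed.

Lemma rank_tens1l m n (B : 'M[F]_n) :
  (\rank (tensmx (1%:M : 'M_m) B) <= m * \rank B)%N.
Proof.
rewrite -[B in tensmx _ B]mulmx_base -[1%:M]mulmx1 -tensmx_mul.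
by apply: rank_mull_leq; apply: rank_leq_col.
Qed.

Lemma lie_tens m n (A A' : 'M[F]_m) (B B' : 'M[F]_n) :
  lie (tensmx A B) (tensmx A' B') =
  tensmx (A *m A') (B *m B') - tensmx (A' *m A) (B' *m B).
Proof. by rewrite mx_lieE !tensmx_mul. Qed.

Lemma lie_tensl m n (A A' : 'M[F]_m) :
  lie (tensmx A (1%:M : 'M_n)) (tensmx A' 1%:M) = tensmx (lie A A') 1%:M.
Proof. by rewrite lie_tens mulmx1 -(linB (@linear_tensl _ _ _ _ _)). Qed.

Lemma lie_tensr m n (B B' : 'M[F]_n) :
  lie (tensmx (1%:M : 'M_m) B) (tensmx 1%:M B') = tensmx 1%:M (lie B B').
Proof. by rewrite lie_tens mulmx1 -(linB (@linear_tensr _ _ _ _ _)). Qed.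

Lemma lie_tenslr m n (A : 'M[F]_m) (B : 'M[F]_n) :
  lie (tensmx A 1%:M) (tensmx 1%:M B) = 0.
Proof. by rewrite lie_tens !mulmx1 !mul1mx subrr. Qed.

End Tensor.

(** * Approximate canonical commutation relations *)

Section Heisenberg.
Variable F : fieldType.

(** On columns, in the basis of divided powers [x^j / j!] with [j <= N], [P] is differentiation and
    [Q] is multiplication by [x], truncated. The commutator is wrong in the top degree only. *)
Lemma canonical_pair N :
  exists P Q : 'M[F]_N.+1, (\rank (lie P Q - 1%:M)%R <= 1)%N.
Proof.
pose P := \matrix_(i < N.+1, j < N.+1) ((j : nat) == i.+1)%:R : 'M[F]_N.+1.
pose Q := \matrix_(i < N.+1, j < N.+1) (((i : nat) == j.+1) * i)%:R : 'M[F]_N.+1.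
exists P, Q.
have QP i k : (Q *m P) i k = ((i == k) * i)%:R.
  rewrite mxE; case: (posnP i) => [i0|i_gt0].
    by rewrite i0 muln0 big1 // => j _; rewrite !mxE i0 mul0r.
  have i'N : (i.-1 < N.+1)%N by apply: leq_ltn_trans (leq_pred _) (ltn_ord i).
  rewrite (bigD1 (Ordinal i'N)) //= big1 ?addr0 => [|j ji].
    by rewrite !mxE /= prednK // eqxx mul1n -natrM [(k : nat) == i]eq_sym mulnC.
  rewrite !mxE; case: eqP => [ij|_]; last by rewrite mul0r.
  by case/eqP: ji; apply: val_inj; rewrite /= ij.
have PQ i k : (P *m Q) i k = ((i == k) * (i < N) * i.+1)%:R.
  rewrite mxE; case: (ltnP i N) => [iN|Ni]; last first.
    rewrite muln0 mul0n big1 // => j _; rewrite !mxE ltn_eqF ?mul0r //.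
    by apply: leq_trans (ltn_ord j) _.
  rewrite (bigD1 (Ordinal (iN : i.+1 < N.+1)%N)) //= big1 ?addr0 => [|j ji].
    by rewrite !mxE /= eqxx mul1r eqSS muln1.
  rewrite !mxE; case: eqP => [ij|_]; last by rewrite mul0r.
  by case/eqP: ji; apply: val_inj; rewrite /= ij.
have -> : lie P Q - 1%:M = (- N.+1%:R) *: delta_mx ord_max ord_max.
  rewrite mx_lieE; apply/matrixP => i k; rewrite mxE [in LHS]mxE [in X in _ + X]mxE.
  rewrite PQ [X in _ + X - _]mxE QP !mxE.
  case: (eqVneq i k) => [<-|ik]; last first.
    have -> : (i == ord_max) && (k == ord_max) = false.
      by apply: contraNF ik => /andP[/eqP-> /eqP->].
    by rewrite !mul0n !subr0 mulr0.
  rewrite andbb -val_eqE /= !mul1n; have := ltn_ord i; rewrite ltnS leq_eqVlt.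
  case: (ltnP i N) => [iN _|Ni].
    by rewrite ltn_eqF // mul1n mulr0 -natr1 addrAC addrK subrr.
  by rewrite orbF => /eqP iN; rewrite iN eqxx mul0n mulr1 -natr1 opprD mulr0n sub0r.
by apply: rank_scale_leq; rewrite mxrank_delta.
Qed.

(** Each new pair, of size [M.+1] and defect 1, acts on a new tensor factor; tensoring with an
    identity matrix does not change relative ranks. *)
Lemma canonical_pairs d M : exists n (P Q : nat -> 'M[F]_n), (0 < n)%N /\
  forall i j, (i < d)%N -> (j < d)%N ->
  [/\ lie (P i) (P j) = 0, lie (Q i) (Q j) = 0
    & (\rank (lie (P i) (Q j) - (i == j)%:R%:M)%R * M <= n)%N].
Proof.
elim: d => [|d [n [P [Q [n0 PQ]]]]]; first by exists 1%N, (fun=> 0), (fun=> 0).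
have [p [q pq]] := canonical_pair M.
exists (n * M.+1)%N, (fun i => if (i < d)%N then tensmx (P i) 1%:M else tensmx 1%:M p),
  (fun i => if (i < d)%N then tensmx (Q i) 1%:M else tensmx 1%:M q).
split=> [|i j]; first by rewrite muln_gt0 n0.
rewrite !ltnS => lid ljd.
have tl0 : tensmx (0 : 'M[F]_n) (1%:M : 'M_M.+1) = 0 by apply: tens0mx.
case: (ltngtP i d) lid => [id _|//|id _]; case: (ltngtP j d) ljd => [jd _|//|jd _].
- have [PP QQ rPQ] := PQ i j id jd.
  rewrite !lie_tensl PP QQ tl0; split=> //.
  have -> : ((i == j)%:R%:M : 'M[F]_(n * M.+1)) = tensmx ((i == j)%:R%:M) 1%:M.
    by rewrite -scalemx1 -tens1mx -(linZ (@linear_tensl _ _ _ _ _ _)) scalemx1.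
  rewrite -(linB (@linear_tensl _ _ _ _ _ _)).
  apply: leq_trans (leq_mul (rank_tens1 _ _) (leqnn _)) _.
  by rewrite mulnAC leq_mul2r rPQ orbT.
- rewrite !lie_tenslr jd ltn_eqF // raddf0 subr0; split=> //; by rewrite mxrank0.
- rewrite !(lieC (tensmx 1%:M _)) !lie_tenslr oppr0 id gtn_eqF // raddf0 subr0.
  by split=> //; rewrite mxrank0.
rewrite !lie_tensr !liexx id jd eqxx tensmx0; split=> //.
rewrite -(tens1mx F n M.+1) -(linB (@linear_tensr _ _ _ _ _ _)).
apply: leq_trans (leq_mul (rank_tens1l _ _) (leqnn _)) _.
rewrite -mulnA leq_mul2l (leq_trans (leq_mul pq (leqnn M))) ?orbT //.
by rewrite mul1n.
Qed.

End Heisenberg.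

Lemma lie_hom_comp (F : fieldType) (g h k : lieType F) (f : g -> h) (f' : h -> k) :
  lie_hom f -> lie_hom f' -> lie_hom (f' \o f).
Proof.
move=> [lin_f lie_f] [lin_f' lie_f']; split=> [a x y|x y] /=.
  by rewrite lin_f lin_f'.
by rewrite lie_f lie_f'.
Qed.

Lemma linear_liel (F : fieldType) (g : lieType F) (y : g) : linear (fun x => lie x y).
Proof. by move=> a x x'; rewrite lieDl lieZl. Qed.

Lemma linear_lier (F : fieldType) (g : lieType F) (x : g) : linear (lie x).
Proof. by move=> a y y'; rewrite lieDr lieZr. Qed.

Lemma exists_functional (F : fieldType) (V : vectType F) (v : V) :
  v != 0 -> exists2 l : V -> F, linear (l : V -> F^o) & l v = 1.
Proof.
move=> v0; pose e := vbasis (@fullv F V).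
have [i ei] : exists i, coord e i v != 0.
  apply/existsP; apply: contraNT v0; rewrite negb_exists => /forallP v0.
  rewrite (coord_vbasis (memvf v)) big1 // => i _.
  by have := v0 i; rewrite negbK => /eqP ->; rewrite scale0r.
exists (fun x => (coord e i v)^-1 * coord e i x); last by rewrite mulVf.
by move=> a x y; rewrite linearP /= mulrDr mulrCA.
Qed.

Section NilpotentCase.
Variables (R : realType) (F : numFieldType) (g s : finLieType F) (f : g -> s).
Hypotheses (hom_f : lie_hom f) (surj_f : forall y, exists x, f x = y).
Hypothesis nil2 : forall x y z : s, lie x (lie y z) = 0.

(* Order-one differential operators: [P i] stands for a derivative and [Q i] for
   multiplication by the corresponding variable. *)
Section WeylAction.
Variables (lam : s -> F) (d : nat) (e : 'I_d -> s) (a : 'I_d -> s -> F).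
Hypotheses (lin_lam : linear (lam : s -> F^o)).
Hypotheses (lin_a : forall i, linear (a i : s -> F^o)).
Hypothesis a_lie : forall i x y, a i (lie x y) = 0.
Hypothesis a_decomp : forall x y, lam (lie (\sum_i a i x *: e i) y) = lam (lie x y).
Variables (n : nat) (P Q : nat -> 'M[F]_n).
Hypothesis PP : forall i j : 'I_d, lie (P i) (P j) = 0.
Hypothesis QQ : forall i j : 'I_d, lie (Q i) (Q j) = 0.

(** In the bracket of two such operators each of the two cross terms contributes
    [lam (lie u v) / 2], whence the factor 1/2. *)
Definition weyl_action (u : s) : 'M[F]_n :=
  \sum_i a i u *: P i + \sum_i (lam (lie (e i) u) / 2%:R) *: Q i + (lam u)%:M.

Lemma linear_weyl_action : linear weyl_action.
Proof.
move=> c x y; rewrite /weyl_action !scalerDr !scaler_sumr scale_scalar_mx.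
rewrite [RHS]addrACA; congr (_ + _); last first.
  by rewrite -raddfD; congr (_%:M); apply: lin_lam.
rewrite [RHS]addrACA; congr (_ + _); rewrite -big_split; apply: eq_bigr => i _ /=.
  by rewrite scalerA -scalerDl; congr (_ *: _); apply: lin_a.
rewrite scalerA -scalerDl; congr (_ *: _).
by rewrite mulrA -mulrDl lieDr lieZr; congr (_ / _); apply: lin_lam.
Qed.

(** The right side vanishes for exact canonical pairs, so the defect is a combination of the [d * d]
    defects of the given pairs. *)
Lemma lie_weyl_action u v :
  lie (weyl_action u) (weyl_action v) - weyl_action (lie u v) =
  \sum_i \sum_j (a i u * (lam (lie (e j) v) / 2%:R)
                  - a i v * (lam (lie (e j) u) / 2%:R))
     *: (lie (P i) (Q j) - (i == j)%:R%:M).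
Proof.
pose A u := \sum_i a i u *: P i; pose b i u := lam (lie (e i) u) / 2%:R.
pose B u := \sum_i b i u *: Q i.
have lamZ k x : lam (k *: x) = k * lam x by apply: (linZ lin_lam).
have lamD x y : lam (x + y) = lam x + lam y by apply: (linD lin_lam).
have lam0 : lam 0 = 0 by apply: (lin0 lin_lam).
have sum_ab x y : \sum_i a i x * b i y = lam (lie x y) / 2%:R.
  rewrite -a_decomp (lin_sum (@linear_liel _ _ y)).
  rewrite (lin_sum lin_lam) mulr_suml; apply: eq_bigr => i _.
  by rewrite lieZl lamZ mulrA.
have wE x : weyl_action x = A x + B x + (lam x)%:M by [].
have AA x y : lie (A x) (A y) = 0.
  rewrite (lin_sum (@linear_liel _ _ _)) big1 // => i _.
  rewrite lieZl (lin_sum (@linear_lier _ _ _)) big1 ?scaler0 // => j _.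
  by rewrite lieZr PP scaler0.
have BB x y : lie (B x) (B y) = 0.
  rewrite (lin_sum (@linear_liel _ _ _)) big1 // => i _.
  rewrite lieZl (lin_sum (@linear_lier _ _ _)) big1 ?scaler0 // => j _.
  by rewrite lieZr QQ scaler0.
have AB x y : lie (A x) (B y) = \sum_i \sum_j (a i x * b j y) *: lie (P i) (Q j).
  rewrite (lin_sum (@linear_liel _ _ _)); apply: eq_bigr => i _.
  rewrite lieZl (lin_sum (@linear_lier _ _ _)) scaler_sumr; apply: eq_bigr => j _.
  by rewrite lieZr scalerA.
have Cl c (X : 'M[F]_n) : lie c%:M X = 0 by rewrite mx_lieE scalar_mxC subrr.
have Cr c (X : 'M[F]_n) : lie X c%:M = 0 by rewrite mx_lieE scalar_mxC subrr.
have -> : weyl_action (lie u v) = (lam (lie u v))%:M.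
  rewrite wE /A /B !big1 ?add0r // => i _; last by rewrite a_lie scale0r.
  by rewrite /b nil2 lam0 mul0r scale0r.
have -> : lie (weyl_action u) (weyl_action v) = lie (A u) (B v) - lie (A v) (B u).
  rewrite !wE !(lieDl, lieDr) AA BB !Cl !Cr add0r !addr0 addrC.
  by rewrite [lie (B u) _]lieC addrC.
rewrite !AB -sumrB -/b.
transitivity (\sum_i (\sum_j (a i u * b j v - a i v * b j u) *: lie (P i) (Q j)
    - (a i u * b i v - a i v * b i u)%:M)).
  rewrite [RHS]sumrB; congr (_ - _).
    apply: eq_bigr => i _; rewrite -sumrB; apply: eq_bigr => j _.
    by rewrite scalerBl.
  rewrite -raddf_sum sumrB !sum_ab; congr (_%:M).
  by rewrite [lie v u]lieC -scaleN1r lamZ mulN1r mulNr opprK -splitr.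
apply: eq_bigr => i _.
transitivity (\sum_j ((a i u * b j v - a i v * b j u) *: lie (P i) (Q j) -
   (a i u * b j v - a i v * b j u) *: (i == j)%:R%:M)); last first.
  by apply: eq_bigr => j _; rewrite [RHS]scalerBr.
rewrite [RHS]sumrB; congr (_ - _).
rewrite (bigD1 i) //= eqxx scalemx1 big1 ?addr0 // => j ij.
by rewrite eq_sym (negbTE ij) mulr0n raddf0 scaler0.
Qed.

End WeylAction.

Lemma nilpotent2_not_stable :
  (exists x y : s, lie x y != 0) -> ~ rank_stable R g.
Proof.
move=> [x0 [y0 xy0]].
have [lam lin_lam lam1] := exists_functional xy0.
pose e := vbasis (@fullv F s).
pose U := lie_vspace (@fullv F s) fullv.
(* Coordinates of [pr x] vanish on the derived algebra [U], and [pr x] has the same brackets as [x]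
   because [U] is central. *)
pose pr x := x - projv U x.
have projU x y : projv U (lie x y) = lie x y.
  by apply: projv_id; apply: memv_lie; rewrite memvf.
have central_U x y : x \in U -> lie x y = 0.
  have [K memK] := linear_kernel (linear_lier y).
  move=> xU; have /subvP/(_ _ xU) : (U <= K)%VS.
    by apply/lie_vspaceP => u v _ _; rewrite memK nil2.
  by rewrite memK lieC oppr_eq0 => /eqP.
pose d := \dim (@fullv F s).
pose a (i : 'I_d) x := coord e i (pr x).
have lin_a i : linear (a i : s -> F^o).
  by move=> k x y; rewrite /a /pr linearP opprD addrACA -scalerBr linearP.
have a_lie i x y : a i (lie x y) = 0 by rewrite /a /pr projU subrr linear0.
have a_decomp x y : lam (lie (\sum_i a i x *: e`_i) y) = lam (lie x y).
  rewrite -coord_vbasis ?memvf // /pr lieBl (central_U (projv U x)) ?subr0 //.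
  exact: memv_pi.
(* The central element is the commutator itself, without quadratic part, normalized by [lam1] to act
   approximately as 1. *)
apply: (@not_rank_stable_of_approx R F g s f [::] (lie x0 y0) 1) => //.
- exact: oner_neq0.
- move=> m r [lin_r lie_r] x; rewrite /quad_op big_nil add0r.
  have /eqP : lie (r x) (r (lie x0 y0)) = 0 by rewrite -lie_r nil2 (lin0 lin_r).
  by rewrite mx_lieE subr_eq0 => /eqP.
- move=> m r [lin_r lie_r]; rewrite /quad_op big_nil add0r lie_r => /(congr1 mxtrace).
  rewrite mx_lieE linearB /= mxtrace_mulC subrr mxtrace1 => /esym/eqP.
  by rewrite pnatr_eq0 => /eqP.
move=> M; have [n [P [Q [n0 PQ]]]] := canonical_pairs F d (M * (d * d)).
exists n, (weyl_action lam (fun i : 'I_d => e`_i) a P Q); split=> // [|x y|].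
- exact: linear_weyl_action.
- rewrite lie_weyl_action //; try by move=> i j; have [] := PQ i j (ltn_ord _) (ltn_ord _).
  have [->|M0] := posnP M; first by rewrite muln0.
  pose q := (n %/ (M * (d * d)))%N.
  apply: leq_trans (_ : (d * (d * q)) * M <= n)%N; last first.
    rewrite (_ : d * (d * q) * M = q * (M * (d * d)))%N ?leq_trunc_div //.
    by ring.
  rewrite leq_mul2r; apply/orP; right.
  have -> : (d * (d * q) = \sum_(i < d) \sum_(j < d) q)%N.
    by rewrite !big_const_ord !iter_addn_0 !(mulnC _ d).
  apply: rank_sum_leq => i _; apply: rank_sum_leq => j _; apply: rank_scale_leq.
  have d0 : (0 < d)%N := leq_ltn_trans (leq0n i) (ltn_ord i).
  have [_ _] := PQ i j (ltn_ord _) (ltn_ord _).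
  by rewrite /q leq_divRL // !muln_gt0 M0 d0.
rewrite /quad_op big_nil add0r /weyl_action !big1 ?add0r => [|i _|i _].
- by rewrite lam1 subrr mxrank0.
- by rewrite nil2 (lin0 lin_lam) mul0r scale0r.
by rewrite a_lie scale0r.
Qed.

End NilpotentCase.

Lemma lie_vspaceS (F : fieldType) (g : finLieType F) (U U' V V' : {vspace g}) :
  (U <= U')%VS -> (V <= V')%VS -> (lie_vspace U V <= lie_vspace U' V')%VS.
Proof.
move=> sU sV; apply/lie_vspaceP => u v uU vV.
by apply: memv_lie; [apply: (subvP sU) | apply: (subvP sV)].
Qed.

Lemma nilpotent_nonabelian_lcs (F : fieldType) (h : finLieType F) :
  lie_nilpotent h -> ~ lie_abelian h ->
  ~~ (lower_central_series h 1 <= lower_central_series h 2)%VS.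
Proof.
move=> [k hk] nab; apply/negP => le12; apply: nab => x y; apply/eqP.
have lek n : (lower_central_series h 1 <= lower_central_series h n)%VS.
  elim: n => [|n IHn]; first exact: subvf.
  by apply: subv_trans le12 _; apply: lie_vspaceS.
rewrite -memv0 -hk; apply: (subvP (lek k)).
by apply: memv_lie; rewrite memvf.
Qed.

Lemma nonabelian_nilpotent_not_stable (R : realType) (F : numFieldType)
    (g : finLieType F) :
  has_nonabelian_nilpotent_image g -> ~ rank_stable R g.
Proof.
move=> [h [f [hom_f surj_f nil_h nab_h]]].
have not12 := nilpotent_nonabelian_lcs nil_h nab_h.
have le21 : (lower_central_series h 2 <= lower_central_series h 1)%VS.
  by apply: lie_vspaceS; rewrite subvf.
(* Index 2 of the series is [[h, [h, h]]], so the quotient has class at most 2; it is not abelian,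
   since the series still drops from index 1 to index 2. *)
have [|s [f' [hom_f' surj_f' kf']]] := @lie_quotient_exists _ _ (lower_central_series h 2).
  by move=> x y /(subvP le21) yL; apply: memv_lie; rewrite ?memvf.
have [_ lie_f'] := hom_f'.
apply: (@nilpotent2_not_stable R F g s (f' \o f)).
- exact: lie_hom_comp.
- by move=> y; have [x <-] := surj_f' y; have [w <-] := surj_f x; exists w.
- move=> x y z; have [{}x <-] := surj_f' x; have [{}y <-] := surj_f' y.
  have [{}z <-] := surj_f' z; rewrite -!lie_f'; apply/eqP; rewrite kf'.
  by apply: memv_lie; rewrite ?memvf //; apply: memv_lie; rewrite memvf.
apply: contrapT => ab; case/negP: not12; apply/lie_vspaceP => x y _ _.
rewrite -kf'; apply: contrapT => /negP xy; apply: ab.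
by exists (f' x), (f' y); rewrite -lie_f'.
Qed.

(** * The Killing form of a minimal nonsolvable quotient *)

Section GeneralizedEigenvectors.
Variables (C : numClosedFieldType) (n : nat) (a : 'M[C]_n.+1).
Implicit Types (p q : {poly C}) (rs : seq C).

Lemma trig_horner (T : 'M[C]_n.+1) p : is_trig_mx T ->
  is_trig_mx (horner_mx T p) /\ forall i, horner_mx T p i i = p.[T i i].
Proof.
move=> /is_trig_mxP trT; elim/poly_ind: p => [|p c [/is_trig_mxP IHp IHd]].
  rewrite rmorph0; split=> [|i]; last by rewrite mxE horner0.
  by apply/is_trig_mxP => i j _; rewrite mxE.
have pE : horner_mx T (p * 'X + c%:P) = horner_mx T p *m T + c%:M.
  by rewrite rmorphD rmorphM /= horner_mx_X horner_mx_C.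
rewrite pE; split=> [|i].
  apply/is_trig_mxP => i j ij; rewrite !mxE big1 ?add0r => [|k _].
    by rewrite -val_eqE ltn_eqF.
  case: (ltnP i k) => [/IHp->|ki]; first by rewrite mul0r.
  by rewrite (trT k) ?mulr0 //; apply: leq_ltn_trans ij.
rewrite !mxE eqxx (bigD1 i) //= big1 ?addr0 => [|k ki].
  by rewrite IHd !hornerE.
case: (ltngtP i k) => [/IHp->|ik|/val_inj ik]; first by rewrite mul0r.
  by rewrite (trT k i) ?mulr0.
by rewrite ik eqxx in ki.
Qed.

Lemma trace_horner : exists rs : seq C,
  horner_mx a (\prod_(z <- rs) ('X - z%:P)) = 0 /\
  forall p, \tr (horner_mx a p) = \sum_(z <- rs) p.[z] /\
    (horner_mx a p = 0 -> all (root p) rs).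
Proof.
have [P /unitarymx_unit uP] := Schur a (ltn0Sn n).
rewrite /similar_to conjumx //; set T := (P *m a *m _) => trT.
have aE p : horner_mx a p = invmx P *m horner_mx T p *m P.
  by rewrite horner_mx_uconj // !mulmxA mulVmx // mul1mx mulmxKV.
exists [seq T i i | i <- enum 'I_n.+1]; split=> [|p].
  rewrite big_map big_enum /= aE -char_poly_trig //.
  by rewrite (Cayley_Hamilton T) mulmx0 mul0mx.
split=> [|p0].
  rewrite big_map big_enum aE mxtrace_mulC mulmxA mulmxV // mul1mx.
  by apply: eq_bigr => i _; rewrite (trig_horner p trT).2.
apply/allP => _ /mapP[i _ ->]; rewrite rootE -(trig_horner p trT).2.
have -> : horner_mx T p = P *m horner_mx a p *m invmx P.
  by rewrite aE !mulmxA mulmxV // mul1mx mulmxK.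
by rewrite p0 mulmx0 mul0mx mxE.
Qed.

Lemma coprime_powers N z rs : z \notin rs ->
  coprimep (('X - z%:P) ^+ N) (\prod_(w <- rs) ('X - w%:P) ^+ N).
Proof.
elim: rs => [|w rs IHrs]; first by rewrite big_nil coprimep1.
rewrite inE negb_or => /andP[zw zrs]; rewrite big_cons coprimepMr IHrs // andbT.
by rewrite coprimep_expl ?coprimep_expr // coprimep_XsubC root_XsubC eq_sym.
Qed.

Lemma bezout_powers N z rs : z \notin rs -> exists u v : {poly C},
  u * ('X - z%:P) ^+ N + v * (\prod_(w <- rs) ('X - w%:P) ^+ N) = 1.
Proof.
by move=> zrs; have /Bezout_eq1_coprimepP[[u v] uv] := coprime_powers N zrs; exists u, v.
Qed.

(** The Chinese remainder theorem for the pairwise coprime powers of ['X - z%:P]. *)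
Lemma interpolate_powers N rs (f : C -> C) : uniq rs ->
  exists q, forall z, z \in rs -> exists r, q = (f z)%:P + r * ('X - z%:P) ^+ N.
Proof.
elim: rs => [|z rs IHrs] /=; first by exists 0.
case/andP=> zrs /IHrs[q qP]; have [u [v uv]] := bezout_powers N zrs.
set B := \prod_(w <- rs) _ in uv.
exists (q + v * B * ((f z)%:P - q)) => w; rewrite inE => /orP[/eqP->|wrs].
  exists (u * (q - (f z)%:P)).
  have -> : v * B = 1 - u * ('X - z%:P) ^+ N by rewrite -uv addrAC subrr add0r.
  by ring.
have [r ->] := qP w wrs.
have [B' BE] : exists B', B = B' * ('X - w%:P) ^+ N.
  by exists (\prod_(w' <- rem w rs) ('X - w'%:P) ^+ N); rewrite /B (big_rem w) //= mulrC.
by exists (r + v * B' * ((f z)%:P - ((f w)%:P + r * ('X - w%:P) ^+ N))); rewrite BE; ring.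
Qed.

Lemma horner_mx_mul p q : horner_mx a (p * q) = horner_mx a p *m horner_mx a q.
Proof. by rewrite rmorphM. Qed.

Lemma generalized_decomposition N rs (u : 'rV[C]_n.+1) : uniq rs ->
  u *m horner_mx a (\prod_(z <- rs) ('X - z%:P) ^+ N) = 0 ->
  exists2 v : C -> 'rV[C]_n.+1, u = \sum_(z <- rs) v z &
    forall z, z \in rs -> v z *m horner_mx a (('X - z%:P) ^+ N) = 0.
Proof.
elim: rs u => [|z rs IHrs] u /=.
  by rewrite big_nil rmorph1 mulmx1 => _ ->; exists (fun=> 0) => //; rewrite big_nil.
case/andP=> zrs urs; rewrite big_cons; have [r [t rt]] := bezout_powers N zrs.
set A := _ ^+ N in rt *; set B := \prod_(w <- rs) _ in rt * => uAB.
have [||v uE vP] := IHrs (u *m horner_mx a (r * A)) => //.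
  by rewrite -mulmxA -horner_mx_mul -mulrA mulrC horner_mx_mul mulmxA uAB mul0mx.
exists (fun w => if w == z then u *m horner_mx a (t * B) else v w) => [|w].
  rewrite big_cons eqxx -[LHS]mulmx1 -[1%:M](rmorph1 (horner_mx a)) -rt addrC.
  rewrite rmorphD /= mulmxDr uE; congr (_ + _); rewrite big_seq [RHS]big_seq.
  by apply: eq_bigr => w wrs; case: eqP => // wz; rewrite -wz wrs in zrs.
rewrite inE; case: eqP => [-> _|_ /vP //].
by rewrite -mulmxA -horner_mx_mul -mulrA mulrC [B * A]mulrC horner_mx_mul mulmxA uAB mul0mx.
Qed.

(* [F] acts on the generalized eigenspaces of [a] by conjugate eigenvalues.  The
   exponent [N.*2] is what brackets of generalized eigenvectors require. *)
Lemma conj_operator : exists (F : 'M[C]_n.+1) (rs : seq C) N,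
  [/\ \tr (a *m F) = 0 -> exists k, a ^+ k = 0,
      forall z (u : 'rV_n.+1), u *m (a - z%:M) ^+ N.*2 = 0 -> u *m F = z^* *: u
    & forall u : 'rV_n.+1, exists2 v : C -> 'rV[C]_n.+1, u = \sum_(z <- rs) v z &
        forall z, z \in rs -> v z *m (a - z%:M) ^+ N = 0].
Proof.
have [rs0 [a_rs0 tr_a]] := trace_horner.
pose rs := undup rs0; pose N := size rs0.
have [q qP] := interpolate_powers N.*2 (fun z => z^*) (undup_uniq rs0).
have XaE z k : horner_mx a (('X - z%:P) ^+ k) = (a - z%:M) ^+ k.
  by rewrite rmorphXn rmorphB /= horner_mx_X horner_mx_C.
have a_rs : horner_mx a (\prod_(z <- rs) ('X - z%:P) ^+ N) = 0.
  have [r ->] : exists r, \prod_(z <- rs) ('X - z%:P) ^+ N =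
      r * \prod_(z <- rs0) ('X - z%:P).
    exists (\prod_(z <- rs) ('X - z%:P) ^+ (N - count_mem z rs0)).
    rewrite -[X in _ * X]prodr_undup_exp_count -/rs -big_split; apply: eq_bigr => z _ /=.
    by rewrite -exprD subnK // count_size.
  by rewrite horner_mx_mul a_rs0 mulmx0.
exists (horner_mx a q), rs, N; split=> [|z u uz|u].
- rewrite -[X in X *m _](horner_mx_X a) -horner_mx_mul (tr_a _).1 => sum0.
  exists N; have -> : a ^+ N = (a - 0%:M) ^+ N by rewrite raddf0 subr0.
  rewrite -XaE.
  have rs00 : all (pred1 0) rs0.
    (* The trace of [a F] is the sum of [z * z^*], so its vanishing forces all eigenvalues to be
       0. *)
    have : \sum_(z <- rs0) `|z| ^+ 2 = 0.
      rewrite -[RHS]sum0 big_seq [RHS]big_seq; apply: eq_bigr => z zrs.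
      have [|r ->] := qP z; first by rewrite mem_undup.
      have N0 : (0 < N)%N by rewrite /N; case: (rs0) zrs.
      by rewrite normCK !hornerE subrr expr0n double_eq0 eqn0Ngt N0 mulr0 addr0.
    move/eqP; rewrite psumr_eq0 => [|z _]; last by rewrite exprn_ge0.
    by apply: sub_all => z /=; rewrite sqrf_eq0 normr_eq0.
  rewrite -[RHS]a_rs0 /N; congr (horner_mx a _).
  elim: (rs0) rs00 => [|z s IHs] /=; first by rewrite big_nil.
  by case/andP=> /eqP-> /IHs ss; rewrite big_cons -ss exprS.
- have [zrs|zrs] := boolP (z \in rs).
    have [r ->] := qP z zrs.
    rewrite mulrC rmorphD /= horner_mx_mul XaE horner_mx_C mulmxDr mulmxA uz mul0mx addr0.
    by rewrite mul_mx_scalar.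
  have [s [t st]] := bezout_powers N.*2 zrs.
  (* Here [z] is not an eigenvalue, and a coprimality relation shows that there is no nonzero
     generalized eigenvector. *)
  have -> : u = 0; last by rewrite mul0mx scaler0.
  rewrite -[u]mulmx1 -[1%:M](rmorph1 (horner_mx a)) -st rmorphD /= mulmxDr.
  rewrite mulrC !horner_mx_mul !mulmxA XaE uz mul0mx add0r.
  have -> : \prod_(w <- rs) ('X - w%:P) ^+ N.*2 =
      \prod_(w <- rs) ('X - w%:P) ^+ N * \prod_(w <- rs) ('X - w%:P) ^+ N.
    by rewrite -big_split; apply: eq_bigr => w _ /=; rewrite -exprD addnn.
  by rewrite horner_mx_mul a_rs mul0mx mulmx0.
have [|v -> vP] := @generalized_decomposition N rs u (undup_uniq rs0).
  by rewrite a_rs mulmx0.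
by exists v => // z zrs; rewrite -XaE vP.
Qed.

End GeneralizedEigenvectors.

Section Adjoint.
Variables (F : fieldType) (g : finLieType F) (n : nat) (e : n.-tuple g).
Hypothesis basis_e : basis_of fullv e.

Definition crd (v : g) : 'rV[F]_n := \row_i coord e i v.
Definition vec (u : 'rV[F]_n) : g := \sum_i u 0 i *: e`_i.
(* Matrices act on row vectors from the right, so [v |-> lie v x] is what makes
   [adm] a homomorphism. *)
Definition adm (x : g) : 'M[F]_n := \matrix_(i, j) coord e j (lie e`_i x).

Lemma linear_crd : linear crd.
Proof. by move=> a v w; apply/rowP => i; rewrite !mxE linearP. Qed.

Lemma linear_vec : linear vec.
Proof.
move=> a u v; rewrite /vec scaler_sumr -big_split; apply: eq_bigr => i _ /=.
by rewrite !mxE scalerDl scalerA.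
Qed.

Lemma crdK : cancel crd vec.
Proof.
move=> v; rewrite [RHS](coord_basis basis_e (memvf v)).
by apply: eq_bigr => i _; rewrite mxE.
Qed.

Lemma vecK : cancel vec crd.
Proof.
move=> u; apply/rowP => i; rewrite mxE /vec coord_sum_free //.
exact: basis_free basis_e.
Qed.

Lemma crd_adm v x : crd v *m adm x = crd (lie v x).
Proof.
apply/rowP => j; rewrite !mxE [v in RHS](coord_basis basis_e (memvf v)).
rewrite lie_suml linear_sum; apply: eq_bigr => i _ /=.
by rewrite !mxE lieZl linearZ.
Qed.

Lemma eq_crd_mulmx m (A B : 'M[F]_(n, m)) :
  (forall v, crd v *m A = crd v *m B) -> A = B.
Proof.
move=> AB; apply/row_matrixP => i; rewrite !rowE.
by rewrite -(vecK (delta_mx 0 i)) AB.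
Qed.

Lemma linear_adm : linear adm.
Proof. by move=> a x y; apply/matrixP => i j; rewrite !mxE lieDr lieZr linearP. Qed.

Lemma adm_hom : lie_hom adm.
Proof.
split=> [|x y]; first exact: linear_adm.
apply: eq_crd_mulmx => v; rewrite mx_lieE mulmxBr !mulmxA !crd_adm.
rewrite -(linB linear_crd) lie_leibniz [lie x (lie v y)]lieC.
by rewrite [lie (lie v x) y]lieC addrC.
Qed.

Definition killing x y := \tr (adm x *m adm y).

Lemma killingC x y : killing x y = killing y x.
Proof. exact: mxtrace_mulC. Qed.

Lemma linear_killing y : linear (killing^~ y : g -> F^o).
Proof.
by move=> a x x'; rewrite /killing linear_adm mulmxDl -scalemxAl linearP.
Qed.

Lemma killing_inv x y z : killing (lie x y) z = killing x (lie y z).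
Proof.
have [_ lie_adm] := adm_hom; rewrite /killing !lie_adm !mx_lieE mulmxBl mulmxBr.
rewrite !linearB /= !mulmxA; congr (_ - _).
by rewrite [in RHS]mxtrace_mulC mulmxA.
Qed.

(** Since [v |-> lie v x] is a derivation, subtracting [la + mu] from it distributes over [lie v w]
    as [la] on [v] and [mu] on [w]; each resulting term lowers one exponent, so induction on [p + q]
    applies. *)
Lemma generalized_eigen_lie (x : g) la mu p q v w :
  crd v *m (adm x - la%:M) ^+ p = 0 -> crd w *m (adm x - mu%:M) ^+ q = 0 ->
  crd (lie v w) *m (adm x - (la + mu)%:M) ^+ (p + q) = 0.
Proof.
have crd0 u : crd u = 0 -> u = 0.
  by move=> u0; rewrite -(crdK u) u0 (lin0 linear_vec).
have crdB u c : crd u *m (adm x - c%:M) = crd (lie u x - c *: u).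
  by rewrite mulmxBr crd_adm mul_mx_scalar (linB linear_crd) (linZ linear_crd).
elim: {p q}(p + q)%N {-2}p {-2}q (erefl (p + q)%N) v w => [|m IHm] p q pq v w.
  move: pq => /eqP; rewrite addn_eq0 => /andP[/eqP-> _].
  by rewrite expr0 mulmx1 => /crd0->; rewrite lie0x (lin0 linear_crd) mul0mx.
case: p pq => [_|p pq].
  by rewrite expr0 mulmx1 => /crd0->; rewrite lie0x (lin0 linear_crd) mul0mx.
case: q pq => [_|q pq].
  by rewrite expr0 mulmx1 => _ /crd0->; rewrite liex0 (lin0 linear_crd) mul0mx.
move=> vp wq; rewrite addSn exprS mulmxA crdB.
move: (vp) (wq); rewrite !exprS !mulmxA !crdB => vp' wq'.
have -> : lie (lie v w) x - (la + mu) *: lie v w =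
    lie (lie v x - la *: v) w + lie v (lie w x - mu *: w).
  rewrite lieBl lieBr lieZl lieZr scalerDl opprD addrACA; congr (_ + _).
  by rewrite lieC lie_leibniz opprD -lieNl -lieC -lieNr -lieC.
rewrite (linD linear_crd) mulmxDl.
move: pq; rewrite addSn => -[pq].
have -> : crd (lie (lie v x - la *: v) w) *m (adm x - (la + mu)%:M) ^+ (p + q.+1) = 0.
  exact: IHm.
by rewrite add0r -addSnnS; apply: IHm => //; rewrite addSnnS.
Qed.

End Adjoint.

Section CartanNilpotent.
Variables (C : numClosedFieldType) (g : finLieType C) (n : nat) (e : n.+1.-tuple g).
Hypothesis basis_e : basis_of fullv e.
Variable P : {vspace g}.
Hypothesis perfectP : (P <= lie_vspace P P)%VS.
Hypothesis killP : forall x y, x \in P -> killing e x y = 0.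

(** The operator [F] of conjugate eigenvalues comes from a derivation [D]. As [P] is perfect, it
    suffices to see that the trace of [[ad y, ad z] F] vanishes for [y] and [z] in [P]; it equals
    [killing e y (D z)]. Here [D z] may leave [P], which is why [killP] has an arbitrary second
    argument. *)
Lemma killing_null_nilpotent x : x \in P -> exists k, adm e x ^+ k = 0.
Proof.
move=> xP; have [F [rs [N [nilF eigF decF]]]] := conj_operator (adm e x).
have [lin_adm lie_adm] := adm_hom basis_e.
have lin_crd := linear_crd e; have lin_vec := linear_vec e.
pose D y := vec e (crd e y *m F).
have DE y : crd e (D y) = crd e y *m F by rewrite vecK.
have eigD z v : crd e v *m (adm e x - z%:M) ^+ N = 0 -> crd e v *m F = z^* *: crd e v.
  move=> vN; apply: eigF; rewrite -addnn exprD.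
  by rewrite [_ ^+ N * _ ^+ N]/(_ *m _) mulmxA vN mul0mx.
(* On generalized eigenvectors the Leibniz rule is the additivity of complex conjugation. *)
have D_lie_eig z w v u : crd e v *m (adm e x - z%:M) ^+ N = 0 ->
    crd e u *m (adm e x - w%:M) ^+ N = 0 -> D (lie v u) = lie (D v) u + lie v (D u).
  move=> vz uw; rewrite /D (eigD _ _ vz) (eigD _ _ uw) !(linZ lin_vec) !crdK //.
  rewrite lieZl lieZr -scalerDl -rmorphD /= (eigF (z + w)) ?(linZ lin_vec) ?crdK //.
  by rewrite -addnn; apply: generalized_eigen_lie.
have linD : linear D by move=> c y z; rewrite /D lin_crd mulmxDl -scalemxAl lin_vec.
have dec y : exists2 v : C -> g, y = \sum_(z <- rs) v z &
    forall z, z \in rs -> crd e (v z) *m (adm e x - z%:M) ^+ N = 0.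
  have [v yE vP] := decF (crd e y).
  exists (fun z => vec e (v z)) => [|z zrs]; last by rewrite vecK // vP.
  by rewrite -[LHS](crdK basis_e) yE (lin_sum lin_vec).
have D_lie v u : D (lie v u) = lie (D v) u + lie v (D u).
  have [v' vE v'P] := dec v; have [u' uE u'P] := dec u.
  rewrite vE (lin_sum linD) !(lin_sum (@linear_liel _ _ _)) (lin_sum linD) -big_split.
  rewrite big_seq [RHS]big_seq; apply: eq_bigr => z zrs /=.
  rewrite uE (lin_sum linD) !(lin_sum (@linear_lier _ _ _)) (lin_sum linD) -big_split.
  rewrite big_seq [RHS]big_seq; apply: eq_bigr => w wrs /=.
  by apply: D_lie_eig; [apply: v'P | apply: u'P].
have admD z : adm e z *m F - F *m adm e z = adm e (D z).
  apply: (eq_crd_mulmx basis_e) => v.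
  rewrite mulmxBr !mulmxA crd_adm // -!DE !crd_adm // -DE -(linB lin_crd) D_lie.
  by rewrite addrAC subrr add0r.
apply: nilF.
have lin_tr : linear ((fun y => \tr (adm e y *m F)) : g -> C^o).
  by move=> c y z; rewrite lin_adm mulmxDl -scalemxAl linearP.
have [K memK] := linear_kernel lin_tr.
have /subvP/(_ x xP) : (P <= K)%VS.
  apply: subv_trans perfectP _; apply/lie_vspaceP => y z yP zP.
  rewrite memK lie_adm mx_lieE mulmxBl linearB /=.
  have -> : \tr (adm e z *m adm e y *m F) = \tr (adm e y *m (F *m adm e z)).
    by rewrite -mulmxA mxtrace_mulC mulmxA.
  rewrite -mulmxA -linearB /= -mulmxBr admD.
  by apply/eqP; apply: killP.
by rewrite memK => /eqP.
Qed.

End CartanNilpotent.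

(** Engel's theorem for [U] acting on [X] modulo [W], phrased without quotient spaces. A maximal
    proper subalgebra [K] has codimension 1, by induction applied to [K] acting on [U] modulo [K];
    then induction applies to [K] acting on [X] modulo [W]. *)
Lemma engel (F : fieldType) (g : finLieType F) (n : nat) (U : {vspace g}) :
  (\dim U <= n)%N -> {in U &, forall x y, lie x y \in U} ->
  (forall x y, x \in U -> exists k, iter k (lie x) y = 0) ->
  forall X W : {vspace g}, ~~ (X <= W)%VS ->
  {in U & X, forall x y, lie x y \in X} ->
  {in U & W, forall x y, lie x y \in W} ->
  exists v, [/\ v \in X, v \notin W & forall x, x \in U -> lie x v \in W].
Proof.
elim: n U => [|n IHn] U dimU subU nilU X W XW UX UW.
  have U0 : U = 0%VS by apply/eqP; rewrite -dimv_eq0 -leqn0.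
  have [v vX vW] : exists2 v, v \in X & v \notin W.
    apply: contrapT => no; case/negP: XW; apply/subvP => v vX.
    by apply: contrapT => /negP vW; apply: no; exists v.
  by exists v; split=> // x; rewrite U0 memv0 => /eqP->; rewrite lie0x mem0v.
have [U0|Upos] := posnP (\dim U).
  by apply: (IHn U) => //; rewrite U0.
pose proper_sub (K : {vspace g}) :=
  [/\ (K <= U)%VS, (\dim K < \dim U)%N & {in K &, forall x y, lie x y \in K}].
have [K [[KU ltKU subK] maxK]] : exists K, proper_sub K /\
    forall K', proper_sub K' -> (\dim K' <= \dim K)%N.
  have exP : exists d, `[< exists2 K, proper_sub K & \dim K = d >].
    exists 0%N; apply/asboolP; exists 0%VS; last exact: dimv0.
    split; rewrite ?sub0v ?dimv0 // => x y; rewrite !memv0 => /eqP-> _.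
    by rewrite lie0x.
  have ubP d : `[< exists2 K, proper_sub K & \dim K = d >] -> (d <= \dim U)%N.
    by move=> /asboolP[K [_ ltKU _] <-]; apply: ltnW.
  case: (ex_maxnP exP ubP) => d /asboolP[K pK <-] maxK.
  by exists K; split=> // K' pK'; apply: maxK; apply/asboolP; exists K'.
have dimK : (\dim K <= n)%N by rewrite -ltnS (leq_trans ltKU).
have nilK x y : x \in K -> exists k, iter k (lie x) y = 0.
  by move=> /(subvP KU) /nilU.
have [|||v [vU vK Kv]] := IHn K dimK subK nilK U K => //.
- by apply: contraL ltKU => /dimvS; rewrite -leqNgt.
- by move=> x y /(subvP KU) xU yU; apply: subU.
have KvU : (K + <[v]>)%VS = U.
  apply/eqP; rewrite eqEdim subv_add KU -memvE vU /=.
  rewrite leqNgt; apply/negP => ltU.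
  suff pK' : proper_sub (K + <[v]>)%VS.
    have := maxK _ pK'; rewrite leqNgt => /negP; apply.
    rewrite ltn_neqAle dimvS ?addvSl // andbT; apply: contra vK => eqd.
    have /eqP-> : K == (K + <[v]>)%VS by rewrite eqEdim addvSl (eqP eqd) leqnn.
    by apply: (subvP (addvSr _ _)); apply: memv_line.
  split=> //; first by rewrite subv_add KU -memvE vU.
  move=> _ _ /memv_addP[k kK [_ /vlineP[a ->] ->]] /memv_addP[k' kK' [_ /vlineP[b ->] ->]].
  apply: (subvP (addvSl _ _)).
  rewrite lieDl !lieDr !lieZl !lieZr liexx !scaler0 addr0.
  apply: rpredD; last by rewrite rpredZ // lieC rpredN Kv.
  by apply: rpredD; [apply: subK | rewrite rpredZ // Kv].
have [|||w [wX wW Kw]] := IHn K dimK subK nilK X W => //.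
- by move=> x y /(subvP KU); apply: UX.
- by move=> x y /(subvP KU); apply: UW.
(* All iterates stay annihilated by [K] modulo [W], since [v] normalizes [K]; the last one outside
   [W] is annihilated by [v] as well. *)
pose w_ j := iter j (lie v) w.
have w_X j : w_ j \in X by elim: j => //= j IHj; apply: UX.
have w_K j : forall k, k \in K -> lie k (w_ j) \in W.
  elim: j => //= j IHj k kK; rewrite lie_leibniz rpredD //.
    by apply: IHj; apply: Kv.
  by apply: UW => //; apply: IHj.
have exj : exists j, w_ j \in W.
  by have [j wj0] := nilU v w vU; exists j; rewrite /w_ wj0 mem0v.
case: (ex_minnP exj) => -[|j] wjW minj; first by case/negP: wW.
exists (w_ j); split=> //; first by apply/negP => /minj; rewrite ltnn.
move=> x; rewrite -KvU => /memv_addP[k kK [_ /vlineP[a ->] ->]].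
by rewrite lieDl lieZl rpredD ?w_K // rpredZ.
Qed.

(** A maximal proper [P]-stable subspace [W] of [P] has codimension 1 by Engel, and [P] acts
    trivially modulo [W]; hence [[P, P]] lies in [W]. *)
Lemma engel_not_perfect (F : fieldType) (g : finLieType F) (P : {vspace g}) :
  P != 0%VS -> {in P &, forall x y, lie x y \in P} ->
  (forall x y, x \in P -> exists k, iter k (lie x) y = 0) ->
  ~~ (P <= lie_vspace P P)%VS.
Proof.
move=> P0 subP nilP; apply/negP => perfP.
pose proper_stable (W : {vspace g}) :=
  [/\ (W <= P)%VS, (\dim W < \dim P)%N & {in P & W, forall x y, lie x y \in W}].
have [W [[WP ltWP PW] maxW]] : exists W, proper_stable W /\
    forall W', proper_stable W' -> (\dim W' <= \dim W)%N.
  have exP : exists d, `[< exists2 W, proper_stable W & \dim W = d >].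
    exists 0%N; apply/asboolP; exists 0%VS; last exact: dimv0.
    split; rewrite ?sub0v ?dimv0 ?lt0n ?dimv_eq0 // => x y _.
    by rewrite !memv0 => /eqP->; rewrite liex0.
  have ubP d : `[< exists2 W, proper_stable W & \dim W = d >] -> (d <= \dim P)%N.
    by move=> /asboolP[W [_ ltWP _] <-]; apply: ltnW.
  case: (ex_maxnP exP ubP) => d /asboolP[W pW <-] maxW.
  by exists W; split=> // W' pW'; apply: maxW; apply/asboolP; exists W'.
have nPW : ~~ (P <= W)%VS by apply: contraL ltWP => /dimvS; rewrite -leqNgt.
have [v [vP vW Pv]] := engel (leqnn _) subP nilP nPW subP PW.
have WvP : (W + <[v]>)%VS = P.
  apply/eqP; rewrite eqEdim subv_add WP -memvE vP /= leqNgt; apply/negP => ltP.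
  suff /maxW : proper_stable (W + <[v]>)%VS.
    rewrite leqNgt => /negP; apply; rewrite ltn_neqAle dimvS ?addvSl // andbT.
    apply: contra vW => eqd.
    have /eqP-> : W == (W + <[v]>)%VS by rewrite eqEdim addvSl (eqP eqd) leqnn.
    by apply: (subvP (addvSr _ _)); apply: memv_line.
  split=> //; first by rewrite subv_add WP -memvE vP.
  move=> x _ xP /memv_addP[w wW [_ /vlineP[a ->] ->]].
  apply: (subvP (addvSl _ _)).
  by rewrite lieDr lieZr rpredD ?PW // rpredZ // Pv.
case/negP: nPW; apply: subv_trans perfP _; apply/lie_vspaceP => x y xP.
rewrite -{1}WvP => /memv_addP[w wW [_ /vlineP[a ->] ->]].
by rewrite lieDr lieZr rpredD ?PW // rpredZ // Pv.
Qed.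

Section DerivedSeries.
Variables (F : fieldType) (g : finLieType F).
Local Notation D := (derived_series g).

Lemma derived_seriesS k : (D k.+1 <= D k)%VS.
Proof. by elim: k => [|k IHk]; [apply: subvf | apply: lie_vspaceS]. Qed.

Lemma derived_series_mono k l : (k <= l)%N -> (D l <= D k)%VS.
Proof.
move=> /subnK <-; elim: (l - k)%N => // m IHm.
by apply: subv_trans IHm; apply: derived_seriesS.
Qed.

Lemma derived_series_stable : ~ lie_solvable g ->
  exists P : {vspace g}, [/\ P != 0%VS, {in P &, forall x y, lie x y \in P},
    (P <= lie_vspace P P)%VS & forall k, (P <= D k)%VS].
Proof.
move=> nsol.
have exd : exists d, `[< exists k, \dim (D k) = d >].
  by exists (\dim (D 0)); apply/asboolP; exists 0%N.
case: (ex_minnP exd) => d /asboolP[k <-] mink.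
have DkD l : (D k <= D l)%VS.
  have [/derived_series_mono //|kl] := leqP l k.
  have /eqP-> // : D l == D k.
  rewrite eqEdim (derived_series_mono (ltnW kl)) /=.
  by apply: mink; apply/asboolP; exists l.
(* A term of least dimension is where the derived series stops decreasing. *)
exists (D k); split=> //; last exact: (DkD k.+1).
- by apply/eqP => Dk0; apply: nsol; exists k.
by move=> x y xD yD; apply: (subvP (derived_seriesS k)); apply: memv_lie.
Qed.

End DerivedSeries.

Lemma derived_series_preim (F : fieldType) (g h : finLieType F) (f : g -> h)
    (K : {vspace g}) k :
  lie_hom f -> (forall x, (f x == 0) = (x \in K)) ->
  derived_series h k = 0%VS -> (derived_series g k <= K)%VS.
Proof.
move=> [lin_f lie_f] kerf hk0.
pose f' : {linear g -> h} := HB.pack f (GRing.isLinear.Build _ _ _ _ f lin_f).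
have fD l x : x \in derived_series g l -> f x \in derived_series h l.
  elim: l x => [|l IHl] x; first by rewrite !memvf.
  have /subvP sD : (derived_series g l.+1 <= linfun f' @^-1: derived_series h l.+1)%VS.
    apply/lie_vspaceP => u v uD vD; rewrite -memv_preim lfunE /= lie_f.
    by apply: memv_lie; apply: IHl.
  by move/sD; rewrite -memv_preim lfunE.
by apply/subvP => x /fD; rewrite hk0 memv0 kerf.
Qed.

Lemma dim_surj_kernel (F : fieldType) (U V : vectType F) (f : U -> V) (K : {vspace U}) :
  linear f -> (forall y, exists x, f x = y) -> (forall x, (f x == 0) = (x \in K)) ->
  (\dim K + \dim (@fullv F V) = \dim (@fullv F U))%N.
Proof.
move=> lin_f surj_f kerf.
pose f' : {linear U -> V} := HB.pack f (GRing.isLinear.Build _ _ _ _ f lin_f).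
have <- : lker (linfun f') = K by apply/vspaceP => x; rewrite memv_ker lfunE /= kerf.
have <- : limg (linfun f') = fullv.
  apply/vspaceP => y; rewrite memvf; have [x <-] := surj_f y.
  by apply/memv_imgP; exists x; rewrite ?memvf ?lfunE.
by rewrite -(limg_ker_dim (linfun f') fullv) capfv.
Qed.

Lemma nonsolvable_killing_quotient (C : numClosedFieldType) (g : finLieType C) :
  ~ lie_solvable g ->
  exists (s : finLieType C) (f : g -> s) n (e : n.+1.-tuple s),
    [/\ lie_hom f, forall y, exists x, f x = y, basis_of fullv e
      & forall x, (forall y, killing e x y = 0) -> x = 0].
Proof.
move=> nsol_g.
pose image (h : finLieType C) := ~ lie_solvable h /\
  exists f : g -> h, lie_hom f /\ forall y, exists x, f x = y.
have exd : exists d, `[< exists2 h, image h & \dim (@fullv C h) = d >].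
  exists (\dim (@fullv C g)); apply/asboolP; exists g => //; split=> //.
  by exists id; split=> // y; exists y.
case: (ex_minnP exd) => d /asboolP[s [nsol [f [hom_f surj_f]]] <-] mins.
have dim0 : (0 < \dim (@fullv C s))%N.
  rewrite lt0n dimv_eq0; apply/eqP => s0; apply: nsol; by exists 0%N.
have [n [e basis_e]] : exists n (e : n.+1.-tuple s), basis_of fullv e.
  move: (vbasis (@fullv C s)) (vbasisP (@fullv C s)).
  by case: (\dim _) dim0 => // n _ e be; exists n, e.
exists s, f, n, e; split=> // x0 x0_kill.
pose k x : 'rV[C]_n.+1 := \row_i killing e x e`_i.
have lin_k : linear k.
  by move=> a x y; apply/rowP => i; rewrite !mxE; apply: (linear_killing e).
have [K memK] := linear_kernel lin_k.
have KP x : x \in K <-> forall y, killing e x y = 0.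
  rewrite memK; split=> [/eqP kx y|kx]; last first.
    by apply/eqP/rowP => i; rewrite !mxE.
  rewrite (coord_basis basis_e (memvf y)) killingC.
  rewrite (lin_sum (linear_killing e x)) big1 // => i _.
  rewrite (linZ (linear_killing e x)) killingC.
  by have /rowP/(_ i) := kx; rewrite !mxE => ->; rewrite scaler0.
have [K0|K0] := eqVneq K 0%VS.
  by apply/eqP; rewrite -memv0 -K0; apply/KP.
have idealK x y : y \in K -> lie x y \in K.
  move=> /KP yK; apply/KP => z; rewrite lieC /killing (linN (linear_adm e)).
  by rewrite mulNmx linearN /= -/(killing _ _ _) killing_inv // yK oppr0.
have [q [f' [hom_f' surj_f' kerf']]] := lie_quotient_exists idealK.
have dimq := dim_surj_kernel hom_f'.1 surj_f' kerf'.
have [l ql] : lie_solvable q.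
  apply: contrapT => nsol_q.
  have : (\dim (@fullv C s) <= \dim (@fullv C q))%N.
    apply: mins; apply/asboolP; exists q => //; split=> //.
    exists (f' \o f); split=> [|y]; first exact: lie_hom_comp.
    by have [x <-] := surj_f' y; have [w <-] := surj_f x; exists w.
  by rewrite -dimq -{2}[\dim fullv]add0n leq_add2r leqn0 dimv_eq0 (negbTE K0).
have [P [P0 subP perfP PD]] := derived_series_stable nsol.
(* By minimality of [s] the quotient by the radical [K] of the Killing form is solvable, so [K]
   contains a late term of the derived series and hence [P]. *)
have PK : (P <= K)%VS by apply: subv_trans (PD l) (derived_series_preim hom_f' kerf' ql).
suff nilP u v : u \in P -> exists k, iter k (lie u) v = 0.
  by have /negP[] := engel_not_perfect P0 subP nilP.
move: u v.
move=> x y xP.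
have [|m am] := killing_null_nilpotent basis_e perfP _ xP.
  by move=> u v /(subvP PK) /KP.
exists m; rewrite -[LHS](crdK basis_e) (_ : crd e _ = 0) ?(lin0 (linear_vec e)) //.
(* The sign arises because [adm e x] brackets with [x] on the right. *)
have -> : crd e (iter m (lie x) y) = crd e y *m (- adm e x) ^+ m.
  elim: (m) => [|j IHj]; first by rewrite expr0 mulmx1.
  rewrite iterS exprSr [(- _) ^+ j * _]/(_ *m _) mulmxA -IHj.
  by rewrite mulmxN crd_adm // lieC (linN (linear_crd e)).
by rewrite exprNn am mulr0 mulmx0.
Qed.

(** * Rigidity of the Casimir eigenvalue *)

(* The third condition makes [D] a derivation of the image of [ev]. *)
Definition derivation_along (A B : comNzRingType) (ev : A -> B) (D : A -> B) :=
  [/\ forall a b, D (a + b) = D a + D b,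
      forall a b, D (a * b) = D a * ev b + ev a * D b
    & forall a, ev a = 0 -> D a = 0].

Lemma size_cancel_lead (F : fieldType) (P Q : {poly F}) :
  P != 0 -> Q != 0 -> (size P <= size Q)%N ->
  (size (lead_coef P *: Q - lead_coef Q *: ('X^(size Q - size P) * P))%R < size Q)%N.
Proof.
move=> P0 Q0 PQ.
have Q_gt0 : (0 < size Q)%N by rewrite lt0n size_poly_eq0.
have P_gt0 : (0 < size P)%N by rewrite lt0n size_poly_eq0.
rewrite -[X in (_ < X)%N](prednK Q_gt0) ltnS; apply/leq_sizeP => j; rewrite leq_eqVlt.
rewrite coefB !coefZ coefXnM => /orP[/eqP<-|Qj].
  rewrite ifF; last by lia.
  have -> : ((size Q).-1 - (size Q - size P))%N = (size P).-1 by lia.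
  by rewrite -!lead_coefE mulrC subrr.
have {}Qj : (size Q <= j)%N by rewrite -(prednK Q_gt0).
rewrite [Q`_j]nth_default // ifF; last by lia.
rewrite nth_default ?mulr0 ?subr0 // leq_subRL ?subnK //.
by apply: leq_trans Qj; apply: leq_subr.
Qed.

(** * Extension of derivations to further elements of the field *)

Section DerivationExtension.
Variables (F : numFieldType) (A : comNzRingType) (ev : {rmorphism A -> F}) (D : A -> F).
Hypothesis derD : derivation_along ev D.
Variable x : F.

Let DD a b : D (a + b) = D a + D b. Proof. by case: derD. Qed.
Let DM a b : D (a * b) = D a * ev b + ev a * D b. Proof. by case: derD. Qed.
Let Dker a : ev a = 0 -> D a = 0. Proof. by case: derD => _ _; apply. Qed.
Let D0 : D 0 = 0. Proof. by apply: Dker; rewrite rmorph0. Qed.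
Let D_sum I (r : seq I) (E : I -> A) : D (\sum_(i <- r) E i) = \sum_(i <- r) D (E i).
Proof. by elim/big_rec2: _ => // i u v _ <-. Qed.

Definition ext_ev : {rmorphism {poly A} -> F} := horner_eval x \o map_poly ev.

(** The chain rule for evaluation at [x], with [y] in the role of the derivative of [x]. *)
Definition ext_der (y : F) (p : {poly A}) : F :=
  (map_poly D p).[x] + (map_poly ev p)^`().[x] * y.

Let ext_evE p : ext_ev p = (map_poly ev p).[x].
Proof. by []. Qed.

Let map_polyDM p q : map_poly D (p * q) =
  map_poly D p * map_poly ev q + map_poly ev p * map_poly D q.
Proof.
apply/polyP => i; rewrite coefD !coefM coef_map_id0 // coefM D_sum -big_split.
by apply: eq_bigr => j _ /=; rewrite DM !coef_map_id0 ?rmorph0.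
Qed.

Lemma ext_derD y p q : ext_der y (p + q) = ext_der y p + ext_der y q.
Proof.
have mD : map_poly D (p + q) = map_poly D p + map_poly D q.
  by apply/polyP => i; rewrite coefD !coef_map_id0 // coefD DD.
by rewrite /ext_der mD rmorphD derivD !hornerD mulrDl addrACA.
Qed.

Lemma ext_derM y p q :
  ext_der y (p * q) = ext_der y p * ext_ev q + ext_ev p * ext_der y q.
Proof.
by rewrite /ext_der map_polyDM rmorphM derivM !ext_evE !hornerE; ring.
Qed.

Lemma ext_derC y a : ext_der y a%:P = D a.
Proof.
have mC : map_poly D a%:P = (D a)%:P.
  by apply/polyP => i; rewrite coef_map_id0 // !coefC; case: ifP.
by rewrite /ext_der mC map_polyC derivC !hornerC mul0r addr0.
Qed.

Lemma ext_derX y : D 1 = 0 -> ext_der y 'X = y.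
Proof.
move=> D1; rewrite /ext_der map_polyX derivX hornerC mul1r.
rewrite (_ : map_poly D 'X = 0) ?horner0 ?add0r //.
apply/polyP => i; rewrite coef_map_id0 // coefX coef0.
by case: (_ == _).
Qed.

Lemma ext_der_ker0 y p : map_poly ev p = 0 -> ext_der y p = 0.
Proof.
move=> p0; rewrite /ext_der p0 deriv0 horner0 mul0r addr0.
rewrite (_ : map_poly D p = 0) ?horner0 //; apply/polyP => i.
rewrite coef_map_id0 // coef0 Dker //.
by have := coef_map ev p i; rewrite p0 coef0.
Qed.

(* When [x] is algebraic, [y] is forced by a relation of minimal degree. *)
Lemma derivation_extend : exists y,
  derivation_along ext_ev (ext_der y) /\
  ((forall p, root (map_poly ev p) x -> map_poly ev p = 0) -> y = 1).
Proof.
have D1 : D 1 = 0.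
  have /eqP := DM 1 1; rewrite mulr1 rmorph1 mulr1 mul1r -subr_eq0 opprD addrA.
  by rewrite subrr add0r oppr_eq0 => /eqP.
have [tr|ntr] := pselect (forall p, root (map_poly ev p) x -> map_poly ev p = 0).
  exists 1; split=> //; split; [exact: ext_derD | exact: ext_derM|].
  by move=> p /eqP p0; apply: ext_der_ker0; apply: tr.
have exn : exists n, `[< exists p, [/\ root (map_poly ev p) x, map_poly ev p != 0
    & size (map_poly ev p) = n] >].
  apply: contrapT => no; apply: ntr => p px; apply: contrapT => p0; apply: no.
  by exists (size (map_poly ev p)); apply/asboolP; exists p; split=> //; apply/eqP.
case: (ex_minnP exn) => n /asboolP[p [px p0 <-]] minp.
have minp' r : root (map_poly ev r) x -> (size (map_poly ev r) < size (map_poly ev p))%N ->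
    map_poly ev r = 0.
  move=> rx; rewrite ltnNge; apply: contraNeq => r0; apply: minp.
  by apply/asboolP; exists r.
(* By minimality of the degree; the characteristic is 0, so the derivative of [p] is a nonzero
   polynomial. *)
have p'x : (map_poly ev p)^`().[x] != 0.
  apply/negP => p'x.
  have size_p : (1 < size (map_poly ev p))%N by apply: root_size_gt1 px.
  have : map_poly ev (p^`()) = 0.
    by apply: minp'; rewrite -deriv_map //; apply: lt_size_deriv.
  rewrite -deriv_map => /polyP/(_ (size (map_poly ev p)).-2); rewrite coef_deriv coef0.
  move/eqP; rewrite mulrn_eq0 /= prednK; last by rewrite -subn1 subn_gt0.
  by rewrite -lead_coefE lead_coef_eq0 (negbTE p0).
exists (- (map_poly D p).[x] / (map_poly ev p)^`().[x]); split; last by [].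
set y := _ / _.
have Dp0 : ext_der y p = 0 by rewrite /ext_der /y mulrCA mulfV // mulr1 subrr.
split; [exact: ext_derD | exact: ext_derM|] => r.
elim: {r}(size (map_poly ev r)) {-2}r (leqnn (size (map_poly ev r))) => [|m IHm] r rm rx.
  by apply: ext_der_ker0; apply/eqP; rewrite -size_poly_eq0 -leqn0.
have [r0|r0] := eqVneq (map_poly ev r) 0; first exact: ext_der_ker0.
have le_pr : (size (map_poly ev p) <= size (map_poly ev r))%N.
  by rewrite leqNgt; apply/negP => /(minp' r) rE; rewrite rE ?eqxx // in r0; apply/eqP.
pose P := map_poly ev p; pose Q := map_poly ev r.
pose lp := p`_(size P).-1; pose lr := r`_(size Q).-1.
(* Coefficients in [A] cannot be inverted, so [r] is first multiplied by [lp], a lift of the leading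
   coefficient of [P], whose image is nonzero. *)
pose r1 := lp%:P * r - lr%:P * 'X^(size Q - size P) * p.
have evr1 : ext_ev r1 = 0.
  have evp : ext_ev p = 0 by apply/eqP.
  by rewrite rmorphB !rmorphM rx evp !mulr0 subr0.
have lpE : ev lp = lead_coef P by rewrite -coef_map.
have lrE : ev lr = lead_coef Q by rewrite -coef_map.
have mr1 : map_poly ev r1 = lead_coef P *: Q - lead_coef Q *: ('X^(size Q - size P) * P).
  by rewrite rmorphB !rmorphM /= !map_polyC map_polyXn -lpE -lrE -!mul_polyC mulrA.
have Dr1 : ext_der y r1 = 0.
  apply: IHm evr1; rewrite mr1 -ltnS; apply: leq_trans rm.
  exact: size_cancel_lead.
have : ext_der y (lp%:P * r) = 0.
  have -> : lp%:P * r = r1 + lr%:P * 'X^(size Q - size P) * p by rewrite subrK.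
  by rewrite ext_derD Dr1 add0r ext_derM Dp0 mulr0 addr0 ext_evE (eqP px) mulr0.
rewrite ext_derM rx mulr0 add0r => /eqP; rewrite mulf_eq0 => /orP[|/eqP //].
by rewrite ext_evE map_polyC hornerC /= lpE lead_coef_eq0 (negbTE p0).
Qed.

End DerivationExtension.

Lemma derivation_chain (F : numFieldType) (A : comNzRingType)
    (ev : {rmorphism A -> F}) (D : A -> F) (l : seq F) :
  derivation_along ev D ->
  exists (B : comNzRingType) (iota : {rmorphism A -> B}) (evB : {rmorphism B -> F})
      (DB : B -> F),
    [/\ derivation_along evB DB, forall a, evB (iota a) = ev a,
        forall a, DB (iota a) = D a & forall x, x \in l -> exists b, evB b = x].
Proof.
elim: l A ev D => [|x l IHl] A ev D derD.
  by exists A, idfun, ev, D.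
have [y [dery _]] := derivation_extend derD x.
have [B [iota [evB [DB [derB evBE DBE Bl]]]]] := IHl _ _ _ dery.
exists B, (iota \o polyC), evB, DB; split=> // [a|a|z] /=.
- by rewrite evBE /= map_polyC /horner_eval hornerC.
- by rewrite DBE (ext_derC derD).
rewrite inE => /orP[/eqP->|/Bl //]; exists (iota 'X).
by rewrite evBE /= map_polyX /horner_eval hornerX.
Qed.

(** Countability ensures later that only countably many numbers are algebraic over the structure
    constants. *)
Lemma countable_subring (F : fieldType) (l : seq F) :
  exists (A : countComNzRingType) (ev : {rmorphism A -> F}),
    forall x, x \in l -> exists a, ev a = x.
Proof.
elim: l => [|x l [A [ev evl]]]; first by exists int, intr.
exists {poly A}, (horner_eval x \o map_poly ev) => z /=.
rewrite inE => /orP[/eqP->|/evl[a <-]].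
  by exists 'X; rewrite map_polyX /horner_eval hornerX.
by exists a%:P; rewrite map_polyC /horner_eval hornerC.
Qed.

Section MatrixDerivation.
Variables (F A : comNzRingType) (ev : {rmorphism A -> F}) (D : A -> F).
Hypothesis derD : derivation_along ev D.

Lemma derivation0 : D 0 = 0.
Proof. by case: derD => _ _; apply; rewrite rmorph0. Qed.

Lemma derivation_sum I (r : seq I) (E : I -> A) :
  D (\sum_(i <- r) E i) = \sum_(i <- r) D (E i).
Proof.
case: derD => DD _ _.
by elim/big_rec2: _ => [|i u v _ <-]; rewrite ?derivation0 ?DD.
Qed.

Lemma map_mx_derD m n (X Y : 'M[A]_(m, n)) : map_mx D (X + Y) = map_mx D X + map_mx D Y.
Proof. by case: derD => DD _ _; apply/matrixP => i j; rewrite !mxE DD. Qed.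

Lemma map_mx_derM m n p (X : 'M[A]_(m, n)) (Y : 'M[A]_(n, p)) :
  map_mx D (X *m Y) = map_mx D X *m map_mx ev Y + map_mx ev X *m map_mx D Y.
Proof.
case: derD => _ DM _; apply/matrixP => i j; rewrite !mxE derivation_sum -big_split.
by apply: eq_bigr => k _ /=; rewrite DM !mxE.
Qed.

Lemma map_mx_derZ m n a (X : 'M[A]_(m, n)) : D a = 0 ->
  map_mx D (a *: X) = ev a *: map_mx D X.
Proof.
case: derD => _ DM _ Da; apply/matrixP => i j.
by rewrite !mxE DM Da mul0r add0r.
Qed.

Lemma map_mx_der_sum m n I (r : seq I) (E : I -> 'M[A]_(m, n)) :
  map_mx D (\sum_(i <- r) E i) = \sum_(i <- r) map_mx D (E i).
Proof.
elim/big_rec2: _ => [|i u v _ <-]; last exact: map_mx_derD.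
by apply/matrixP => i j; rewrite !mxE derivation0.
Qed.

(** An identity that holds only after applying [ev] may be differentiated, by the third condition on
    [D]. *)
Lemma map_mx_der_eq m n (X Y : 'M[A]_(m, n)) :
  map_mx ev X = map_mx ev Y -> map_mx D X = map_mx D Y.
Proof.
case: derD => DD DM Dker evXY; apply/matrixP => i j; rewrite !mxE.
have /matrixP/(_ i j) := evXY; rewrite !mxE => evE.
by rewrite -[X i j](subrK (Y i j)) DD Dker ?add0r // rmorphB /= evE subrr.
Qed.

End MatrixDerivation.

Section KillingNondegenerate.
Variables (F : fieldType) (s : finLieType F) (n : nat) (e : n.-tuple s).
Hypothesis basis_e : basis_of fullv e.
Hypothesis nondeg : forall x, (forall y, killing e x y = 0) -> x = 0.

Definition gram : 'M[F]_n := \matrix_(i, j) killing e e`_i e`_j.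

Definition dual_basis (i : 'I_n) : s := \sum_j invmx gram i j *: e`_j.

Definition casimir_pairs := [seq (e`_i, dual_basis i) | i : 'I_n].

Let killZ a x y : killing e (a *: x) y = a * killing e x y.
Proof. exact: (linZ (linear_killing e y)). Qed.

Let kill_suml I (r : seq I) (E : I -> s) y :
  killing e (\sum_(i <- r) E i) y = \sum_(i <- r) killing e (E i) y.
Proof. exact: (lin_sum (linear_killing e y)). Qed.

Lemma eq_killing x y : (forall z, killing e x z = killing e y z) -> x = y.
Proof.
move=> xy; apply/subr0_eq/nondeg => z.
by rewrite (linB (linear_killing e z)) xy subrr.
Qed.

Lemma eq_killing_basis x y :
  (forall i : 'I_n, killing e x e`_i = killing e y e`_i) -> x = y.
Proof.
move=> xy; apply: eq_killing => z; rewrite (coord_basis basis_e (memvf z)).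
rewrite [LHS]killingC [RHS]killingC !kill_suml; apply: eq_bigr => i _.
by rewrite !killZ killingC xy killingC.
Qed.

Lemma gram_unit : gram \in unitmx.
Proof.
suff kerG (u : 'rV_n) : u *m gram = 0 -> u = 0.
  rewrite -row_free_unit -kermx_eq0; apply/eqP/row_matrixP => i; rewrite row0.
  by apply/kerG/eqP; rewrite -sub_kermx row_sub.
move=> uG; rewrite -(vecK basis_e u) (_ : vec e u = 0) ?(lin0 (linear_crd e)) //.
apply: nondeg => y; rewrite (coord_basis basis_e (memvf y)) killingC kill_suml big1 // => j _.
rewrite killZ killingC /vec kill_suml; have /rowP/(_ j) := uG; rewrite !mxE => uj.
rewrite [X in _ * X](_ : _ = 0) ?mulr0 // -[RHS]uj.
by apply: eq_bigr => k _; rewrite killZ mxE.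
Qed.

Lemma killing_dual (i j : 'I_n) : killing e (dual_basis i) e`_j = (i == j)%:R.
Proof.
rewrite /dual_basis kill_suml.
have /matrixP/(_ i j) := mulVmx gram_unit; rewrite !mxE => <-.
by apply: eq_bigr => k _; rewrite killZ mxE.
Qed.

Lemma crd_dual x : x = \sum_(i < n) killing e x e`_i *: dual_basis i.
Proof.
apply: eq_killing_basis => j; rewrite kill_suml (bigD1 j) //= big1 => [|k kj].
  by rewrite killZ killing_dual eqxx mulr1 addr0.
by rewrite killZ killing_dual (negbTE kj) mulr0.
Qed.

Lemma coord_killing x i : coord e i x = killing e x (dual_basis i).
Proof.
rewrite {2}(coord_basis basis_e (memvf x)) kill_suml (bigD1 i) //= big1 => [|k ki].
  by rewrite killZ killingC killing_dual eqxx mulr1 addr0.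
by rewrite killZ killingC killing_dual eq_sym (negbTE ki) mulr0.
Qed.

Lemma casimirE m (r : s -> 'M[F]_m) : linear r ->
  quad_op casimir_pairs 0 r = \sum_(i < n) r e`_i *m r (dual_basis i).
Proof. by move=> lin_r; rewrite /quad_op (lin0 lin_r) addr0 big_image /=. Qed.

(** Invariance of the Killing form makes the matrices of [ad x] in the two dual bases opposite
    transposes, so the two halves of the commutator cancel. *)
Lemma casimir_central m (r : s -> 'M[F]_m) : lie_hom r ->
  forall x, r x *m quad_op casimir_pairs 0 r = quad_op casimir_pairs 0 r *m r x.
Proof.
move=> [lin_r lie_r] x; rewrite casimirE //; apply/subr0_eq.
rewrite mulmx_sumr mulmx_suml -sumrB.
have E (i : 'I_n) : r x *m (r e`_i *m r (dual_basis i)) - r e`_i *m r (dual_basis i) *m r x =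
   r (lie x e`_i) *m r (dual_basis i) + r e`_i *m r (lie x (dual_basis i)).
  rewrite !lie_r !mx_lieE mulmxBl mulmxBr !mulmxA addrA subrK //.
rewrite (eq_bigr _ (fun i _ => E i)) big_split /=.
have -> : \sum_(i < n) r (lie x e`_i) *m r (dual_basis i) =
    \sum_(i < n) \sum_(j < n) killing e (lie x e`_i) (dual_basis j) *: (r e`_j *m r (dual_basis i)).
  apply: eq_bigr => i _.
  rewrite {1}(coord_basis basis_e (memvf (lie x e`_i))) (lin_sum lin_r) mulmx_suml.
  by apply: eq_bigr => j _; rewrite (linZ lin_r) scalemxAl coord_killing.
have -> : \sum_(i < n) r e`_i *m r (lie x (dual_basis i)) =
    \sum_(i < n) \sum_(j < n) killing e (lie x (dual_basis i)) e`_j *: (r e`_i *m r (dual_basis j)).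
  apply: eq_bigr => i _.
  rewrite {1}(crd_dual (lie x (dual_basis i))) (lin_sum lin_r) mulmx_sumr.
  by apply: eq_bigr => j _; rewrite (linZ lin_r) scalemxAr.
rewrite [X in _ + X]exchange_big -big_split big1 // => i _.
rewrite -big_split big1 // => j _ /=; rewrite -scalerDl.
rewrite [lie x e`_i]lieC (linN (linear_killing e _)) killing_inv //.
by rewrite [killing e (lie _ _) _]killingC addNr scale0r.
Qed.

(* [th] is [killing (D x) y] for a derivation [D], so [th x y] is the trace of
   [D] against a commutator. *)
Lemma skew_of_cocycle (th : s -> s -> F) :
  (forall y, linear (th^~ y : s -> F^o)) -> (forall x, linear (th x : s -> F^o)) ->
  (forall a b y, th (lie a b) y = th a (lie b y) + th b (lie y a)) ->
  forall x y, th x y = - th y x.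
Proof.
move=> th_l th_r th_cocycle.
pose D x := \sum_(j < n) th x e`_j *: dual_basis j.
have DE x y : killing e (D x) y = th x y.
  rewrite /D kill_suml [y in RHS](coord_basis basis_e (memvf y)) (lin_sum (th_r x)).
  apply: eq_bigr => j _; rewrite killZ (linZ (th_r x)) killingC -coord_killing.
  exact: mulrC.
have lin_D : linear D.
  move=> a x y; apply: eq_killing => z.
  by rewrite (linear_killing e z a) !DE; apply: th_l.
have D_lie a b : D (lie a b) = lie (D a) b + lie a (D b).
  apply: eq_killing => z; rewrite DE th_cocycle (linD (linear_killing e z)).
  rewrite -!DE killing_inv // [lie a (D b)]lieC (linN (linear_killing e z)).
  by rewrite killing_inv // [lie z a]lieC !(killingC e (D b)) (linN (linear_killing e _)).
pose M := \matrix_(i < n, j < n) coord e j (D e`_i).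
have crdM v : crd e v *m M = crd e (D v).
  apply/rowP => j; rewrite !mxE [v in RHS](coord_basis basis_e (memvf v)).
  rewrite (lin_sum lin_D) linear_sum; apply: eq_bigr => i _ /=.
  by rewrite !mxE (linZ lin_D) linearZ.
have admD z : adm e z *m M - M *m adm e z = adm e (D z).
  apply: (eq_crd_mulmx basis_e) => v.
  rewrite mulmxBr !mulmxA crd_adm // !crdM !crd_adm // crdM -(linB (linear_crd e)) D_lie.
  by rewrite addrAC subrr add0r.
have thE x y : th x y = \tr (M *m (adm e y *m adm e x - adm e x *m adm e y)).
  rewrite -DE /killing -admD mulmxBl mulmxBr !linearB /= !mulmxA; congr (_ - _).
  by have := mxtrace_mulC (adm e x) (M *m adm e y); rewrite mulmxA.
by move=> x y; rewrite !thE -[X in - \tr (M *m X)]opprB mulmxN linearN opprK.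
Qed.

End KillingNondegenerate.

Lemma eq_linear_basis (F : fieldType) (U : vectType F) (V : lmodType F) n
    (e : n.-tuple U) (f h : U -> V) :
  basis_of fullv e -> linear f -> linear h ->
  (forall i : 'I_n, f e`_i = h e`_i) -> f =1 h.
Proof.
move=> basis_e lin_f lin_h fh x; rewrite (coord_basis basis_e (memvf x)).
rewrite (lin_sum lin_f) (lin_sum lin_h); apply: eq_bigr => i _.
by rewrite (linZ lin_f) (linZ lin_h) fh.
Qed.

Section CasimirRigidity.
Variables (F : numFieldType) (s : finLieType F) (n : nat) (e : n.-tuple s).
Hypothesis basis_e : basis_of fullv e.
Hypothesis nondeg : forall x, (forall y, killing e x y = 0) -> x = 0.
Variables (A : comNzRingType) (ev : {rmorphism A -> F}).
Variable (ga : 'I_n -> 'I_n -> 'I_n -> A) (gi : 'I_n -> 'I_n -> A).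
Hypothesis gaE : forall i j k, ev (ga i j k) = coord e k (lie e`_i e`_j).
Hypothesis giE : forall i j, ev (gi i j) = invmx (gram e) i j.
Variable c : F.
Hypothesis transc : forall p : {poly A}, root (map_poly ev p) c -> map_poly ev p = 0.

Lemma casimir_rigid m (r : s -> 'M[F]_m) : lie_hom r ->
  quad_op (casimir_pairs e) 0 r = c%:M -> m = 0%N.
Proof.
move=> hom_r; have [lin_r lie_r] := hom_r; rewrite casimirE // => cas_r.
(* The zero derivation on the structure constants is extended first to [c], with value 1, and then
   to the entries of the matrices [r e_i]. *)
have der0 : derivation_along ev (fun=> 0).
  by split=> // *; rewrite ?addr0 // mul0r mulr0 addr0.
have [y [der1 /(_ transc) y1]] := derivation_extend der0 c.
pose l := [seq (r e`_(p.1 : 'I_n)) p.2.1 p.2.2 | p : 'I_n * ('I_m * 'I_m)].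
have [B [iota [evB [D [derD evBE DE Bl]]]]] := derivation_chain l der1.
have evBA a : evB (iota a%:P) = ev a by rewrite evBE /= map_polyC /horner_eval hornerC.
have DBA a : D (iota a%:P) = 0 by rewrite DE (ext_derC der0).
have evBc : evB (iota 'X) = c by rewrite evBE /= map_polyX /horner_eval hornerX.
have DBc : D (iota 'X) = 1 by rewrite DE ext_derX.
have [b bE] : exists b : 'I_n -> 'M[B]_m, forall i, map_mx evB (b i) = r e`_i.
  have ex (p : 'I_n * ('I_m * 'I_m)) : exists x, evB x = (r e`_(p.1)) p.2.1 p.2.2.
    by apply: Bl; apply: fintype.image_f.
  have [h hE] := choice ex.
  exists (fun i => \matrix_(j, k) h (i, (j, k))) => i.
  by apply/matrixP => j k; rewrite !mxE hE.
(* Only the matrices of basis elements are differentiated; [r'] extends the result linearly over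
   [F], since [D] is not defined on arbitrary coordinates of [x]. *)
pose r' x := \sum_(i < n) coord e i x *: map_mx D (b i).
have lin_r' : linear r'.
  move=> a u v; rewrite /r' scaler_sumr -big_split; apply: eq_bigr => i _ /=.
  by rewrite linearP scalerDl scalerA.
have coord_e (i j : 'I_n) : coord e i e`_j = (i == j)%:R.
  by rewrite coord_free ?(basis_free basis_e) // eq_sym.
have r'e (i : 'I_n) : r' e`_i = map_mx D (b i).
  rewrite /r' (bigD1 i) //= coord_e eqxx scale1r big1 ?addr0 // => j ji.
  by rewrite coord_e (negbTE ji) scale0r.
have r'_lie_e (i j : 'I_n) : r' (lie e`_i e`_j) =
    r' e`_i *m r e`_j - r e`_j *m r' e`_i + (r e`_i *m r' e`_j - r' e`_j *m r e`_i).
  have rel : map_mx evB (b i *m b j) =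
      map_mx evB (b j *m b i + \sum_k iota (ga i j k)%:P *: b k).
    rewrite map_mxD !map_mxM !bE map_mx_sum.
    rewrite (eq_bigr (fun k => coord e k (lie e`_i e`_j) *: r e`_k)) => [|k _].
      have -> : \sum_(k < n) coord e k (lie e`_i e`_j) *: r e`_k = r (lie e`_i e`_j).
        rewrite [X in r X](coord_basis basis_e (memvf (lie e`_i e`_j))) (lin_sum lin_r).
        by apply: eq_bigr => k _; rewrite (linZ lin_r).
      by rewrite lie_r mx_lieE addrC subrK.
    by rewrite map_mxZ evBA gaE bE.
  have := map_mx_der_eq derD rel.
  rewrite (map_mx_derD derD) !(map_mx_derM derD) !bE -!r'e (map_mx_der_sum derD) => rel'.
  have -> : r' (lie e`_i e`_j) = \sum_(k < n) map_mx D (iota (ga i j k)%:P *: b k).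
    by apply: eq_bigr => k _; rewrite (map_mx_derZ derD) ?DBA // evBA gaE.
  have -> : \sum_(k < n) map_mx D (iota (ga i j k)%:P *: b k) =
    (r' e`_i *m r e`_j + r e`_i *m r' e`_j) - (r' e`_j *m r e`_i + r e`_j *m r' e`_i).
    by rewrite rel' addrAC subrr add0r.
  by rewrite [X in _ - X]addrC opprD addrACA.
have r'_lie u v : r' (lie u v) = lie (r' u) (r v) + lie (r u) (r' v).
  apply: (eq_linear_basis basis_e (f := fun u => r' (lie u v))
    (h := fun u => lie (r' u) (r v) + lie (r u) (r' v))) => [a x z|a x z|i].
  - by rewrite lieDl lieZl lin_r'.
  - by rewrite lin_r' lin_r !lieDl !lieZl [in RHS]scalerDr addrACA.
  apply: (eq_linear_basis basis_e (f := fun v => r' (lie e`_i v))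
    (h := fun v => lie (r' e`_i) (r v) + lie (r e`_i) (r' v))) => [a x z|a x z|j].
  - by rewrite lieDr lieZr lin_r'.
  - by rewrite lin_r' lin_r !lieDr !lieZr [in RHS]scalerDr addrACA.
  by rewrite r'_lie_e.
(* This is the derivative of the equation [z = c]; the entries of the inverse Gram matrix are
   constants. *)
have r'_cas : \sum_(i < n) (r' e`_i *m r (dual_basis e i) + r e`_i *m r' (dual_basis e i)) = 1%:M.
  have rel : map_mx evB (\sum_i \sum_j iota (gi i j)%:P *: (b i *m b j)) =
      map_mx evB ((iota 'X)%:M).
    rewrite map_scalar_mx evBc -cas_r map_mx_sum; apply: eq_bigr => i _.
    rewrite map_mx_sum /dual_basis (lin_sum lin_r) mulmx_sumr.
    apply: eq_bigr => j _.
    by rewrite map_mxZ map_mxM evBA giE !bE (linZ lin_r) scalemxAr.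
  have := map_mx_der_eq derD rel.
  have -> : map_mx D ((iota 'X)%:M : 'M[B]_m) = (1%:M : 'M[F]_m).
    apply/matrixP => i j; rewrite !mxE; case: eqP => _ //=.
    by rewrite !mulr0n (derivation0 derD).
  move=> <-; rewrite (map_mx_der_sum derD); apply: eq_bigr => i _.
  rewrite (map_mx_der_sum derD) /dual_basis (lin_sum lin_r) (lin_sum lin_r').
  rewrite !mulmx_sumr -big_split; apply: eq_bigr => j _ /=.
  rewrite (map_mx_derZ derD) ?DBA // (map_mx_derM derD) !bE evBA giE -!r'e.
  by rewrite (linZ lin_r) (linZ lin_r') -!scalemxAr scalerDr.
pose th u v := \tr (r' u *m r v).
have th_skew : forall u v, th u v = - th v u.
  apply: (skew_of_cocycle basis_e nondeg) => [v|u|u v w].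
  - by move=> a u u'; rewrite /th lin_r' mulmxDl -scalemxAl linearP.
  - by move=> a v v'; rewrite /th lin_r mulmxDr -scalemxAr linearP.
  have cyc (X Y Z : 'M[F]_m) : \tr (X *m Y *m Z) = \tr (Y *m (Z *m X)).
    by rewrite -mulmxA mxtrace_mulC mulmxA.
  rewrite /th r'_lie !lie_r !mx_lieE mulmxDl !mulmxBl !mulmxBr mxtraceD !linearB /=.
  by rewrite (cyc (r v)) (cyc (r u)) -(mulmxA (r' u)) -(mulmxA (r' v)).
have : \tr (1%:M : 'M[F]_m) = 0.
  rewrite -r'_cas linear_sum big1 // => i _ /=.
  by rewrite linearD /= [X in _ + X]mxtrace_mulC -/(th _ _) -/(th _ _) th_skew addNr.
by rewrite mxtrace1 => /eqP; rewrite pnatr_eq0 => /eqP.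
Qed.

End CasimirRigidity.

Section CasimirPowers.
Variables (C : numClosedFieldType) (s : finLieType C) (n : nat) (e : n.+1.-tuple s).
Hypothesis basis_e : basis_of fullv e.
Hypothesis nondeg : forall x, (forall y, killing e x y = 0) -> x = 0.
Local Notation cas := (quad_op (casimir_pairs e) 0).

(** The element [t] represents the trace form. Traces of commutators vanish, so [t] is central,
    whence [adm e t = 0] and the form is 0. *)
Lemma mxtrace_adm x : \tr (adm e x) = 0.
Proof.
have lin_tr : linear ((fun y => \tr (adm e y)) : s -> C^o).
  by move=> a u v; rewrite linear_adm linearP.
pose t := \sum_(i < n.+1) \tr (adm e e`_i) *: dual_basis e i.
have tE y : \tr (adm e y) = killing e t y.
  apply: (eq_linear_basis basis_e lin_tr) => [|i].
    by move=> a u v; rewrite killingC linear_killing !(killingC e t).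
  rewrite /t (lin_sum (linear_killing e _)) (bigD1 i) //= big1 => [|j ji].
    by rewrite (linZ (linear_killing e _)) killing_dual // eqxx addr0 [RHS]mulr1.
  by rewrite (linZ (linear_killing e _)) killing_dual // (negbTE ji) [LHS]mulr0.
have [_ lie_adm] := adm_hom basis_e.
have t_central u : lie t u = 0.
  apply: nondeg => v; rewrite killing_inv // -tE lie_adm mx_lieE linearB /=.
  by rewrite mxtrace_mulC subrr.
have admt : adm e t = 0.
  by apply/matrixP => i j; rewrite !mxE lieC t_central oppr0 linear0.
by rewrite tE /killing admt mul0mx mxtrace0.
Qed.

(** * Truncations of the enveloping algebra *)

(* Traces on [r (x) 1 + 1 (x) adm]: the mixed terms vanish since [\tr (adm x) = 0]. *)
Lemma casimir_trace_unbounded k : exists D (r : s -> 'M[C]_D.+1),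
  lie_hom r /\ \tr (cas r) = k%:R * D.+1%:R.
Proof.
elim: k => [|k [D [r [hom_r tr_r]]]].
  have hom0 : lie_hom (fun _ : s => 0 : 'M[C]_1).
    by split=> [a x y|x y]; rewrite ?scaler0 ?addr0 // lie0x.
  exists 0%N, (fun=> 0); split=> //.
  rewrite casimirE; last by case: hom0.
  by rewrite big1 ?mxtrace0 ?mul0r // => i _; rewrite mul0mx.
have [lin_r lie_r] := hom_r; have [lin_adm lie_adm] := adm_hom basis_e.
pose r' x := tensmx (r x) 1%:M + tensmx 1%:M (adm e x).
have lin_r' : linear r'.
  move=> a x y; rewrite /r' lin_r lin_adm (linear_tensl _ a) (linear_tensr _ a).
  by rewrite scalerDr addrACA.
have hom_r' : lie_hom r'.
  split=> // x y; rewrite /r' lieDl !lieDr lie_tensl lie_tensr lie_tenslr.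
  by rewrite [lie (tensmx 1%:M _) _]lieC lie_tenslr oppr0 addr0 add0r lie_r lie_adm.
exists (D.+1 * n.+1).-1, r'; split=> //.
rewrite -[RHS]/(k.+1%:R * (D.+1 * n.+1)%:R).
have -> : cas r' = \sum_(i < n.+1) r' e`_i *m r' (dual_basis e i) by rewrite casimirE.
have E (i : 'I_n.+1) : \tr (r' e`_i *m r' (dual_basis e i)) =
    \tr (r e`_i *m r (dual_basis e i)) * n.+1%:R + D.+1%:R * killing e e`_i (dual_basis e i).
  rewrite /r' mulmxDl !mulmxDr !tensmx_mul !mxtraceD !mul1mx !mulmx1.
  by rewrite !mxtrace_tens !mxtrace_adm !mxtrace1 !mulr0 addr0 add0r.
rewrite linear_sum (eq_bigr _ (fun i _ => E i)) big_split -mulr_suml /=.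
rewrite -linear_sum -casimirE // -[X in X * _]/(\tr (cas r)) tr_r -mulr_sumr.
rewrite (eq_bigr (fun=> 1)) => [|i _]; last by rewrite killingC killing_dual // eqxx.
rewrite sumr_const card_ord natrM -[k.+1]addn1 natrD; ring.
Qed.

End CasimirPowers.

Section Words.
Variables (F : fieldType) (s : finLieType F) (d : nat) (e : d.-tuple s).

Definition word_act D (r : s -> 'M[F]_D) (w : seq 'I_d) : 'M[F]_D :=
  foldr (fun (i : 'I_d) X => r e`_i *m X) 1%:M w.

Lemma word_act_cat D (r : s -> 'M[F]_D) w w' :
  word_act r (w ++ w') = word_act r w *m word_act r w'.
Proof. by elim: w => [|i w IHw] /=; rewrite ?mul1mx // IHw mulmxA. Qed.

(** Such a list stands for an element of the enveloping algebra. The algebra itself is not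
    constructed: its identities are tested on finite-dimensional representations. *)
Definition ncpoly := seq (F * seq 'I_d).

Definition ncpoly_act D (r : s -> 'M[F]_D) (u : ncpoly) : 'M[F]_D :=
  \sum_(p <- u) p.1 *: word_act r p.2.

Definition ncpoly_scale (a : F) (u : ncpoly) : ncpoly := [seq (a * p.1, p.2) | p <- u].

Definition ncpoly_mulr (u : ncpoly) (i : 'I_d) : ncpoly :=
  [seq (p.1, rcons p.2 i) | p <- u].

Lemma ncpoly_act_cat D (r : s -> 'M[F]_D) u v :
  ncpoly_act r (u ++ v) = ncpoly_act r u + ncpoly_act r v.
Proof. exact: big_cat. Qed.

Lemma ncpoly_act_scale D (r : s -> 'M[F]_D) a u :
  ncpoly_act r (ncpoly_scale a u) = a *: ncpoly_act r u.
Proof.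
by rewrite /ncpoly_act big_map scaler_sumr; apply: eq_bigr => p _; rewrite scalerA.
Qed.

Lemma ncpoly_act_mulr D (r : s -> 'M[F]_D) u i :
  ncpoly_act r (ncpoly_mulr u i) = ncpoly_act r u *m r e`_i.
Proof.
rewrite /ncpoly_act big_map mulmx_suml; apply: eq_bigr => p _.
by rewrite -cats1 word_act_cat /= mulmx1 scalemxAl.
Qed.

(* A polynomial of degree at most L is a row vector indexed by words. *)
Definition word_dim L := #|{: L.-bseq 'I_d}|.

Definition word L (k : 'I_(word_dim L)) : seq 'I_d :=
  (enum_val k : L.-bseq 'I_d).

Definition row_act L D (r : s -> 'M[F]_D) (x : 'rV[F]_(word_dim L)) : 'M[F]_D :=
  \sum_k x 0 k *: word_act r (word k).

Definition word_row L (w : seq 'I_d) : 'rV[F]_(word_dim L) :=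
  \row_k (word k == w)%:R.

Lemma linear_row_act L D (r : s -> 'M[F]_D) : linear (@row_act L D r).
Proof.
move=> a x y; rewrite /row_act scaler_sumr -big_split; apply: eq_bigr => k _ /=.
by rewrite !mxE scalerDl scalerA.
Qed.

Lemma word_inj L : injective (@word L).
Proof. by move=> k l /val_inj /enum_val_inj. Qed.

Lemma word_size L (k : 'I_(word_dim L)) : (size (word k) <= L)%N.
Proof. exact: size_bseq. Qed.

Lemma word_surj L w : (size w <= L)%N -> exists k : 'I_(word_dim L), word k = w.
Proof.
move=> wL; exists (enum_rank (Bseq wL)); by rewrite /word enum_rankK.
Qed.

Lemma word_row_delta L (k : 'I_(word_dim L)) : word_row L (word k) = delta_mx 0 k.
Proof. by apply/rowP => l; rewrite !mxE (inj_eq (@word_inj L)). Qed.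

Lemma row_act_word L D (r : s -> 'M[F]_D) w : (size w <= L)%N ->
  row_act r (word_row L w) = word_act r w.
Proof.
move=> /word_surj[k <-]; rewrite word_row_delta /row_act (bigD1 k) //= mxE !eqxx.
by rewrite scale1r big1 ?addr0 // => l lk; rewrite mxE eqxx (negbTE lk) scale0r.
Qed.

Lemma row_act_ncpoly L D (r : s -> 'M[F]_D) (x : 'rV[F]_(word_dim L)) :
  row_act r x = ncpoly_act r [seq (x 0 k, word k) | k : 'I_(word_dim L)].
Proof. by rewrite /ncpoly_act big_image. Qed.

Lemma ncpoly_act_row L (u : ncpoly) : all (fun p => size p.2 <= L)%N u ->
  exists x : 'rV[F]_(word_dim L), forall D (r : s -> 'M[F]_D),
    ncpoly_act r u = row_act r x.
Proof.
elim: u => [_|[a w] u IHu /= /andP[wL /IHu[x xE]]].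
  by exists 0 => D r; rewrite (lin0 (linear_row_act r)) /ncpoly_act big_nil.
exists (a *: word_row L w + x) => D r.
by rewrite linear_row_act /ncpoly_act big_cons -/(ncpoly_act _ _) xE row_act_word.
Qed.

End Words.

(** * Invertibility of the Casimir element minus a scalar *)

Section CasimirUnit.
Variables (C : numClosedFieldType) (s : finLieType C) (n : nat) (e : n.+1.-tuple s).
Hypothesis basis_e : basis_of fullv e.
Hypothesis nondeg : forall x, (forall y, killing e x y = 0) -> x = 0.
Hypothesis archi : forall x : C, exists k : nat, ~~ (k%:R <= x).
Local Notation cas := (quad_op (casimir_pairs e) 0).

(** All eigenvalues would be roots of [q], of absolute value at most [B], whereas representations
    exist with any natural number [k] as mean eigenvalue. *)
Lemma casimir_not_algebraic (q : {poly C}) :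
  (forall D (r : s -> 'M[C]_D.+1), lie_hom r -> horner_mx (cas r) q = 0) -> q = 0.
Proof.
move=> casq; apply: contrapT => /eqP q0.
have [rs qE] := closed_field_poly_normal q.
pose B := \sum_(z <- rs) `|z|.
have root_le z : root q z -> `|z| <= B.
  rewrite qE rootZ ?lead_coef_eq0 // root_prod_XsubC => zrs.
  rewrite /B (big_rem z) //= lerDl; apply: sumr_ge0 => w _; exact: normr_ge0.
have [k kB] := archi B.
have [D [r [hom_r tr_r]]] := casimir_trace_unbounded basis_e nondeg k.
have [zs [_ tr_zs]] := trace_horner (cas r).
have /allP rootz := (tr_zs q).2 (casq _ _ hom_r).
have := (tr_zs 'X).1; rewrite horner_mx_X tr_r => trX.
have := (tr_zs 1).1; rewrite rmorph1 mxtrace1 => tr1.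
case/negP: kB; rewrite -(ler_pM2r (ltr0Sn C D)).
rewrite -[k%:R * _]ger0_norm ?mulr_ge0 ?ler0n // trX; apply: le_trans (ler_norm_sum _ _ _) _.
rewrite tr1 mulr_sumr big_seq [X in _ <= X]big_seq; apply: ler_sum => z zzs.
by rewrite !hornerE; apply: root_le; apply: rootz.
Qed.

(* More such [c] than words of length at most [N] would give a linear relation
   between the inverses [v], hence a polynomial relation for the Casimir element. *)
Lemma casimir_unit_finite N : exists l : seq C, forall c,
  (exists2 v : ncpoly C n.+1, all (fun p => size p.2 <= N)%N v &
     forall D (r : s -> 'M[C]_D.+1), lie_hom r ->
       (cas r - c%:M) *m ncpoly_act e r v = 1%:M) -> c \in l.
Proof.
pose bad (c : C) :=
  exists2 v : ncpoly C n.+1, all (fun p => size p.2 <= N)%N v &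
     forall D (r : s -> 'M[C]_D.+1), lie_hom r ->
       (cas r - c%:M) *m ncpoly_act e r v = 1%:M.
pose K := @word_dim n.+1 N.
have bound (l : seq C) : uniq l -> (forall c, c \in l -> bad c) -> (size l <= K)%N.
  move=> uniq_l badl; rewrite leqNgt; apply/negP => Kl.
  have ex (i : 'I_(size l)) : exists x : 'rV[C]_K, forall D (r : s -> 'M[C]_D.+1),
      lie_hom r -> (cas r - (l`_i)%:M) *m row_act e r x = 1%:M.
    have [|v vN vE] := badl l`_i; first exact: mem_nth.
    have [x xE] := ncpoly_act_row e vN; exists x => D r hom_r.
    by rewrite -xE vE.
  have [x xP] := choice ex.
  pose M := \matrix_i x i.
  have : kermx M != 0.
    rewrite kermx_eq0 /row_free neq_ltn (leq_ltn_trans _ Kl) //; exact: rank_leq_col.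
  case/rowV0Pn => u /sub_kermxP uM u0.
  pose P := fun i : 'I_(size l) => \prod_(j < size l | j != i) ('X - (l`_j)%:P).
  pose q := \sum_i u 0 i *: P i.
  have PE (i : 'I_(size l)) : ('X - (l`_i)%:P) * P i = \prod_(j < size l) ('X - (l`_j)%:P).
    by rewrite [RHS](bigD1 i).
  (* A linear relation [u] between the inverses of the [cas - l_i], multiplied by the product of all
     [cas - l_j], says that [q] annihilates the Casimir element. *)
  have q0 : q = 0.
    apply: casimir_not_algebraic => D r hom_r.
    pose a := cas r.
    have Pa (i : 'I_(size l)) : horner_mx a (P i) =
        horner_mx a (\prod_(j < size l) ('X - (l`_j)%:P)) *m row_act e r (x i).
      rewrite -(PE i) mulrC horner_mx_mul -mulmxA rmorphB /= horner_mx_X horner_mx_C.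
      by rewrite xP // mulmx1.
    rewrite rmorph_sum /=.
    rewrite (eq_bigr (fun i => horner_mx a (\prod_(j < size l) ('X - (l`_j)%:P))
        *m (u 0 i *: row_act e r (x i)))) => [|i _].
      rewrite -mulmx_sumr [X in _ *m X](_ : _ = 0) ?mulmx0 //.
      transitivity (row_act e r (u *m M)); last by rewrite uM (lin0 (linear_row_act e r)).
      rewrite mulmx_sum_row (lin_sum (linear_row_act e r)); apply: eq_bigr => i _.
      by rewrite (linZ (linear_row_act e r)) rowK.
    by rewrite horner_mxZ Pa scalemxAr.
  have /rV0Pn[i ui] := u0.
  have /(congr1 (horner^~ l`_i)) := q0; rewrite horner0 horner_sum (bigD1 i) //= big1.
    move/eqP; rewrite addr0 hornerZ mulf_eq0 (negbTE ui) /= horner_prod.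
    case/prodf_eq0=> j ji; rewrite hornerXsubC subr_eq0 nth_uniq // => /eqP ij.
    by case/eqP: ji; apply: val_inj.
  move=> j ji; rewrite hornerZ horner_prod (bigD1 i) 1?eq_sym //= hornerXsubC subrr.
  by rewrite mul0r mulr0.
pose good m := `[< exists l : seq C, [/\ uniq l, forall c, c \in l -> bad c & size l = m] >].
have exm : exists m, good m by exists 0%N; apply/asboolP; exists [::].
have ubm m : good m -> (m <= K)%N.
  by move=> /asboolP[l [ul badl <-]]; apply: bound.
case: (ex_maxnP exm ubm) => m /asboolP[l [ul badl <-]] maxl.
exists l => c badc; apply: contrapT => /negP cl.
have : good (size l).+1.
  apply/asboolP; exists (c :: l); split=> //=; first by rewrite cl.
  by move=> c'; rewrite inE => /orP[/eqP->|/badl].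
by move/maxl; rewrite ltnn.
Qed.

End CasimirUnit.

(** * Growth, uncountability and subspaces defined by predicates *)

Lemma exp2_beats_pow d a : exists k, ((a * k + 1) ^ d < 2 ^ k)%N.
Proof.
(* For [k = 2 ^ u] the claim reduces to [(a + u) * d < 2 ^ u], and [2 ^ u] is at least [v.+1]
   cubed. *)
pose v := (a + d + 4)%N; pose u := (3 * v)%N; exists (2 ^ u)%N.
have le1 : (a * 2 ^ u + 1 <= 2 ^ (a + u))%N.
  rewrite expnD; apply: (@leq_trans (a.+1 * 2 ^ u)).
    by rewrite mulSn addnC leq_add2r expn_gt0.
  by rewrite leq_mul2r ltn_expl // orbT.
apply: (@leq_ltn_trans (2 ^ ((a + u) * d))); first by rewrite expnM; case: (d) => [|d'] //; rewrite leq_exp2r.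
rewrite ltn_exp2l //.
have v2 : (v.+1 <= 2 ^ v)%N by apply: ltn_expl.
apply: (@leq_trans (v.+1 * v.+1 * v.+1)); last first.
  have -> : u = (v + v + v)%N by rewrite /u; lia.
  by rewrite (expnD _ (v + v)) (expnD _ v v); apply: leq_mul => //; apply: leq_mul.
rewrite /u /v; nia.
Qed.

(* Otherwise [r] would double every [2 * M] steps. *)
Lemma subexponential_step d M : exists K, forall r : nat -> nat,
  {homo r : i j / (i <= j)%N} -> (0 < r 0)%N -> (forall j, j <= K -> r j <= j.+1 ^ d)%N ->
  exists2 j, (j + 2 <= K)%N & (M * (r (j + 2) - r j) <= r (j + 2))%N.
Proof.
have [k kP] := exp2_beats_pow d (2 * M).
(* There is room for [k] doublings of [2 * M] steps each, and for a last window of length 2. *)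
exists (2 * M * k + 2)%N => r r_mono r0 rK.
apply: contrapT => no.
have step j : (j + 2 <= 2 * M * k + 2)%N -> (r (j + 2) < M * (r (j + 2) - r j))%N.
  by move=> jK; rewrite ltnNge; apply/negP => le; apply: no; exists j.
have block i t : (i <= M)%N -> (2 * M * t + 2 * i <= 2 * M * k)%N ->
    (i * r (2 * M * t) <= M * (r (2 * M * t + 2 * i) - r (2 * M * t)))%N.
  elim: i => [|i IHi] // iM itk; rewrite mulSn.
  have {}IHi := IHi (ltnW iM).
  have := step (2 * M * t + 2 * i)%N; rewrite -addnA -mulnSr.
  have mono1 : (r (2 * M * t) <= r (2 * M * t + 2 * i))%N by apply: r_mono; rewrite leq_addr.
  have mono2 : (r (2 * M * t + 2 * i) <= r (2 * M * t + 2 * i.+1))%N.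
    by apply: r_mono; rewrite leq_add2l leq_mul2l /=.
  nia.
have double t : (t <= k)%N -> (2 ^ t <= r (2 * M * t))%N.
  elim: t => [|t IHt] tk; first by rewrite muln0.
  have := block M t (leqnn _); rewrite -mulnSr leq_mul2l tk orbT => /(_ isT).
  have mono1 : (r (2 * M * t) <= r (2 * M * t.+1))%N by apply: r_mono; rewrite leq_mul2l leqnSn orbT.
  have [M0|M0] := posnP M.
    by have := step 0%N; rewrite M0 !mul0n => /(_ isT).
  rewrite leq_mul2l eqn0Ngt M0 /= => le; have := IHt (ltnW tk); rewrite expnS; lia.
have := double k (leqnn _); rewrite leqNgt => /negP; apply.
apply: leq_ltn_trans kP; rewrite addn1; apply: rK; exact: leq_addr.
Qed.

Lemma real_uncountable (R : realType) (f : nat -> R) : exists x, forall k, f k <> x.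
Proof.
(* Nested intervals: the outer third on the side away from [f k] is kept. *)
pose step k (ab : R * R) := let: (a, b) := ab in
  if f k <= (a + b) / 2%:R then (b - (b - a) / 3%:R, b) else (a, a + (b - a) / 3%:R).
pose I := fix I k := if k is k'.+1 then step k' (I k') else (0, 1).
have I_lt k : (I k).1 < (I k).2.
  elim: k => [|k IHk] /=; first exact: ltr01.
  by rewrite /step; move: IHk; case: (I k) => a b /= ab; case: ifP => _ /=; lra.
have I_S k : (I k).1 <= (I k.+1).1 /\ (I k.+1).2 <= (I k).2.
  have := I_lt k; rewrite /= /step; case: (I k) => a b /= ab; case: ifP => _ /=; lra.
have I_f k : f k < (I k.+1).1 \/ (I k.+1).2 < f k.
  have := I_lt k; rewrite /= /step; case: (I k) => a b /= ab.
  case: (leP (f k) ((a + b) / 2%:R)) => h /=; [left | right]; lra.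
have I_mono k l : (k <= l)%N -> (I k).1 <= (I l).1 /\ (I l).2 <= (I k).2.
  move=> /subnK <-; elim: (l - k)%N => [|m [IH1 IH2]] //; have [h1 h2] := I_S (m + k)%N.
  by split; [apply: le_trans h1 | apply: le_trans IH2].
have I_le k l : (I k).1 <= (I l).2.
  have [k1 k2] := I_mono k _ (leq_maxl k l); have [l1 l2] := I_mono l _ (leq_maxr k l).
  by apply: le_trans k1 (le_trans (ltW (I_lt _)) l2).
pose E := [set (I k).1 | k in setT]%classic.
have supE : has_sup E.
  split; first by exists (I 0%N).1, 0%N.
  by exists 1 => _ [k _ <-]; apply: (I_le k 0%N).
exists (sup E) => k fk.
have le1 : (I k.+1).1 <= sup E by apply: (ub_le_sup supE.2); exists k.+1.
have le2 : sup E <= (I k.+1).2 by apply: (ge_sup supE.1) => _ [l _ <-].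
by case: (I_f k); rewrite fk; [rewrite ltNge le1 | rewrite ltNge le2].
Qed.

Lemma complex_uncountable (R : realType) (T : countType) (l : T -> seq R[i]) :
  exists x, forall t, x \notin l t.
Proof.
pose f k : R := if unpickle k is Some (t, j) then complex.Re (nth 0 (l t) j) else 0.
have [x xP] := real_uncountable f.
exists (x%:C)%C => t; apply/negP => xt; apply: (xP (pickle (t, index (x%:C)%C (l t)))).
by rewrite /f pickleK nth_index.
Qed.

Lemma complex_archi (R : realType) (x : R[i]) : exists k : nat, ~~ (k%:R <= x).
Proof.
case: x => a b; exists (Num.bound `|a|); rewrite -(rmorph_nat (real_complex R)) lecE /=.
rewrite negb_and -ltNge; apply/orP; right.
by apply: le_lt_trans (ler_norm a) _; apply: archi_boundP.
Qed.

(** A matrix of maximal rank whose row space satisfies [P] captures all of [P]. This lets a subspace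
    defined by quantifying over all representations be handled as the kernel of a matrix. *)
Lemma linear_pred_space (F : fieldType) m (P : 'rV[F]_m -> Prop) :
  P 0 -> (forall a x y, P x -> P y -> P (a *: x + y)) ->
  exists Z : 'M[F]_m, forall x, P x <-> x *m Z = 0.
Proof.
move=> P0 Plin.
pose sub (Y : 'M[F]_m) := forall x : 'rV_m, (x <= Y)%MS -> P x.
have exr : exists k, `[< exists2 Y, sub Y & \rank Y = k >].
  exists 0%N; apply/asboolP; exists 0; last exact: mxrank0.
  by move=> x; rewrite submx0 => /eqP->.
have ubr k : `[< exists2 Y, sub Y & \rank Y = k >] -> (k <= m)%N.
  by move=> /asboolP[Y _ <-]; apply: rank_leq_col.
case: (ex_maxnP exr ubr) => k /asboolP[Y subY <-] maxY.
exists (cokermx Y) => x; split=> [Px|/eqP xY]; last by apply: subY; rewrite submxE.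
apply/eqP; rewrite -submxE.
have subYx : sub (Y + x)%MS.
  move=> y /sub_addsmxP[[u v] /= ->]; rewrite [v]mx11_scalar mul_scalar_mx addrC.
  by apply: Plin => //; apply: subY; apply: submxMl.
have le_rank : (\rank (Y + x)%MS <= \rank Y)%N by apply: maxY; apply/asboolP; exists (Y + x)%MS.
have [_] := mxrank_leqif_sup (addsmxSl Y x).
rewrite eqn_leq le_rank mxrankS ?addsmxSl //= => /esym.
by apply: submx_trans; apply: addsmxSr.
Qed.

Lemma eq_linear_delta (F : fieldType) m (V : lmodType F) (f h : 'rV[F]_m -> V) :
  linear f -> linear h -> (forall k, f (delta_mx 0 k) = h (delta_mx 0 k)) -> f =1 h.
Proof.
move=> lin_f lin_h fh y; rewrite (row_sum_delta y) (lin_sum lin_f) (lin_sum lin_h).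
by apply: eq_bigr => k _; rewrite (linZ lin_f) (linZ lin_h) fh.
Qed.

(** * Right multiplication on words of bounded length *)

Section WordMatrices.
Variables (F : fieldType) (s : finLieType F) (d : nat) (e : d.-tuple s) (L : nat).
Hypothesis basis_e : basis_of fullv e.
Local Notation m := (word_dim d L).
Local Notation row_of := (word_row F L).

(** Words of the maximal length [L] are sent to 0, so this is true multiplication only after a
    truncation to smaller length. *)
Definition rcons_mx (i : 'I_d) : 'M[F]_m :=
  \matrix_(k, l) (word l == rcons (word k) i)%:R.

Definition mulr_mx (x : s) : 'M[F]_m := \sum_i coord e i x *: rcons_mx i.

Definition trunc_mx j : 'M[F]_m := diag_mx (\row_k (size (word k) <= j)%:R).

Lemma eq_word_rows p (A B : 'M[F]_(m, p)) :
  (forall w : seq 'I_d, (size w <= L)%N -> row_of w *m A = row_of w *m B) -> A = B.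
Proof.
move=> AB; apply/row_matrixP => k; rewrite !rowE -word_row_delta.
exact: AB (word_size k).
Qed.

Lemma word_row_rcons (w : seq 'I_d) i : (size w <= L)%N ->
  row_of w *m rcons_mx i = row_of (rcons w i).
Proof.
move=> /word_surj[k <-]; rewrite word_row_delta -rowE.
by apply/rowP => l; rewrite !mxE.
Qed.

Lemma word_row_trunc (w : seq 'I_d) j :
  row_of w *m trunc_mx j = (size w <= j)%:R *: row_of w.
Proof.
apply/rowP => k; rewrite /trunc_mx mul_mx_diag !mxE.
by case: eqP => [->|_]; rewrite ?mul1r ?mulr1 // mul0r mulr0.
Qed.

Lemma trunc_mxM i j : (i <= j)%N -> trunc_mx i *m trunc_mx j = trunc_mx i.
Proof.
move=> ij; apply: eq_word_rows => w _; rewrite mulmxA word_row_trunc -scalemxAl.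
rewrite word_row_trunc scalerA; case: (leqP (size w) i) => [wi|]; last by rewrite mul0r.
by rewrite (leq_trans wi ij) mulr1.
Qed.

Lemma linear_mulr_mx : linear mulr_mx.
Proof.
move=> a x y; rewrite /mulr_mx scaler_sumr -big_split; apply: eq_bigr => i _ /=.
by rewrite linearP scalerDl scalerA.
Qed.

Lemma trunc_rcons j i : trunc_mx j *m rcons_mx i *m trunc_mx j.+1 = trunc_mx j *m rcons_mx i.
Proof.
apply: eq_word_rows => w wL; rewrite !mulmxA word_row_trunc -!scalemxAl.
case: (leqP (size w) j) => [wj|]; last by rewrite !scale0r.
by rewrite !scale1r word_row_rcons // word_row_trunc size_rcons ltnS wj scale1r.
Qed.

Lemma trunc_mulr j x : trunc_mx j *m mulr_mx x *m trunc_mx j.+1 = trunc_mx j *m mulr_mx x.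
Proof.
rewrite /mulr_mx mulmx_sumr mulmx_suml; apply: eq_bigr => i _.
by rewrite -scalemxAr -scalemxAl trunc_rcons.
Qed.

Lemma row_act_rcons D (r : s -> 'M[F]_D) j i (y : 'rV_m) : (j < L)%N ->
  row_act e r (y *m trunc_mx j *m rcons_mx i) = row_act e r (y *m trunc_mx j) *m r e`_i.
Proof.
move=> jL; have lin_act := linear_row_act e r (L := L).
apply: (eq_linear_delta (f := fun y => row_act e r (y *m trunc_mx j *m rcons_mx i))
  (h := fun y => row_act e r (y *m trunc_mx j) *m r e`_i)) => [a u v|a u v|k].
- by rewrite !mulmxDl -!scalemxAl lin_act.
- by rewrite mulmxDl -scalemxAl lin_act mulmxDl -scalemxAl.
rewrite -word_row_delta word_row_trunc -scalemxAl !(linZ lin_act) -scalemxAl.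
case: (leqP (size (word k)) j) => [kj|]; last by rewrite !scale0r.
rewrite word_row_rcons ?word_size // !row_act_word ?word_size //.
  by rewrite -cats1 word_act_cat /= mulmx1.
by rewrite size_rcons (leq_ltn_trans kj).
Qed.

Lemma row_act_mulr D (r : s -> 'M[F]_D) j x (y : 'rV_m) : linear r -> (j < L)%N ->
  row_act e r (y *m trunc_mx j *m mulr_mx x) = row_act e r (y *m trunc_mx j) *m r x.
Proof.
move=> lin_r jL; have lin_act := linear_row_act e r (L := L).
rewrite [x in RHS](coord_basis basis_e (memvf x)) (lin_sum lin_r) !mulmx_sumr.
rewrite (lin_sum lin_act); apply: eq_bigr => i _.
by rewrite -scalemxAr (linZ lin_act) row_act_rcons // (linZ lin_r) -scalemxAr.
Qed.

End WordMatrices.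

(** The ordered monomial of Poincare, Birkhoff and Witt with exponents [a]. *)
Definition canonical_word d j (a : {ffun 'I_d -> 'I_j.+1}) : seq 'I_d :=
  flatten [seq nseq (a i) i | i <- enum 'I_d].

Lemma perm_canonical_word d j (w : seq 'I_d) : (size w <= j)%N ->
  exists a : {ffun 'I_d -> 'I_j.+1}, perm_eq w (canonical_word a).
Proof.
move=> wj; exists [ffun i => inord (count_mem i w)]; rewrite /perm_eq; apply/allP => i _ /=.
rewrite /canonical_word count_flatten -map_comp sumnE big_map big_enum /=.
rewrite (bigD1 i) //= count_nseq /= eqxx mul1n ffunE inordK; last first.
  by rewrite ltnS (leq_trans (count_size _ _)).
by rewrite big1 ?addn0 // => k ki; rewrite count_nseq /= (negbTE ki).
Qed.

Section Truncation.
Variables (F : fieldType) (s : finLieType F) (d : nat) (e : d.-tuple s).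
Hypothesis basis_e : basis_of fullv e.
Variables (pq : seq (s * s)) (z : s) (c : F).
Local Notation zop := (quad_op pq z).
Hypothesis central : forall m (r : s -> 'M[F]_m), lie_hom r ->
  forall x, r x *m zop r = zop r *m r x.
Hypothesis not_unit : ~ exists v : ncpoly F d, forall D (r : s -> 'M[F]_D),
  lie_hom r -> (zop r - c%:M) *m ncpoly_act e r v = 1%:M.

Section FixedLength.
Variable L : nat.
Local Notation m := (word_dim d L).
Local Notation row_of := (word_row F L).

(* The ideal generated by [zop - c], tested in all finite-dimensional
   representations. *)
Definition in_ideal (y : 'rV[F]_m) := exists v : ncpoly F d,
  forall D (r : s -> 'M[F]_D), lie_hom r ->
    row_act e r y = (zop r - c%:M) *m ncpoly_act e r v.

Variable Z : 'M[F]_m.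
Hypothesis memZ : forall y, in_ideal y <-> y *m Z = 0.

Let X := mulr_mx e L.
Let T := trunc_mx F d L.

Lemma in_ideal_rows p (Y : 'M[F]_(p, m)) :
  (forall k, in_ideal (row k Y)) -> Y *m Z = 0.
Proof.
by move=> YI; apply/row_matrixP => k; rewrite row_mul row0; apply/memZ.
Qed.

Lemma ideal_mulr p (Y : 'M[F]_(p, m)) j x : (j < L)%N ->
  Y *m T j = Y -> Y *m Z = 0 -> Y *m X x *m Z = 0.
Proof.
move=> jL YT YZ; apply: in_ideal_rows => k.
have /memZ[v vE] : row k Y *m Z = 0 by rewrite -row_mul YZ row0.
exists (flatten [seq ncpoly_scale (coord e i x) (ncpoly_mulr v i) | i : 'I_d]) => D r hom_r.
have [lin_r _] := hom_r; rewrite row_mul -YT row_mul row_act_mulr // -row_mul YT vE //.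
rewrite -mulmxA; congr (_ *m _).
rewrite [x in LHS](coord_basis basis_e (memvf x)) (lin_sum lin_r) mulmx_sumr.
rewrite -[RHS]/(\sum_(p <- _) _) big_flatten big_image /=; apply: eq_bigr => i _.
rewrite -[RHS]/(ncpoly_act e r _) ncpoly_act_scale ncpoly_act_mulr.
by rewrite (linZ lin_r) scalemxAr.
Qed.

Section Truncated.
Variable j : nat.
Hypothesis jL : (j + 2 <= L)%N.
Variables (nQ : nat) (Q : 'M[F]_(m, nQ)) (QR : 'M[F]_(nQ, m)).
Hypothesis freeQR : row_free QR.
Hypothesis defQR : T j.+2 *m Z = Q *m QR.

Let YZQ p (Y : 'M[F]_(p, m)) :
  Y *m T j.+2 = Y -> Y *m Z = Y *m Q *m QR.
Proof. by move=> YT; rewrite -mulmxA -defQR mulmxA YT. Qed.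

Let kerQ p (Y : 'M[F]_(p, m)) : Y *m T j.+2 = Y -> Y *m Z = 0 -> Y *m Q = 0.
Proof.
move=> YT YZ; apply: (row_free_inj freeQR).
by rewrite /= -YZQ // YZ mul0mx.
Qed.

Let kerZ p (Y : 'M[F]_(p, m)) : Y *m T j.+2 = Y -> Y *m Q = 0 -> Y *m Z = 0.
Proof. by move=> YT YQ; rewrite YZQ // YQ mul0mx. Qed.

(** Right multiplication by [x] from the image of words of length at most [j.+1] to that of words of
    length at most [j.+2], modulo the ideal; [pinvmx] extends it to the whole space in an arbitrary
    way. *)
Definition truncated_action x :=
  pinvmx (T j.+1 *m Q) *m (T j.+1 *m X x *m Q).
Local Notation al := truncated_action.

Let TT i k : (i <= k)%N -> T i *m T k = T i. Proof. exact: trunc_mxM. Qed.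

Let TX i x : T i *m X x *m T i.+1 = T i *m X x. Proof. exact: trunc_mulr. Qed.

(** The action is well defined: the ideal is stable under right multiplication, so linear relations
    between words modulo it persist. *)
Lemma truncated_actionE x : T j.+1 *m Q *m al x = T j.+1 *m X x *m Q.
Proof.
rewrite /al mulmxA; set M := T j.+1 *m Q.
pose K := 1%:M - M *m pinvmx M.
have KM : K *m M = 0 by rewrite mulmxBl mul1mx mulmxKpV // subrr.
have KTZ : K *m T j.+1 *m Z = 0.
  by apply: kerZ; rewrite -mulmxA ?TT // KM.
have : K *m (T j.+1 *m X x *m Q) = 0.
  rewrite !mulmxA; apply: kerQ; first by rewrite -!mulmxA (mulmxA (T _) (X x)) TX.
  apply: (ideal_mulr (j := j.+1)) => //; first by rewrite -addn2.
  by rewrite -mulmxA TT.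
by move/eqP; rewrite mulmxBl mul1mx subr_eq0 => /eqP <-.
Qed.

Lemma linear_truncated_action : linear al.
Proof.
move=> a x y; rewrite /al /X (linear_mulr_mx e L a) mulmxDr mulmxDl mulmxDr.
by rewrite -!scalemxAr -!scalemxAl -scalemxAr.
Qed.

Let act1 x : T j *m Q *m al x = T j *m X x *m Q.
Proof.
by rewrite -[T j in LHS](TT (leqnSn j)) -!mulmxA (mulmxA (T j.+1)) truncated_actionE
  !mulmxA TT.
Qed.

Let act2 x y : T j *m Q *m (al x *m al y) = T j *m (X x *m X y) *m Q.
Proof.
rewrite mulmxA act1 -(TX j x) -mulmxA (mulmxA (T j) (X x)).
by rewrite -(mulmxA _ (T j.+1)) (mulmxA (T j.+1) Q) truncated_actionE !mulmxA TX.
Qed.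

(** A relation of degree 2 holds exactly on the image of words of length at most [j], so its defect
    has rank at most the codimension of that image. *)
Let rel_zero (A : 'M[F]_nQ) (B : 'M[F]_m) :
  T j *m Q *m A = T j *m B *m Q -> T j *m B *m T j.+2 = T j *m B ->
  (forall k, in_ideal (row k (T j *m B))) ->
  (\rank A <= nQ - \rank (T j *m Z))%N.
Proof.
move=> AB BT BI; have : T j *m Q *m A = 0.
  by rewrite AB; apply: kerQ => //; apply: in_ideal_rows.
move/mulmx0_rank_max; have -> : \rank (T j *m Z) = \rank (T j *m Q).
  rewrite -(mxrankMfree _ freeQR) -mulmxA -defQR mulmxA.
  by rewrite TT // -addn2 leq_addr.
move=> le_n; rewrite leq_subRL //; apply: leq_trans le_n; exact: leq_addr.
Qed.

Let XXT x y : T j *m (X x *m X y) *m T j.+2 = T j *m (X x *m X y).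
Proof. by rewrite !mulmxA -(TX j x) -!mulmxA (mulmxA (T j.+1) (X y)) TX. Qed.

Let XT x : T j *m X x *m T j.+2 = T j *m X x.
Proof. by rewrite -(TX j x) -!mulmxA TT. Qed.

Let jL1 : (j.+1 < L)%N. Proof. by rewrite -addn2. Qed.

Let row_actX D (r : s -> 'M[F]_D) u x : linear r ->
  row_act e r (u *m T j *m X x) = row_act e r (u *m T j) *m r x.
Proof. by move=> lin_r; apply: row_act_mulr => //; apply: ltn_trans jL1. Qed.

Let row_actXX D (r : s -> 'M[F]_D) u x y : linear r ->
  row_act e r (u *m T j *m (X x *m X y)) = row_act e r (u *m T j) *m (r x *m r y).
Proof.
move=> lin_r; rewrite mulmxA -(mulmxA u) -(TX j x) [u *m _]mulmxA row_act_mulr //.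
by rewrite -(mulmxA u) TX (mulmxA u) row_actX // mulmxA.
Qed.

Lemma truncated_lie x y :
  (\rank (lie (al x) (al y) - al (lie x y))%R <= nQ - \rank (T j *m Z))%N.
Proof.
apply: (rel_zero (B := X x *m X y - X y *m X x - X (lie x y))).
- rewrite mx_lieE !mulmxBr !act2 act1.
  by rewrite !mulmxBl.
- by rewrite !mulmxBr !mulmxBl !XXT XT.
move=> k; exists [::] => D r [lin_r lie_r].
rewrite /ncpoly_act big_nil mulmx0 row_mul rowE !mulmxBr.
have lin_act := linear_row_act e r (L := L).
rewrite !(linB lin_act) !row_actXX // row_actX // lie_r mx_lieE.
by rewrite -!mulmxBr subrr mulmx0.
Qed.

Lemma truncated_quad :
  (\rank (zop al - c%:M)%R <= nQ - \rank (T j *m Z))%N.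
Proof.
apply: (rel_zero (B := zop X - c%:M)).
- rewrite /quad_op !mulmxBr !mulmxDr !mulmxBl !mulmxDl act1 !mulmx_sumr.
  congr (_ + _ - _); last by rewrite !mul_mx_scalar scalemxAl.
  by rewrite mulmx_suml; apply: eq_bigr => i _; rewrite act2.
- rewrite /quad_op !mulmxBr !mulmxDr !mulmxBl !mulmxDl XT mulmx_sumr mulmx_suml.
  congr (_ + _ - _); last by rewrite !mul_mx_scalar -scalemxAl TT // leqW.
  by apply: eq_bigr => i _; rewrite XXT.
move=> k; exists [seq ((row k (T j)) 0 l, word l) | l : 'I_m] => D r hom_r.
have [lin_r lie_r] := hom_r; rewrite -row_act_ncpoly row_mul rowE mulmxBr.
have lin_act := linear_row_act e r (L := L).
rewrite (linB lin_act) mul_mx_scalar (linZ lin_act) mulmxBl mul_scalar_mx; congr (_ - _).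
have comm_r x : r x *m zop r = zop r *m r x by apply: central.
(* The ideal is defined with [zop - c] on the left, the action multiplies on the right; centrality
   reconciles them. *)
have -> : zop r *m row_act e r (delta_mx 0 k *m T j) = row_act e r (delta_mx 0 k *m T j) *m zop r.
  rewrite /row_act mulmx_sumr mulmx_suml; apply: eq_bigr => l _.
  rewrite -scalemxAr -scalemxAl; congr (_ *: _).
  elim: (word l) => [|i w IHw] /=; first by rewrite mul1mx mulmx1.
  by rewrite (mulmxA (zop r)) -comm_r -(mulmxA (r _) (zop r)) IHw mulmxA.
rewrite {1}/quad_op mulmxDr mulmx_sumr (linD lin_act) (lin_sum lin_act) row_actX //.
rewrite /quad_op mulmxDr mulmx_sumr; congr (_ + _).
by apply: eq_bigr => i _; rewrite row_actXX.
Qed.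

End Truncated.

Let rank_T j := \rank (T j *m Z).

Lemma truncated_rank_mono : {homo rank_T : i j / (i <= j)%N}.
Proof.
move=> i j ij; rewrite /rank_T.
have <- : T i *m T j = T i by apply: trunc_mxM.
by rewrite -mulmxA mxrankM_maxr.
Qed.

(** Otherwise the empty word would lie in the ideal, so [zop - c] would have an inverse. *)
Lemma truncated_rank0 : (0 < rank_T 0)%N.
Proof.
rewrite lt0n mxrank_eq0; apply/eqP => T0; apply: not_unit.
have [|v vE] := (memZ (row_of [::])).2.
  have := word_row_trunc F L ([::] : seq 'I_d) 0; rewrite leqnn scale1r => <-.
  by rewrite -mulmxA T0 mulmx0.
by exists v => D r hom_r; rewrite -vE // row_act_word.
Qed.

Let ka w := row_of w *m Z.

Let ka_swap u i k v : (size (u ++ [:: i, k & v]) <= L)%N ->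
  ka (u ++ [:: i, k & v]) = ka (u ++ [:: k, i & v]) +
    \sum_l coord e l (lie e`_i e`_k) *: ka (u ++ l :: v).
Proof.
move=> szL; apply/subr0_eq; rewrite /ka.
rewrite (eq_bigr (fun l => (coord e l (lie e`_i e`_k) *: row_of (u ++ l :: v)) *m Z)) => [|l _];
  last by rewrite scalemxAl.
rewrite -mulmx_suml -mulmxDl -mulmxBl; apply/memZ; exists [::] => D r [lin_r lie_r].
rewrite /ncpoly_act big_nil mulmx0.
have lin_act := linear_row_act e r (L := L).
have szE : size (u ++ [:: i, k & v]) = (size u + size v).+2 by rewrite size_cat /= !addnS.
rewrite (linB lin_act) (linD lin_act) (lin_sum lin_act) !row_act_word //; last first.
  by rewrite size_cat /= !addnS -szE.
rewrite (eq_bigr (fun l => word_act e r u *m (coord e l (lie e`_i e`_k) *: r e`_l)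
    *m word_act e r v)) => [|l _]; last first.
  rewrite (linZ lin_act) row_act_word ?word_act_cat /= ?scalemxAl -?scalemxAr ?mulmxA //.
    by rewrite scalemxAl.
  by rewrite size_cat /= addnS (leq_trans _ szL) // szE.
rewrite -mulmx_suml -mulmx_sumr.
have -> : \sum_l coord e l (lie e`_i e`_k) *: r e`_l = r (lie e`_i e`_k).
  rewrite [X in r X](coord_basis basis_e (memvf (lie e`_i e`_k))) (lin_sum lin_r).
  by apply: eq_bigr => l _; rewrite (linZ lin_r).
rewrite lie_r mx_lieE !word_act_cat /= mulmxBr mulmxBl !mulmxA.
by rewrite [X in _ - X]addrC subrK subrr.
Qed.

(** Exchanging adjacent letters changes a word by shorter words modulo the ideal, so by induction on
    the length each word may be sorted modulo [S]. *)
Lemma straightening p (S : 'M[F]_(p, m)) j : (j <= L)%N ->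
  (forall a : {ffun 'I_d -> 'I_j.+1}, (ka (canonical_word a) <= S)%MS) ->
  forall w, (size w <= j)%N -> (ka w <= S)%MS.
Proof.
move=> jL canS w; have [N] := ubnP (size w); elim: N w => // N IHN w wN wj.
pose M := size w.
have small w' : (size w' < M)%N -> (ka w' <= S)%MS.
  move=> w'M; apply: IHN; first exact: leq_trans w'M _.
  exact: leq_trans (ltnW w'M) wj.
have swap u i k v : size (u ++ [:: i, k & v]) = M ->
    (ka (u ++ [:: i, k & v]) - ka (u ++ [:: k, i & v]) <= S)%MS.
  move=> szM; rewrite ka_swap ?szM ?(leq_trans wj) // addrAC subrr add0r.
  apply: summx_sub => l _; apply: scalemx_sub; apply: small.
  by rewrite -szM !size_cat /= !addnS.
have move_letter a u i b : size (u ++ a ++ i :: b) = M ->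
    (ka (u ++ i :: a ++ b) - ka (u ++ a ++ i :: b) <= S)%MS.
  elim: a u => [|k a IHa] u szM /=; first by rewrite subrr sub0mx.
  have -> : ka (u ++ [:: i, k & a ++ b]) - ka (u ++ k :: a ++ i :: b) =
      (ka (u ++ [:: i, k & a ++ b]) - ka (u ++ [:: k, i & a ++ b])) +
      (ka (rcons u k ++ i :: a ++ b) - ka (rcons u k ++ a ++ i :: b)).
    by rewrite !cat_rcons addrA subrK.
  apply: addmx_sub.
    by apply: swap; rewrite -szM !size_cat /= !size_cat /= !addnS.
  by apply: IHa; rewrite cat_rcons.
have perm u v v' : perm_eq v v' -> size (u ++ v) = M -> (ka (u ++ v) - ka (u ++ v') <= S)%MS.
  elim: v u v' => [|i v IHv] u v'.
    by move/perm_size/esym/size0nil => -> _; rewrite subrr sub0mx.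
  move=> pv szM; have iv : i \in v' by rewrite -(perm_mem pv) mem_head.
  move: pv; case/splitPr: iv => a b pv.
  have pv' : perm_eq v (a ++ b).
    by rewrite -(perm_cons i) (perm_trans pv) // perm_catC /= perm_cons perm_catC.
  have -> : ka (u ++ i :: v) - ka (u ++ a ++ i :: b) =
      (ka (rcons u i ++ v) - ka (rcons u i ++ a ++ b)) +
      (ka (u ++ i :: a ++ b) - ka (u ++ a ++ i :: b)).
    by rewrite !cat_rcons addrA subrK.
  apply: addmx_sub; first by apply: IHv => //; rewrite cat_rcons.
  by apply: move_letter; rewrite -szM !size_cat (perm_size pv) size_cat.
have [a wa] := perm_canonical_word wj.
rewrite -(subrK (ka (canonical_word a)) (ka w)); apply: addmx_sub => //.
exact: (perm [::]).
Qed.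

(** Ordered monomials with exponents at most [j] span, and there are [j.+1 ^ d] of them. Polynomial
    growth then yields a [j] at which the next two steps add relatively little. *)
Lemma truncated_rank_bound j : (j <= L)%N -> (rank_T j <= j.+1 ^ d)%N.
Proof.
move=> jL.
pose S := \matrix_(t < #|{ffun 'I_d -> 'I_j.+1}|) ka (canonical_word (enum_val t)).
have -> : (j.+1 ^ d = #|{ffun 'I_d -> 'I_j.+1}|)%N by rewrite card_ffun !card_ord.
apply: leq_trans (rank_leq_row S); apply: mxrankS; apply/row_subP => k.
rewrite row_mul rowE -word_row_delta word_row_trunc -scalemxAl.
case: (leqP (size (word k)) j) => [kj|]; last by rewrite scale0r sub0mx.
rewrite scale1r; apply: (straightening jL) kj => a.
by rewrite -(enum_rankK a) -(rowK (fun t => ka (canonical_word (enum_val t)))) row_sub.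
Qed.

End FixedLength.

Lemma truncated_approximation M : exists n (al : s -> 'M[F]_n),
  [/\ (0 < n)%N, linear al,
      forall x y, (\rank (lie (al x) (al y) - al (lie x y))%R * M <= n)%N
    & (\rank (zop al - c%:M)%R * M <= n)%N].
Proof.
have [L LP] := subexponential_step d M.
have [|a x y [u uE] [v vE]|Z memZ] := @linear_pred_space F _ (@in_ideal L).
- exists [::] => D r hom_r; rewrite (lin0 (linear_row_act e r (L := L))).
  by rewrite /ncpoly_act big_nil mulmx0.
- exists (ncpoly_scale a u ++ v) => D r hom_r.
  rewrite (linear_row_act e r a) uE // vE // ncpoly_act_cat ncpoly_act_scale.
  by rewrite mulmxDr scalemxAr.
have [j jL step] := LP _ (@truncated_rank_mono L Z) (truncated_rank0 memZ)
  (fun j => @truncated_rank_bound L Z memZ j).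
pose Y := trunc_mx F d L j.+2 *m Z.
have defY : Y = col_base Y *m row_base Y by rewrite mulmx_base.
have n0 : (0 < \rank Y)%N.
  apply: leq_trans (truncated_rank0 memZ) _; exact: truncated_rank_mono.
rewrite addn2 in step.
exists (\rank Y), (truncated_action j (col_base Y)); split=> //.
- exact: linear_truncated_action.
- move=> x y; apply: leq_trans step; rewrite mulnC leq_mul2l.
  by rewrite (truncated_lie memZ jL (row_base_free Y) defY) orbT.
apply: leq_trans step; rewrite mulnC leq_mul2l.
by rewrite (truncated_quad memZ jL (row_base_free Y) defY) orbT.
Qed.

End Truncation.

(** * Choice of the Casimir eigenvalue and conclusion *)

Lemma nonsolvable_not_stable (R : realType) (g : finLieType R[i]) :
  ~ lie_solvable g -> ~ rank_stable R g.
Proof.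
move=> /nonsolvable_killing_quotient[s [f [n [e [hom_f surj_f basis_e nondeg]]]]].
pose l : seq R[i] :=
  [seq coord e (p.2 : 'I_n.+1) (lie e`_(p.1.1 : 'I_n.+1) e`_(p.1.2 : 'I_n.+1))
    | p : ('I_n.+1 * 'I_n.+1) * 'I_n.+1] ++
  [seq invmx (gram e) p.1 p.2 | p : 'I_n.+1 * 'I_n.+1].
have [A [ev evl]] := countable_subring l.
have [ga gaE] : exists ga : 'I_n.+1 -> 'I_n.+1 -> 'I_n.+1 -> A,
    forall i j k, ev (ga i j k) = coord e k (lie e`_i e`_j).
  have ex (p : ('I_n.+1 * 'I_n.+1) * 'I_n.+1) :
      exists a, ev a = coord e p.2 (lie e`_(p.1.1) e`_(p.1.2)).
    by apply: evl; rewrite mem_cat; apply/orP; left; apply/fintype.imageP; exists p.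
  by have [h hE] := choice ex; exists (fun i j k => h ((i, j), k)) => i j k; rewrite hE.
have [gi giE] : exists gi : 'I_n.+1 -> 'I_n.+1 -> A,
    forall i j, ev (gi i j) = invmx (gram e) i j.
  have ex (p : 'I_n.+1 * 'I_n.+1) : exists a, ev a = invmx (gram e) p.1 p.2.
    by apply: evl; rewrite mem_cat; apply/orP; right; apply/fintype.imageP; exists p.
  by have [h hE] := choice ex; exists (fun i j => h (i, j)) => i j; rewrite hE.
pose roots (p : {poly A}) := sval (closed_field_poly_normal (map_poly ev p)).
have rootsP p : map_poly ev p = lead_coef (map_poly ev p) *: \prod_(z <- roots p) ('X - z%:P).
  exact: svalP (closed_field_poly_normal (map_poly ev p)).
have [units unitsP] := choice (casimir_unit_finite basis_e nondeg (@complex_archi R)).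
(* Two countable families are avoided: the roots of polynomials over [A], for rigidity, and for each
   [N] the scalars at which the Casimir element becomes invertible with an inverse of degree at most
   [N]. *)
have [c cP] := complex_uncountable (fun t : {poly A} + nat =>
  match t with inl p => roots p | inr N => units N end).
have transc (p : {poly A}) : root (map_poly ev p) c -> map_poly ev p = 0.
  move=> pc; apply/eqP; apply: contraT => p0; have := cP (inl p); rewrite -root_prod_XsubC.
  by rewrite -(rootZ _ _ (_ : lead_coef (map_poly ev p) != 0)) ?lead_coef_eq0 // -rootsP pc.
apply: (@not_rank_stable_of_approx R _ g s f (casimir_pairs e) 0 c hom_f surj_f).
- apply/eqP => c0; have := transc 'X; rewrite map_polyX c0 rootX eqxx => /(_ isT)/eqP.
  by rewrite polyX_eq0.
- by move=> m r hom_r x; apply: casimir_central.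
- by move=> m r hom_r; apply: (casimir_rigid basis_e nondeg gaE giE transc hom_r).
apply: (truncated_approximation basis_e) => [m r hom_r x|[v vP]].
  exact: casimir_central.
pose N := \max_(p <- v) size p.2.
have := cP (inr N); rewrite (unitsP N) //; exists v => [|D r hom_r]; last exact: vP.
by apply/allP => p pv; rewrite /N (big_rem p) //= leq_maxl.
Qed.

Theorem theorem8p5 (R : realType) (g : finLieType R[i]) :
  ~ lie_solvable g \/ has_nonabelian_nilpotent_image g ->
  ~ rank_stable R g.
Proof.
by case=> [/nonsolvable_not_stable|/(@nonabelian_nilpotent_not_stable R R[i])].
Qed.
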